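(* Let $A,S$ be non-negative random variables with $\mathbb{E}[A]=\mathbb{E}[S]=1$. Suppose that $\mathbb{E}[A^2]<\infty$ and $\mathbb{E}[S^{1+\epsilon}]<\infty$ for some $\epsilon\in(0,1]$ (higher moments may or may not exist). Then for all $B>0$ and all integers $n>4B^2$ such that $Q^n_{A,S,B,2}(\infty)$ exists, and for all $x\ge 16$, $$\mathbb{P}\Big(n^{-\frac12}L^n_{A,S,B,2}(\infty)\ge x\Big)\le 10^{100}\Big(\epsilon\big(1-\mathbb{E}[\exp(-S)]\big)\Big)^{-7}\big(10\,\mathbb{E}[S^{1+\epsilon}]\big)^{\frac1\epsilon}(1+\sigma_A^2)(B^{-1}+B^{-2})\,x^{-\frac{\epsilon}{1+\epsilon}}.$$
   Context: $\sigma_A^2=\mathrm{Var}[A]$. For $B>0$, $\alpha>1$ and an integer $n>B^{\frac{\alpha}{\alpha-1}}$, let $\lambda_{n,B,\alpha}=n-Bn^{1/\alpha}$, and let $\mathcal{Q}^n_{A,S,B,\alpha}$ be the first-come-first-served (FCFS) $GI/GI/n$ queue ($n$ identical parallel servers, infinite waiting room) with i.i.d. inter-arrival times distributed as $A/\lambda_{n,B,\alpha}$ and i.i.d. processing times distributed as $S$, independent of the arrivals. If, for any given initial condition, the total number of jobs in the system (in service plus waiting) converges in distribution as time goes to infinity to a (finite) random variable $Q^n_{A,S,B,\alpha}(\infty)$ whose law does not depend on the initial condition, we say that $Q^n_{A,S,B,\alpha}(\infty)$ exists. In that case $L^n_{A,S,B,\alpha}(\infty)=\big(Q^n_{A,S,B,\alpha}(\infty)-n\big)^+$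 is the steady-state number of jobs waiting in queue. Here $\alpha=2$. *)

(* Defs.v *)
(* MathComp / MathComp-Analysis *)
From HB Require Import structures.
From mathcomp Require Import all_boot all_order all_algebra.
From mathcomp Require Import all_classical all_reals all_analysis.
Set Implicit Arguments.
Unset Strict Implicit.
Unset Printing Implicit Defensive.
Import Order.TTheory GRing.Theory Num.Theory.
Import numFieldNormedType.Exports.
Local Open Scope classical_set_scope.
Local Open Scope ring_scope.

Definition same_law (R : realType) (d d' : measure_display)
    (T : measurableType d) (T' : measurableType d')
    (P : probability T R) (P' : probability T' R)
    (X : T -> R) (Y : T' -> R) : Prop :=
  forall U : set R, measurable U -> P (X @^-1` U) = P' (Y @^-1` U).

Definition mutually_independent (R : realType) (d : measure_display)
    (T : measurableType d) (P : probability T R)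
    (I : eqType) (X : I -> {RV P >-> R}) : Prop :=
  forall (J : seq I) (U : I -> set R), uniq J ->
    (forall i, measurable (U i)) ->
    P (\big[setI/setT]_(i <- J) (X i @^-1` U i)) =
    (\prod_(i <- J) P (X i @^-1` U i))%E.

(* [Y t] may be infinite, but its limit [X] is finite. *)
Definition cvg_in_distribution (R : realType) (d d' : measure_display)
    (T : measurableType d) (T' : measurableType d')
    (P : probability T R) (P' : probability T' R)
    (Y : R -> T -> \bar R) (X : {RV P' >-> R}) : Prop :=
  forall y : R, {for y, continuous (cdf X)} ->
    P [set w | (Y t w <= y%:E)%E] @[t --> +oo] --> cdf X y.

(* State at time 0.  Residual processing time 0 encodes an idle server.  The
   processing times of the initially waiting jobs are not part of the state:
   they are the first terms of the i.i.d. sequence of processing times. *)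
Record initial_condition (R : realType) (n : nat) := InitialCondition {
  residual : n.-tuple R;
  waiting : nat;
  first_arrival : R;
  residual_ge0 : forall i, 0 <= tnth residual i;
  waiting_busy : (0 < waiting)%N -> forall i, 0 < tnth residual i;
  first_arrival_ge0 : 0 <= first_arrival }.

(* Sample paths.  Jobs not yet in service at time 0 are numbered 0, 1, 2, ...
   in FCFS order, the initially waiting ones first.  [a i] is the time between
   the (i+1)-th and the (i+2)-th arrival after time 0, and [s k] is the
   processing time of job [k]. *)
Definition arrival_time (R : realType) (n : nat) (c : initial_condition R n)
    (a : nat -> R) (k : nat) : R :=
  if (k < waiting c)%N then 0
  else first_arrival c + \sum_(i < k - waiting c) a i.

(* Sorted times at which the [n] servers have completed the jobs initially in
   service and the jobs 0, ..., k-1; job [k] is served by the server which is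
   free first. *)
Fixpoint server_free_times (R : realType) (n : nat)
    (c : initial_condition R n) (a s : nat -> R) (k : nat) : seq R :=
  if k is j.+1 then
    let F := server_free_times c a s j in
    sort <=%R
      ((Num.max (arrival_time c a j) (head 0 F) + s j) :: behead F)
  else sort <=%R (residual c).

Definition service_start (R : realType) (n : nat) (c : initial_condition R n)
    (a s : nat -> R) (k : nat) : R :=
  Num.max (arrival_time c a k) (head 0 (server_free_times c a s k)).

Definition departure_time (R : realType) (n : nat) (c : initial_condition R n)
    (a s : nat -> R) (k : nat) : R :=
  service_start c a s k + s k.

(* Jobs in service or waiting at time [t].  The value can be [+oo] only if
   infinitely many jobs arrive by time [t], which has probability 0 for i.i.d.
   inter-arrival times with positive mean. *)
Definition jobs_in_system (R : realType) (n : nat) (c : initial_condition R n)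
    (a s : nat -> R) (t : R) : \bar R :=
  ((count (fun r => t < r)%R (residual c))%:R%:E +
   counting [set k : nat |
      (arrival_time c a k <= t < departure_time c a s k)%R])%E.

(* The inter-arrival times [a] have the law of [X], the processing times [s]
   that of [Y], and all of them are mutually independent. *)
Definition GI_GI_primitives (R : realType) (d d' : measure_display)
    (T : measurableType d) (T' : measurableType d')
    (P : probability T R) (P' : probability T' R)
    (X Y : T' -> R) (a s : nat -> {RV P >-> R}) : Prop :=
  [/\ forall k, same_law P P' (a k) X,
      forall k, same_law P P' (s k) Y &
      mutually_independent
        (fun i : nat + nat => match i with inl k => a k | inr k => s k end)].

(* [Q] is the steady-state number of jobs in the FCFS queue with [n] servers.
   Convergence from every deterministic initial condition is equivalent to
   convergence from every random one independent of [a] and [s]. *)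
Definition steady_state (R : realType) (d d' : measure_display)
    (T : measurableType d) (T' : measurableType d')
    (P : probability T R) (P' : probability T' R)
    (n : nat) (a s : nat -> {RV P >-> R}) (Q : {RV P' >-> R}) : Prop :=
  forall c : initial_condition R n,
    cvg_in_distribution P
      (fun t w => jobs_in_system c (fun k => a k w) (fun k => s k w) t) Q.

Definition arrival_rate (R : realType) (n : nat) (B alpha : R) : R :=
  n%:R - B * n%:R `^ alpha^-1.

Definition queue_length (R : realType) (n : nat) (q : R) : R :=
  Num.max (q - n%:R) 0.

(* Main.v *)
(** The queue is dominated by one whose servers never idle: a free server takes a
    dummy job when no real job is waiting.  Scheduling decisions depend only on what
    has been revealed, so the services can be read off [n] independent sequences,
    and if the residual services at time 0 have the excess law of [S], each server
    completes jobs along a stationary renewal process of rate 1.  When more than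
    [n + Y] jobs are present at time [t], the arrivals since some time [s <= t] at
    which no job was waiting exceed the completions of the pool by more than [Y].
    The drift being [- B sqrt n], on the dyadic window of length
    [u = 2^k x / (2 B)] around [t - s] either the arrivals or the pool deviate from
    their means by order [sqrt n B u].  The arrivals are controlled by Kolmogorov's
    maximal inequality.  The pool is controlled by dyadic chaining: on short blocks
    by fourth moments, on long ones by the variance, of order [u^(2 - d)] with
    [d = eps / (1 + eps)], which comes from Wald's identity for truncated services.
    The resulting probabilities are summable in [k] uniformly in [t]; averaging over
    the residual services and letting [t] tend to infinity gives the bound. *)
Require Import Defs.
From HB Require Import structures.
From mathcomp Require Import all_boot all_order all_algebra.
From mathcomp Require Import all_classical all_reals all_analysis.
From mathcomp Require Import measurable_realfun ring lra.
Set Implicit Arguments.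
Unset Strict Implicit.
Unset Printing Implicit Defensive.
Import Order.TTheory GRing.Theory Num.Theory.
Import numFieldNormedType.Exports.
Local Open Scope classical_set_scope.
Local Open Scope ring_scope.

(** * Expectations of bounded functions *)

(** Unbounded and infinite objects are avoided: every expectation is of a bounded function, each
    server is followed for finitely many epochs [M], and interarrival times are cut. The errors
    become as small as desired once the time horizon is fixed.

    The tail index enters only through the truncation level a = (2m)^(1/eps) max(1,v)^(1/(1+eps)),
    where m is the moment of order 1+eps. It loses at most half of the mean service, and the loss
    accumulated over time v is of order a. Hence the count in a block of length v has variance of
    order v a, that is v^(2-d). A window of length u_k then fails with probability of order n
    u_k^(2-d) / (sqrt n B u_k)^2 = B^-2 u_k^-d, geometric in k with ratio 2^-d. This explains x^-d,
    the power B^(d-2) (at most B^-1 + B^-2) and a factor 1/eps.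

    Variances do not survive the union over short blocks, whose number doubles at each level; hence
    fourth moments there. These come from the Chernoff estimate P(sum of q services <= v) <= e^v
    E[exp(-S)]^q, which is where 1 - E[exp(-S)] enters. *)

Section Expectation.
Context d (T : measurableType d) (R : realType) (P : probability T R).
Implicit Types (f g : T -> R) (b c : T -> bool).

(** Closed under ring operations and always integrable, so that linearity and Fubini need no further
    integrability conditions. *)
Definition bounded_measurable f :=
  measurable_fun setT f /\ exists C, forall w, `|f w| <= C.

Lemma bm_cst (r : R) : bounded_measurable (fun=> r).
Proof. by split; [exact: measurable_cst | exists `|r|]. Qed.

Lemma bmD f g : bounded_measurable f -> bounded_measurable g ->
  bounded_measurable (fun w => f w + g w).
Proof.
move=> [mf [C fC]] [mg [D gD]]; split; first exact: measurable_funD.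
exists (C + D) => w; apply: le_trans (ler_normD _ _) _; exact: lerD.
Qed.

Lemma bmM f g : bounded_measurable f -> bounded_measurable g ->
  bounded_measurable (fun w => f w * g w).
Proof.
move=> [mf [C fC]] [mg [D gD]]; split; first exact: measurable_funM.
by exists (C * D) => w; rewrite normrM ler_pM.
Qed.

Lemma bmN f : bounded_measurable f -> bounded_measurable (fun w => - f w).
Proof.
move=> [mf [C fC]]; split; last by exists C => w; rewrite normrN.
exact: measurableT_comp.
Qed.

Lemma bmB f g : bounded_measurable f -> bounded_measurable g ->
  bounded_measurable (fun w => f w - g w).
Proof. by move=> bf bg; apply: bmD => //; exact: bmN. Qed.

Lemma bmX f k : bounded_measurable f -> bounded_measurable (fun w => f w ^+ k).
Proof.
move=> bf; elim: k => [|k IH]; first exact: bm_cst.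
by under eq_fun do rewrite exprS; apply: bmM.
Qed.

Lemma bm_sum I (r : seq I) (p : pred I) (F : I -> T -> R) :
  (forall i, p i -> bounded_measurable (F i)) ->
  bounded_measurable (fun w => \sum_(i <- r | p i) F i w).
Proof.
move=> bF; elim: r => [|i r IH].
  by under eq_fun do rewrite big_nil; exact: bm_cst.
under eq_fun do rewrite big_cons.
case: (boolP (p i)) => // pi; apply: bmD => //; exact: bF.
Qed.

Lemma measurable_indicator b : measurable_fun setT b ->
  measurable_fun setT (fun w => (b w)%:R : R).
Proof.
move=> mb; rewrite (_ : (fun w => _) = (fun w => if b w then 1 else 0)).
  by apply: measurable_fun_ifT.
by apply/funext => w; case: (b w).
Qed.

Lemma bm_indicator b : measurable_fun setT b ->
  bounded_measurable (fun w => (b w)%:R).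
Proof.
move=> mb; split; first exact: measurable_indicator.
by exists 1 => w; case: (b w); rewrite ?normr1 ?normr0.
Qed.

Lemma bm_between f (a c : R) : measurable_fun setT f ->
  (forall w, a <= f w <= c) -> bounded_measurable f.
Proof.
move=> mf fac; split=> //; exists (`|a| + `|c|) => w.
have /andP[af fc] := fac w; rewrite ler_norml.
have := ler_norm c; have := ler_normr (- a) a; have := normr_ge0 a.
have := normr_ge0 c; have := ler_norm (- a); rewrite normrN; lra.
Qed.

Lemma bm_integrable f : bounded_measurable f -> P.-integrable setT (EFin \o f).
Proof.
move=> [mf [C fC]]; apply: measurable_bounded_integrable => //.
  exact: le_lt_trans (probability_le1 P measurableT) (ltry 1).
exists C; split; first exact: num_real.
by move=> M CM x _ /=; exact: le_trans (fC x) (ltW CM).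
Qed.

Definition Ex f : R := \int[P]_w f w.
Definition Pr b : R := Ex (fun w => (b w)%:R).

Lemma eq_Ex f g : f =1 g -> Ex f = Ex g.
Proof. by move=> /funext ->. Qed.

Lemma Ex_cst (r : R) : Ex (fun=> r) = r.
Proof.
have P1 : fine (P setT) = 1 by rewrite probability_setT.
by rewrite /Ex Rintegral_cst// P1 mulr1.
Qed.

Lemma le_Ex f g : bounded_measurable f -> bounded_measurable g ->
  (forall w, f w <= g w) -> Ex f <= Ex g.
Proof. by move=> bf bg fg; apply: le_Rintegral => //; exact: bm_integrable. Qed.

Lemma Ex_ge0 f : (forall w, 0 <= f w) -> 0 <= Ex f.
Proof. by move=> f0; apply: Rintegral_ge0. Qed.

Lemma Ex_le f (r : R) : bounded_measurable f -> (forall w, f w <= r) -> Ex f <= r.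
Proof.
by move=> bf fr; rewrite -[leRHS]Ex_cst; apply: le_Ex => //; exact: bm_cst.
Qed.

Lemma ExD f g : bounded_measurable f -> bounded_measurable g ->
  Ex (fun w => f w + g w) = Ex f + Ex g.
Proof. by move=> bf bg; rewrite /Ex RintegralD//; exact: bm_integrable. Qed.

Lemma ExB f g : bounded_measurable f -> bounded_measurable g ->
  Ex (fun w => f w - g w) = Ex f - Ex g.
Proof. by move=> bf bg; rewrite /Ex RintegralB//; exact: bm_integrable. Qed.

Lemma ExZ f (r : R) : bounded_measurable f ->
  Ex (fun w => r * f w) = r * Ex f.
Proof. by move=> bf; rewrite /Ex RintegralZl//; exact: bm_integrable. Qed.

Lemma Ex_sum I (r : seq I) (p : pred I) (F : I -> T -> R) :
  (forall i, p i -> bounded_measurable (F i)) ->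
  Ex (fun w => \sum_(i <- r | p i) F i w) = \sum_(i <- r | p i) Ex (F i).
Proof.
move=> bF; elim: r => [|i r IH].
  by under eq_Ex do rewrite big_nil; rewrite Ex_cst big_nil.
under eq_Ex do rewrite big_cons; rewrite big_cons -IH.
case: (boolP (p i)) => // pi; rewrite ExD //; first exact: bF.
exact: bm_sum.
Qed.

Lemma Pr_ge0 b : 0 <= Pr b.
Proof. by apply: Ex_ge0 => w; rewrite ler0n. Qed.

Lemma Pr_le1 b : measurable_fun setT b -> Pr b <= 1.
Proof.
by move=> mb; apply: Ex_le => [|w]; [exact: bm_indicator | case: (b w)].
Qed.

Lemma le_Pr b c : measurable_fun setT b -> measurable_fun setT c ->
  (forall w, b w -> c w) -> Pr b <= Pr c.
Proof.
move=> mb mc bc; apply: le_Ex; try exact: bm_indicator.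
by move=> w; move: (bc w); case: (b w) => [->//|_]; rewrite ler0n.
Qed.

Lemma Pr_le_sum I (r : seq I) b (c : I -> T -> bool) :
  measurable_fun setT b -> (forall i, measurable_fun setT (c i)) ->
  (forall w, b w -> has (c^~ w) r) -> Pr b <= \sum_(i <- r) Pr (c i).
Proof.
move=> mb mc bc; rewrite -Ex_sum; last by move=> i _; exact: bm_indicator.
apply: le_Ex; first exact: bm_indicator.
  by apply: bm_sum => i _; exact: bm_indicator.
move=> w; case: (boolP (b w)) => [/bc|_]; last first.
  by apply: sumr_ge0 => i _; rewrite ler0n.
elim: r {bc} => //= i r IH /orP[ci|/IH {}IH]; rewrite big_cons.
  by rewrite ci lerDl; apply: sumr_ge0 => j _; rewrite ler0n.
by apply: le_trans IH _; rewrite lerDr ler0n.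
Qed.

Lemma Pr_or b c : measurable_fun setT b -> measurable_fun setT c ->
  Pr (fun w => b w || c w) <= Pr b + Pr c.
Proof.
move=> mb mc; rewrite -ExD; try exact: bm_indicator.
apply: le_Ex; first by apply: bm_indicator; exact: measurable_or.
  by apply: bmD; exact: bm_indicator.
by move=> w; case: (b w); case: (c w); rewrite /= ?addr0 ?add0r// -natrD ler_nat.
Qed.

Lemma Pr_neg b : measurable_fun setT b -> Pr (fun w => ~~ b w) = 1 - Pr b.
Proof.
move=> mb; rewrite -[in RHS](Ex_cst 1) -ExB; [|exact: bm_cst|exact: bm_indicator].
by apply: eq_Ex => w; case: (b w); rewrite ?subrr ?subr0.
Qed.

Lemma markov_Pr f (a : R) : bounded_measurable f -> (forall w, 0 <= f w) ->
  0 < a -> Pr (fun w => a <= f w) <= Ex f / a.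
Proof.
move=> bf f0 a0; rewrite ler_pdivlMr// mulrC -ExZ; last first.
  by apply: bm_indicator; apply: measurable_fun_ler => //; case: bf.
apply: le_Ex => //.
  apply: bmM; first exact: bm_cst.
  by apply: bm_indicator; apply: measurable_fun_ler => //; case: bf.
by move=> w; case: (leP a (f w)) => h; rewrite ?mulr1 ?mulr0.
Qed.

Lemma PrE b : measurable_fun setT b -> P [set w | b w] = (Pr b)%:E.
Proof.
move=> mb; have mB : measurable [set w | b w].
  by have := mb measurableT [set true]; rewrite setTI; apply.
rewrite /Pr /Ex /Rintegral.
rewrite (eq_integral (fun w => (\1_[set w | b w] w)%:E)); last first.
  by move=> w _; rewrite indicE mem_setE.
by rewrite integral_indic// setIT fineK// fin_num_measure.
Qed.

Lemma cvg_Ex (f : nat -> T -> R) (g : T -> R) (C : R) :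
  (forall k, measurable_fun setT (f k)) -> measurable_fun setT g ->
  (forall k w, `|f k w| <= C) ->
  (forall w, f ^~ w @ \oo --> g w) ->
  Ex (f k) @[k --> \oo] --> Ex g.
Proof.
move=> mf mg fC fg.
have gC w : `|g w| <= C.
  have h : `|f k w| @[k --> \oo] --> `|g w| by apply: cvg_norm; exact: fg.
  by rewrite -(cvg_lim _ h)//; apply: limr_le; [exact: cvgP h | exact: nearW].
have bf k : bounded_measurable (f k) by split=> //; exists C.
have bg : bounded_measurable g by split=> //; exists C.
have [] := @dominated_convergence _ _ _ P setT measurableT
  (fun k => EFin \o f k) (EFin \o g) (fun=> C%:E).
- by move=> k; apply/measurable_EFinP.
- exact/measurable_EFinP.
- by apply: aeW => w _; apply: cvg_EFin; [exact: nearW|exact: fg].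
- by apply: (bm_integrable (bm_cst C)).
- by apply: aeW => w k _ /=; rewrite lee_fin.
move=> _ _ h; rewrite /Ex /Rintegral.
apply: fine_cvg; rewrite fineK //; exact: integrable_fin_num (bm_integrable bg).
Qed.

End Expectation.

Lemma Ex_bounded_prod d1 d2 (T1 : measurableType d1) (T2 : measurableType d2)
    (R : realType) (P1 : probability T1 R) (P2 : probability T2 R)
    (f : T1 * T2 -> R) : bounded_measurable f ->
  Ex (P1 \x P2)%E f = Ex P1 (fun x => Ex P2 (fun y => f (x, y))).
Proof.
move=> bf; have fi := bm_integrable (P1 \x P2)%E bf.
rewrite /Ex /Rintegral -integral12_prod_meas1//; congr fine.
apply: eq_integral => x _; rewrite /fubini_F /= fineK //.
apply: integrable_fin_num => //; apply: bm_integrable.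
case: bf => mf [C fC]; split; last by exists C.
by apply: measurableT_comp => //; exact: pair1_measurable.
Qed.

Lemma bm_Ex_section d1 d2 (T1 : measurableType d1) (T2 : measurableType d2)
    (R : realType) (P2 : probability T2 R)
    (f : T1 * T2 -> R) : bounded_measurable f ->
  bounded_measurable (fun x => Ex P2 (fun y => f (x, y))).
Proof.
move=> bf; have [mf [C fC]] := bf.
have bs x : bounded_measurable (fun y => f (x, y)).
  split; last by exists C.
  by apply: measurableT_comp => //; exact: pair1_measurable.
split.
  (* Tonelli wants a nonnegative integrand: the bound [C] is added first and subtracted
     afterwards. *)
  rewrite (_ : (fun x => _) =
     fun x => Ex P2 (fun y => f (x, y) + C) - C); last first.
    by apply/funext => x; rewrite ExD ?Ex_cst ?addrK//; exact: bm_cst.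
  apply: measurable_funB => //; apply: measurableT_comp => //=.
  apply: (@measurable_fun_fubini_tonelli_F _ _ _ _ _ P2 (fun z => (f z + C)%:E)).
    by apply/measurable_EFinP; apply: measurable_funD.
  by move=> z; rewrite lee_fin; have := fC z; rewrite ler_norml => /andP[]; lra.
exists C => x; rewrite ler_norml; apply/andP; split.
  rewrite -[leLHS](Ex_cst P2); apply: le_Ex => //; first exact: bm_cst.
  by move=> y; have := fC (x, y); rewrite ler_norml => /andP[].
by apply: Ex_le => // y; have := fC (x, y); rewrite ler_norml => /andP[].
Qed.

(** * Product measures on path spaces *)

(** Finite intersections rather than single-coordinate sets: they form a pi-system, so a law is
    determined by its values on them, and mutual independence speaks of exactly these sets. *)
Definition cylinders (I : eqType) (R : realType) : set (set (I -> R)) :=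
  [set E | exists J : seq I, exists U : I -> set R,
     [/\ uniq J, forall i, measurable (U i) &
         E = \big[setI/setT]_(i <- J) [set w | U i (w i)]]].

Notation "{ 'paths' I -> R }" :=
  (g_sigma_algebraType (@cylinders I R))
  (at level 0, I at level 98, R at level 99, format "{ 'paths'  I  ->  R }").

Section Coordinates.
Context (I : eqType) (R : realType).
Local Notation W := {paths I -> R}.
Implicit Types (K : pred I) (J : seq I) (U : I -> set R).

Definition cylinder J U : set (I -> R) := \big[setI/setT]_(i <- J) [set w | U i (w i)].

Lemma cylinderE J U w : cylinder J U w <-> (forall i, i \in J -> U i (w i)).
Proof.
rewrite /cylinder; elim: J => [|j J IH]; first by rewrite big_nil.
rewrite big_cons; split=> [[Uj /IH UJ] i|UJ].
  by rewrite inE => /predU1P[->//|]; exact: UJ.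
split; first by apply: UJ; rewrite mem_head.
by apply/IH => i iJ; apply: UJ; rewrite inE iJ orbT.
Qed.

Lemma measurable_cylinder J U : uniq J -> (forall i, measurable (U i)) ->
  measurable (cylinder J U : set W).
Proof. by move=> uJ mU; apply: sub_sigma_algebra; exists J, U. Qed.

Lemma setI_closed_cylinders : setI_closed (@cylinders I R).
Proof.
move=> _ _ [J [U [uJ mU ->]]] [J' [U' [uJ' mU' ->]]].
pose V i := (if i \in J then U i else setT) `&` (if i \in J' then U' i else setT).
exists (undup (J ++ J')), V; split; first exact: undup_uniq.
  by move=> i; apply: measurableI; case: ifP.
rewrite -!/(cylinder _ _); apply/seteqP; split=> w.
  move=> [/cylinderE UJ /cylinderE UJ'].
  apply/cylinderE => i _; split; case: ifP => //; [exact: UJ|exact: UJ'].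
move/cylinderE => /= H; split; apply/cylinderE => i iJ.
  by have [|+ _] := H i; rewrite ?mem_undup ?mem_cat ?iJ.
by have [|_ +] := H i; rewrite ?mem_undup ?mem_cat ?iJ ?orbT.
Qed.

Lemma measurable_coordinate i : measurable_fun setT (fun w : W => w i).
Proof.
move=> _ U mU; rewrite setTI.
rewrite (_ : _ @^-1` _ = cylinder [:: i] (fun=> U)).
  exact: measurable_cylinder.
apply/seteqP; split=> w.
  by move=> Uw; apply/cylinderE => j; rewrite inE => /eqP ->.
by move/cylinderE/(_ i); rewrite mem_head; apply.
Qed.

Lemma measurable_to_paths d (T : measurableType d) (f : T -> W) :
  (forall i, measurable_fun setT (fun t => f t i)) -> measurable_fun setT f.
Proof.
move=> mf; apply: (@measurability _ _ T W setT f (@cylinders I R) erefl).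
move=> _ [_ [J [U [uJ mU ->]] <-]]; rewrite setTI.
elim: J {uJ} => [|i J IH]; first by rewrite big_nil preimage_setT.
rewrite big_cons preimage_setI; apply: measurableI => //.
by have := mf i measurableT (U i) (mU i); rewrite setTI.
Qed.

Section ProductLaw.
Variable L : I -> probability R R.

(** Nothing is asked of the coordinates outside [K], so that two such laws for complementary [K] can
    be glued by [mix_law]. *)
Definition product_law K (mu : probability W R) :=
  forall J U, uniq J -> all K J -> (forall i, measurable (U i)) ->
  mu (cylinder J U) = (\prod_(i <- J) L i (U i))%E.

Lemma product_law_unique (mu nu : probability W R) :
  product_law predT mu -> product_law predT nu ->
  forall E, measurable E -> mu E = nu E.
Proof.
move=> hmu hnu E mE.
apply: (@measure_unique _ R W (@cylinders I R) (fun=> setT)) => //.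
- exact: setI_closed_cylinders.
- by move=> _; exists [::], (fun=> setT); rewrite big_nil.
- by rewrite bigcup_const.
- move=> _ [J [U [uJ mU ->]]].
  exact: etrans (hmu J U uJ (all_predT J) mU) (esym (hnu J U uJ (all_predT J) mU)).
- by move=> _; exact: le_lt_trans (probability_le1 _ _) (ltry 1).
Qed.

Lemma Ex_law_unique (mu nu : probability W R) f :
  product_law predT mu -> product_law predT nu -> bounded_measurable f ->
  Ex mu f = Ex nu f.
Proof.
move=> hmu hnu bf; rewrite /Ex /Rintegral; congr fine.
by apply: eq_measure_integral => E mE _; exact: product_law_unique.
Qed.

End ProductLaw.

Section Pushforward.
Context d (T : measurableType d) (P : probability T R) (f : T -> W).
Hypothesis mf : forall i, measurable_fun setT (fun t => f t i).

Lemma path_rv_measurable : measurable_fun setT f.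
Proof. exact: measurable_to_paths. Qed.

HB.instance Definition _ := isMeasurableFun.Build _ _ _ _ f path_rv_measurable.

Definition path_law : probability W R := distribution P f.

Lemma Ex_path_law g : bounded_measurable g -> Ex path_law g = Ex P (g \o f).
Proof.
move=> bg; rewrite /Ex /Rintegral; congr fine.
rewrite /path_law integral_distribution //; first by apply/measurable_EFinP; case: bg.
apply: (@bm_integrable _ _ _ _ (g \o f)); case: bg => mg [C gC].
split; last by exists C => t; exact: gC.
exact: measurableT_comp mg path_rv_measurable.
Qed.

End Pushforward.

Definition mix K (w w' : W) : W := fun i => if K i then w i else w' i.

Lemma measurable_mix K i :
  measurable_fun setT (fun z : W * W => mix K z.1 z.2 i).
Proof.
rewrite /mix; case: (K i).
  exact: (measurableT_comp (measurable_coordinate i) measurable_fst).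
exact: (measurableT_comp (measurable_coordinate i) measurable_snd).
Qed.

Definition mix_law K (mu nu : probability W R) : probability W R :=
  path_law (mu \x nu)%E (measurable_mix K).

Lemma product_law_mix L K mu nu :
  product_law L K mu -> product_law L (predC K) nu ->
  product_law L predT (mix_law K mu nu).
Proof.
move=> hmu hnu J U uJ _ mU.
transitivity ((mu \x nu)%E
    (cylinder (seq.filter K J) U `*` cylinder (seq.filter (predC K) J) U)); last first.
  rewrite product_measure1E; [|exact: measurable_cylinder (filter_uniq _ uJ) mU..].
  rewrite [RHS](bigID K) /=; congr (_ * _)%E.
    by rewrite -big_filter; exact: hmu (filter_uniq _ uJ) (filter_all _ _) mU.
  by rewrite -big_filter; exact: hnu (filter_uniq _ uJ) (filter_all _ _) mU.
apply: (congr1 (mu \x nu)%E).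
apply/seteqP; split=> [[w w'] /= /cylinderE H|[w w'] /= [/cylinderE H /cylinderE H']].
  split; apply/cylinderE => i; rewrite mem_filter => /andP[Ki iJ].
    by have := H i iJ; rewrite /mix Ki.
  by have := H i iJ; rewrite /mix (negbTE Ki).
apply/cylinderE => i iJ; rewrite /mix; case: ifPn => Ki.
  by apply: H; rewrite mem_filter Ki.
by apply: H'; rewrite mem_filter /= Ki.
Qed.

Lemma Ex_mix_law K mu nu f : bounded_measurable f ->
  Ex (mix_law K mu nu) f = Ex mu (fun w => Ex nu (fun w' => f (mix K w w'))).
Proof.
move=> bf; rewrite /mix_law Ex_path_law // Ex_bounded_prod //.
case: bf => mf [C fC]; split; last by exists C => z; exact: fC.
apply: measurableT_comp => //; exact: measurable_to_paths (measurable_mix K).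
Qed.

(** Pointwise substitute for measurability with respect to the coordinates in [K]. *)
Definition depends_on K (S : Type) (f : W -> S) :=
  forall w w', (forall i, K i -> w i = w' i) -> f w = f w'.

Lemma depends_on_comp K S S' (h : S -> S') f :
  depends_on K f -> depends_on K (fun w => h (f w)).
Proof. by move=> df w w' e; rewrite (df _ _ e). Qed.

Section Independence.
Context (L : I -> probability R R) (mu : probability W R).
Hypothesis mu_law : product_law L predT mu.

(** This is conditioning: the inner expectation is the conditional one given the coordinates in [K].
    It holds because two independent copies mixed along [K] again have the product law. *)
Lemma Ex_mix K f : bounded_measurable f ->
  Ex mu f = Ex mu (fun w => Ex mu (fun w' => f (mix K w w'))).
Proof.
move=> bf; rewrite -Ex_mix_law//; apply: (Ex_law_unique mu_law _ bf).
by apply: product_law_mix => J U uJ _ mU; apply: mu_law => //; exact: all_predT.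
Qed.

Lemma bm_mix K (f : W -> R) w : bounded_measurable f ->
  bounded_measurable (fun w' => f (mix K w w')).
Proof.
move=> [mf [C fC]]; split; last by exists C => z; exact: fC.
apply: measurableT_comp => //; apply: measurable_to_paths => i.
rewrite /mix; case: (K i); first exact: measurable_cst.
exact: measurable_coordinate.
Qed.

Lemma bm_Ex_mix K (f : W -> R) : bounded_measurable f ->
  bounded_measurable (fun w => Ex mu (fun w' => f (mix K w w'))).
Proof.
move=> [mf [C fC]].
apply: (@bm_Ex_section _ _ W W R mu (fun z => f (mix K z.1 z.2))).
split; last by exists C => z; exact: fC.
apply: measurableT_comp => //; exact: measurable_to_paths (measurable_mix K).
Qed.

Lemma Ex_indep K (f g : W -> R) : bounded_measurable f -> bounded_measurable g ->
  depends_on K f -> depends_on (predC K) g ->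
  Ex mu (fun w => f w * g w) = Ex mu f * Ex mu g.
Proof.
move=> bf bg df dg; rewrite (Ex_mix K (bmM bf bg)).
have e1 w w' : f (mix K w w') = f w by apply: df => i Ki; rewrite /mix Ki.
have e2 w w' : g (mix K w w') = g w'.
  by apply: dg => i /= Ki; rewrite /mix (negbTE Ki).
under eq_Ex do under eq_Ex do rewrite e1 e2.
under eq_Ex do rewrite ExZ// mulrC.
by rewrite ExZ// mulrC.
Qed.

Definition swap (i j : I) (w : W) : W :=
  fun k => if k == i then w j else if k == j then w i else w k.

Lemma swapK i j : involutive (swap i j).
Proof.
move=> w; apply/funext => k; rewrite /swap eqxx.
have [->|ki] := eqVneq k i; first by case: eqVneq => [->|//]; rewrite ?eqxx.
by have [->|kj] := eqVneq k j; rewrite ?eqxx.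
Qed.

Lemma measurable_swap i j k : measurable_fun setT (fun w => swap i j w k).
Proof.
rewrite /swap; case: (k == i); first exact: measurable_coordinate.
by case: (k == j); exact: measurable_coordinate.
Qed.

Lemma product_law_swap i j : L i = L j ->
  product_law L predT (path_law mu (measurable_swap i j)).
Proof.
move=> Lij J U uJ _ mU.
pose s k := if k == i then j else if k == j then i else k.
have sK : involutive s.
  move=> k; rewrite /s; have [->|ki] := eqVneq k i.
    by case: eqVneq => [->|//]; rewrite ?eqxx.
  by have [->|kj] := eqVneq k j; rewrite ?eqxx// (negbTE ki) (negbTE kj).
have sw w k : swap i j w k = w (s k).
  by rewrite /swap /s; do 2?case: ifP.
transitivity (mu (cylinder (map s J) (U \o s))).
  apply: (congr1 mu); apply/seteqP; split=> w /=.
    move=> /cylinderE H; apply/cylinderE => _ /mapP[k kJ ->] /=.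
    by rewrite sK -sw; exact: H.
  move=> /cylinderE H; apply/cylinderE => k kJ.
  by have := H _ (map_f s kJ); rewrite /= sK sw.
rewrite mu_law ?all_predT//; last first.
- by move=> k; exact: mU.
- by rewrite map_inj_uniq//; exact: inv_inj.
rewrite big_map; apply: eq_bigr => k _; rewrite /= sK.
suff -> : L (s k) = L k by [].
by rewrite /s; have [->|_] := eqVneq k i => //; have [->|] := eqVneq k j.
Qed.

Lemma Ex_swap i j (f : W -> R) : L i = L j -> bounded_measurable f ->
  Ex mu (fun w => f (swap i j w)) = Ex mu f.
Proof.
move=> Lij bf; rewrite -(Ex_law_unique (product_law_swap Lij) mu_law bf).
by rewrite Ex_path_law.
Qed.

Lemma Ex_coordinate i (g : R -> R) : bounded_measurable (fun w : W => g (w i)) ->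
  bounded_measurable g ->
  Ex mu (fun w => g (w i)) = Ex (L i) g.
Proof.
move=> bf [mg [C gC]].
have e E : measurable E -> mu [set w | E (w i)] = L i E.
  move=> mE; have := mu_law (J := [:: i]) (U := fun=> E) erefl erefl (fun=> mE).
  rewrite big_seq1 => <-; congr (mu _); apply/seteqP; split=> w.
    by move=> Ew; apply/cylinderE => j; rewrite inE => /eqP ->.
  by move/cylinderE/(_ i); rewrite mem_head; apply.
have mi : measurable_fun setT (fun w : W => w i) by exact: measurable_coordinate.
rewrite /Ex /Rintegral; congr fine.
pose X := MeasurableFun.Pack (MeasurableFun.Class (isMeasurableFun.Build _ _ _ _ _ mi)).
have := @integral_distribution _ _ _ _ R mu X (EFin \o g).
rewrite /= => <-; first by apply: eq_measure_integral => E mE _; exact: (e E mE).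
  exact/measurable_EFinP.
exact: bm_integrable.
Qed.

End Independence.
End Coordinates.

(** Makes times nonnegative on every path instead of almost every one, so that the pathwise
    arguments involve no null sets. *)
Definition pos (I : Type) (R : realType) (w : I -> R) (i : I) : R := Num.max (w i) 0.

Lemma pos_ge0 (I : Type) (R : realType) (w : I -> R) i : 0 <= pos w i.
Proof. by rewrite /pos le_max lexx orbT. Qed.

(** * Elementary facts on sums and powers *)

Section RealLemmas.
Variable R : realType.
Implicit Types (x y u v z : R).

(** Each off-diagonal pair is listed from its smaller index. For indicators of epochs this lets
    later epochs be counted from an earlier one, where the process renews. *)
Lemma sum_square_ordered (y : nat -> R) M :
  (\sum_(m < M) y m) ^+ 2 =
  \sum_(m < M) y m * (2 * (\sum_(m <= j < M) y j) - y m).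
Proof.
elim: M => [|M IH]; first by rewrite !big_ord0 expr0n.
rewrite !big_ord_recr /= sqrrD IH big_nat1.
under [in RHS]eq_bigr => m _.
  rewrite (@big_nat_recr _ _ _ M m) ?(ltnW (ltn_ord m))//=.
  rewrite (_ : _ * _ = y m * (2 * (\sum_(m <= j < M) y j) - y m) + 2 * y M * y m).
  over. ring.
by rewrite big_split /= -mulr_sumr; ring.
Qed.

(** The pathwise content of Wald's identity: the steps before the passage over [v] add up to at most
    [v], and the crossing step contributes at most the cut [c]. *)
Lemma truncated_first_passage (z : nat -> R) (v c : R) Q :
  (forall q, 0 <= z q) -> 0 <= v -> 0 <= c ->
  \sum_(q < Q) (\sum_(l < q) z l <= v)%R%:R * Num.min (z q) c <= v + c.
Proof.
move=> z0 v0 c0.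
have leD Q' : \sum_(q < Q') (\sum_(l < q) z l <= v)%R%:R * Num.min (z q) c <=
    \sum_(q < Q') z q.
  apply: ler_sum => q _; rewrite -[leRHS]mul1r.
  apply: ler_pM => //; first by rewrite le_min z0.
    by case: (_ <= v).
  by rewrite ge_min lexx.
elim: Q => [|Q IH]; first by rewrite big_ord0 addr_ge0.
rewrite big_ord_recr /=; case: (leP (\sum_(l < Q) z l) v) => h.
  rewrite mul1r; apply: lerD; first exact: le_trans (leD Q) h.
  by rewrite ge_min lexx orbT.
by rewrite mul0r addr0.
Qed.

(** u - x is the integral over [0, u] of the indicator of x <= v. This indicator increases in v, so
    right endpoints overestimate it. *)
Lemma riemann_excess (u x : R) J : 0 <= u -> 0 <= x -> x <= u -> (0 < J)%N ->
  u - x <= \sum_(j < J) u / J%:R * (x <= u / J%:R * j.+1%:R)%R%:R.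
Proof.
move=> u0 x0 xu J0; set h := u / J%:R.
have h0 : 0 <= h by rewrite divr_ge0.
pose f (j : nat) : R := Num.max (h * j%:R - x) 0.
have fJ : f J = u - x.
  rewrite /f /h divfK ?pnatr_eq0 -?lt0n//.
  by apply/max_idPl; rewrite subr_ge0.
have f0 : f 0%N = 0 by rewrite /f mulr0 sub0r; apply/max_idPr; rewrite oppr_le0.
have -> : u - x = \sum_(j < J) (f j.+1 - f j).
  by rewrite -(big_mkord xpredT (fun j => f j.+1 - f j)) telescope_sumr// fJ f0 subr0.
apply: ler_sum => j _; rewrite /f -natr1 mulrDr mulr1.
case: (leP x) => hx; rewrite ?mulr1 ?mulr0.
  by rewrite /Num.max; case: ltrP => h1; case: ltrP => h2; lra.
by rewrite /Num.max; case: ltrP => h1; case: ltrP => h2; lra.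
Qed.

(** Partial sums of the negative binomial series: by Pascal's rule, multiplying by 1 - x lowers r by
    one up to a nonnegative boundary term. *)
Lemma sum_binomial_geometric r K x : 0 <= x < 1 ->
  \sum_(k < K) 'C(k + r, r)%:R * x ^+ k <= (1 - x) ^- r.+1.
Proof.
move=> /andP[x0 x1]; have x1' : 0 < 1 - x by rewrite subr_gt0.
elim: r => [|r IH].
  have e : (\sum_(k < K) 'C(k + 0, 0)%:R * x ^+ k) * (1 - x) + x ^+ K = 1.
    elim: K => [|K IH]; first by rewrite big_ord0 mul0r add0r.
    by rewrite big_ord_recr /= -[RHS]IH bin0 exprS; ring.
  rewrite expr1 -[leRHS]mul1r ler_pdivlMr// -[leRHS]e lerDl; exact: exprn_ge0.
have e : (\sum_(k < K) 'C(k + r.+1, r.+1)%:R * x ^+ k) * (1 - x)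
    + 'C(K + r, r.+1)%:R * x ^+ K = \sum_(k < K) 'C(k + r, r)%:R * x ^+ k.
  elim: K {IH} => [|K IH].
    by rewrite !big_ord0 add0n bin_small// !mul0r add0r.
  by rewrite !big_ord_recr /= -[in RHS]IH addnS addSn binS natrD exprS; ring.
rewrite [_ ^+ r.+2]exprSr invfM ler_pdivlMr//; apply: le_trans IH.
by rewrite -[leRHS]e lerDl mulr_ge0// exprn_ge0.
Qed.

(** The layer-cake formula, which turns tail bounds for a count into moment bounds. *)
Lemma nat_power_layers p (N M : nat) : (N <= M)%N -> (0 < p)%N ->
  (N%:R : R) ^+ p = \sum_(k < M) (k.+1%:R ^+ p - k%:R ^+ p) * (k < N)%N%:R.
Proof.
move=> NM p0.
have e N' : \sum_(k < N') ((k.+1%:R : R) ^+ p - k%:R ^+ p) = N'%:R ^+ p.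
  elim: N' => [|N' IH]; first by rewrite big_ord0 expr0n gtn_eqF.
  by rewrite big_ord_recr /= IH subrKC.
rewrite -(big_mkord xpredT (fun k => (k.+1%:R ^+ p - k%:R ^+ p) * (k < N)%N%:R)).
rewrite (@big_cat_nat _ _ _ N)//= [X in _ + X]big_nat_cond [X in _ + X]big1.
  rewrite addr0 big_mkord -e; apply: eq_bigr => k _.
  by rewrite ltn_ord mulr1.
by move=> k /andP[/andP[Nk _] _]; rewrite ltnNge Nk mulr0.
Qed.

Lemma square_layer_le (k : nat) :
  (k.+1%:R : R) ^+ 2 - k%:R ^+ 2 <= 2 * 'C(k + 1, 1)%:R.
Proof.
rewrite bin1 addn1 -natr1; have := ler0n R k; move: (k%:R) => y y0.
by rewrite !expr2; nra.
Qed.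

(** The right side is 4(k+1)(k+2)(k+3), which exceeds the bound 4(k+1)^3 of the mean value theorem.
    The binomial form is the one that [sum_binomial_geometric] sums. *)
Lemma fourth_layer_le (k : nat) :
  (k.+1%:R : R) ^+ 4 - k%:R ^+ 4 <= 24 * 'C(k + 3, 3)%:R.
Proof.
have e : ('C(k + 3, 3) * 6 = k.+3 * k.+2 * k.+1)%N.
  by rewrite (bin_ffact (k + 3) 3) addn3 !ffactnS ffactn0 /= muln1 mulnA.
have -> : 24 * 'C(k + 3, 3)%:R = 4 * (k.+3 * k.+2 * k.+1)%:R :> R.
  by rewrite -e natrM; ring.
rewrite !natrM -!natr1; have := ler0n R k; move: (k%:R) => y y0.
have y3 : 0 <= y ^+ 3 by exact: exprn_ge0.
have y2 : 0 <= y ^+ 2 by exact: exprn_ge0.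
rewrite -subr_ge0 (_ : _ - _ = 18 * y ^+ 2 + 40 * y + 23); last by ring.
lra.
Qed.

End RealLemmas.

(** * Renewal counts of one server *)

Section Renewal.
Context (I : eqType) (R : realType) (L : I -> probability R R).
Local Notation W := {paths I -> R}.
Context (mu : probability W R) (mu_law : product_law L predT mu).
Context (c : nat -> I) (c_inj : injective c) (F : probability R R).
Context (LF : forall m, L (c m.+1) = F).

(** Coordinate [c 0] carries the residual service at time 0, and [c m.+1] the service that separates
    epochs [m] and [m.+1]. *)
Definition service (m : nat) (w : W) : R := pos w (c m.+1).
Definition delay (m q : nat) (w : W) : R := \sum_(l < q) service (m + l) w.
Definition epoch (m : nat) (w : W) : R := pos w (c 0%N) + delay 0 m w.

Lemma service_ge0 m w : 0 <= service m w. Proof. exact: pos_ge0. Qed.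

Lemma delay_ge0 m q w : 0 <= delay m q w.
Proof. by apply: sumr_ge0 => l _; exact: service_ge0. Qed.

Lemma epoch_ge0 m w : 0 <= epoch m w.
Proof. by rewrite addr_ge0 ?pos_ge0// delay_ge0. Qed.

Lemma delay0 m w : delay m 0 w = 0. Proof. by rewrite /delay big_ord0. Qed.

Lemma delayS m q w : delay m q.+1 w = delay m q w + service (m + q) w.
Proof. by rewrite /delay big_ord_recr. Qed.

Lemma epochD m q w : epoch (m + q) w = epoch m w + delay m q w.
Proof.
elim: q => [|q IH]; first by rewrite addn0 delay0 addr0.
by rewrite addnS delayS addrA -IH /epoch delayS addrA add0n.
Qed.

Lemma epoch_mono w : {homo epoch^~ w : m k / (m <= k)%N >-> m <= k}.
Proof. by move=> m k mk; rewrite -(subnKC mk) epochD lerDl delay_ge0. Qed.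

Lemma measurable_pos i : measurable_fun setT (fun w : W => pos w i).
Proof. exact: measurable_maxr (measurable_coordinate i) (measurable_cst _). Qed.

Lemma measurable_delay m q : measurable_fun setT (delay m q).
Proof. by apply: measurable_sum => l; exact: measurable_pos. Qed.

Lemma measurable_epoch m : measurable_fun setT (epoch m).
Proof. apply: measurable_funD; [exact: measurable_pos|exact: measurable_delay]. Qed.

Lemma depends_on_delay (K : pred I) m q :
  (forall l, (l < q)%N -> K (c (m + l).+1)) -> depends_on K (delay m q).
Proof.
move=> HK w w' e; apply: eq_bigr => l _.
by rewrite /service /pos e//; exact: HK.
Qed.

Lemma depends_on_epoch (K : pred I) m :
  (forall l, (l <= m)%N -> K (c l)) -> depends_on K (epoch m).
Proof.
move=> HK w w' e; congr (_ + _); first by rewrite /pos e//; exact: HK.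
by apply: depends_on_delay e => l lm; exact: HK.
Qed.

Lemma bm_coordinate (g : R -> R) i : bounded_measurable g ->
  bounded_measurable (fun w : W => g (w i)).
Proof.
move=> [mg [C gC]]; split; last by exists C => w.
exact: measurableT_comp mg (measurable_coordinate i).
Qed.

Lemma Ex_same_service m (g : R -> R) : bounded_measurable g ->
  Ex mu (fun w => g (w (c m.+1))) = Ex mu (fun w => g (w (c 1%N))).
Proof.
by move=> bg; rewrite !(Ex_coordinate mu_law)// ?LF//; exact: bm_coordinate.
Qed.

Definition laplace : R := Ex mu (fun w => expR (- pos w (c 1%N))).

Lemma bm_exp_pos : bounded_measurable (fun x : R => expR (- Num.max x 0)).
Proof.
apply: (@bm_between _ _ _ _ 0 1).
  apply: measurableT_comp => //; apply: measurable_funN.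
  exact: measurable_maxr (@measurable_id _ _ _) (measurable_cst _).
by move=> x; rewrite expR_ge0 expR_le1 oppr_le0 le_max lexx orbT.
Qed.

Lemma laplace_ge0 : 0 <= laplace.
Proof. by apply: Ex_ge0 => w; exact: expR_ge0. Qed.

Lemma bm_exp_delay m q : bounded_measurable (fun w => expR (- delay m q w)).
Proof.
apply: (@bm_between _ _ _ _ 0 1).
  by apply: measurableT_comp => //; apply: measurable_funN; exact: measurable_delay.
by move=> x; rewrite expR_ge0 expR_le1 oppr_le0 delay_ge0.
Qed.

Lemma Ex_exp_delay m q : Ex mu (fun w => expR (- delay m q w)) = laplace ^+ q.
Proof.
elim: q => [|q IH].
  by under eq_Ex do rewrite delay0 oppr0 expR0; rewrite Ex_cst expr0.
under eq_Ex do rewrite delayS opprD expRD.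
rewrite (Ex_indep (K := predC1 (c (m + q).+1)) mu_law); first last.
- by move=> w w' e; rewrite /service /pos e//= negbK eqxx.
- apply: depends_on_comp; apply: depends_on_comp; apply: depends_on_delay => l lq /=.
  by rewrite (inj_eq c_inj) eqSS eqn_add2l neq_ltn lq.
- exact: (bm_coordinate _ bm_exp_pos).
- exact: bm_exp_delay.
rewrite IH exprSr; congr (_ * _); exact: (Ex_same_service _ bm_exp_pos).
Qed.

Lemma measurable_delay_le m q v : measurable_fun setT (fun w => delay m q w <= v).
Proof. by apply: measurable_fun_ler => //; exact: measurable_delay. Qed.

(** Chernoff bound with exponential parameter 1; every later appearance of the Laplace transform
    goes back to it. *)
Lemma Pr_delay_le m q v : Pr mu (fun w => delay m q w <= v) <= expR v * laplace ^+ q.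
Proof.
rewrite -(Ex_exp_delay m) -ExZ; last exact: bm_exp_delay.
apply: le_Ex.
- by apply: bm_indicator; exact: measurable_delay_le.
- by apply: bmM; [exact: bm_cst|exact: bm_exp_delay].
move=> w; case: (leP (delay m q w) v) => h; last by rewrite mulr_ge0 ?expR_ge0.
by rewrite -expRD -expR0 ler_expR subr_ge0.
Qed.

(** Plays two roles: the mean step in Wald's identity with truncation, and, by [residual_law], the
    distribution function of the residual service. *)
Definition mean_cut (a : R) : R := Ex mu (fun w => Num.min (pos w (c 1%N)) a).

Lemma bm_min_pos (a : R) : bounded_measurable (fun x : R => Num.min (Num.max x 0) a).
Proof.
apply: (@bm_between _ _ _ _ (Num.min 0 a) a).
  apply: measurable_minr (measurable_cst _).
  exact: measurable_maxr (@measurable_id _ _ _) (measurable_cst _).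
move=> x; rewrite [X in _ && X]ge_min lexx orbT andbT le_min !ge_min le_max.
by rewrite !lexx !orbT.
Qed.

(* Wald's identity with services truncated at [a]. *)
Lemma renewal_function_le m Q (v a : R) : 0 <= v -> 0 <= a -> 0 < mean_cut a ->
  \sum_(q < Q) Pr mu (fun w => delay m q w <= v) <= (v + a) / mean_cut a.
Proof.
move=> v0 a0 M0; rewrite ler_pdivlMr// mulr_suml.
have bi q : bounded_measurable (fun w => (delay m q w <= v)%R%:R : R).
  by apply: bm_indicator; exact: measurable_delay_le.
have bs q : bounded_measurable (fun w => Num.min (service (m + q) w) a).
  exact: (bm_coordinate _ (bm_min_pos a)).
rewrite (eq_bigr (fun q : 'I_Q => Ex mu (fun w =>
   (delay m q w <= v)%R%:R * Num.min (service (m + q) w) a))); last first.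
  move=> q _; rewrite (Ex_indep (K := predC1 (c (m + q).+1)) mu_law) //.
  - by congr (_ * _); rewrite /mean_cut -(Ex_same_service (m + q) (bm_min_pos a)).
  - apply: (@depends_on_comp _ _ _ _ _ (fun x => (x <= v)%R%:R)).
    apply: depends_on_delay => l lq /=.
    by rewrite (inj_eq c_inj) eqSS eqn_add2l neq_ltn lq.
  - by move=> w w' e; rewrite /service /pos e//= negbK eqxx.
rewrite -Ex_sum; last by move=> q _; exact: bmM.
apply: Ex_le; first by apply: bm_sum => q _; exact: bmM.
move=> w; apply: (truncated_first_passage (z := fun q => service (m + q) w)) => //.
by move=> q; exact: service_ge0.
Qed.

Section Equilibrium.
Hypothesis residual_law : forall v, 0 <= v ->
  Pr mu (fun w => pos w (c 0%N) <= v) = mean_cut v.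

Lemma bm_excess (v : R) m q : bounded_measurable (fun w => Num.max (v - delay m q w) 0).
Proof.
apply: (@bm_between _ _ _ _ 0 (Num.max v 0)).
  apply: measurable_maxr; last exact: measurable_cst.
  by apply: measurable_funB => //; exact: measurable_delay.
move=> w; rewrite le_max lexx orbT /= ge_max !le_max lexx orbT andbT.
by rewrite gerBl delay_ge0.
Qed.

(** With D the delay up to epoch m, the residual fits with conditional probability E min(S, (v -
    D)^+). For nonnegative D and S, min(S, (v - D)^+) = (v - D)^+ - (v - D - S)^+, and this
    difference will telescope in m. *)
Lemma Pr_epoch m v : Pr mu (fun w => epoch m w <= v) =
  Ex mu (fun w => Num.max (v - delay 0 m w) 0) -
  Ex mu (fun w => Num.max (v - delay 0 m.+1 w) 0).
Proof.
have bi : bounded_measurable (fun w => (epoch m w <= v)%R%:R : R).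
  by apply: bm_indicator; apply: measurable_fun_ler => //; exact: measurable_epoch.
have mix_delay (i : I) w w' : (forall l, (l < m)%N -> c l.+1 != i) ->
    delay 0 m (mix (predC1 i) w w') = delay 0 m w.
  move=> H; apply: (@depends_on_delay (predC1 i)).
    by move=> l lm /=; rewrite add0n; exact: H.
  by move=> j /= ji; rewrite /mix /= ji.
rewrite /Pr (Ex_mix mu_law (predC1 (c 0%N)))//.
have mc0 : mean_cut 0 = 0.
  rewrite /mean_cut -[RHS](Ex_cst mu 0); apply: eq_Ex => w.
  by apply/min_idPr; exact: pos_ge0.
transitivity (Ex mu (fun w => mean_cut (Num.max (v - delay 0 m w) 0))).
  apply: eq_Ex => w.
  have e w' : (epoch m (mix (predC1 (c 0%N)) w w') <= v) =
      (pos w' (c 0%N) <= v - delay 0 m w).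
    rewrite /epoch mix_delay; last by move=> l _; rewrite (inj_eq c_inj).
    by rewrite lerBrDr {1}/pos /mix /= eqxx.
  under eq_Ex do rewrite e.
  case: (leP 0 (v - delay 0 m w)) => h; first by rewrite -residual_law.
  rewrite mc0 -[RHS](Ex_cst mu 0); apply: eq_Ex => w'.
  by rewrite leNgt (lt_le_trans h (pos_ge0 _ _)).
have bz : bounded_measurable
    (fun w => Num.min (service m w) (Num.max (v - delay 0 m w) 0)).
  apply: (@bm_between _ _ _ _ 0 (Num.max v 0)).
    apply: measurable_minr; first exact: measurable_pos.
    by case: (bm_excess v 0 m).
  move=> w; rewrite le_min service_ge0 le_max lexx orbT /= ge_min; apply/orP; right.
  by rewrite ge_max !le_max lexx orbT andbT gerBl delay_ge0.
(* The service in [mean_cut] is realised by service [m], which is independent of the delay before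
   it; thus the next delay appears. *)
transitivity (Ex mu (fun w => Num.min (service m w) (Num.max (v - delay 0 m w) 0))).
  rewrite (Ex_mix mu_law (predC1 (c m.+1)) bz).
  apply: eq_Ex => w.
  rewrite /mean_cut -(Ex_same_service m (bm_min_pos (Num.max (v - delay 0 m w) 0))).
  apply: eq_Ex => w'.
  rewrite mix_delay; last by move=> l lm; rewrite (inj_eq c_inj) eqSS neq_ltn lm.
  by rewrite /service /pos /mix /= eqxx.
rewrite -ExB; [|exact: (bm_excess v 0 m)|exact: (bm_excess v 0 m.+1)].
apply: eq_Ex => w.
rewrite delayS add0n; have := service_ge0 m w; have := delay_ge0 0 m w.
move: (service m w) (delay 0 m w) => z x x0 z0.
rewrite /Num.min /Num.max; case: (ltP (v - x) 0) => h1; case: (ltP (v - (x + z)) 0) => h2;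
  case: ltP => h3; lra.
Qed.

(** Stationarity: the renewal function is v itself, up to the contribution of the epochs from [M]
    on. *)
Lemma sum_Pr_epoch M v : 0 <= v ->
  \sum_(m < M) Pr mu (fun w => epoch m w <= v) =
  v - Ex mu (fun w => Num.max (v - delay 0 M w) 0).
Proof.
move=> v0; elim: M => [|M IH].
  under eq_Ex do rewrite delay0 subr0.
  by rewrite Ex_cst big_ord0 (max_idPl v0) subrr.
by rewrite big_ord_recr /= IH Pr_epoch; ring.
Qed.

Lemma Ex_excess_le M v : 0 <= v ->
  Ex mu (fun w => Num.max (v - delay 0 M w) 0) <= v * (expR v * laplace ^+ M).
Proof.
move=> v0; apply: le_trans (ler_wpM2l v0 (Pr_delay_le 0 M v)).
have bi := bm_indicator R (measurable_delay_le 0 M v).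
rewrite -ExZ//; apply: le_Ex; first exact: bm_excess.
  by apply: bmM => //; exact: bm_cst.
move=> w; have := delay_ge0 0 M w; case: (leP (delay 0 M w) v) => h h0 /=; last first.
  by rewrite mulr0 ge_max lexx andbT; lra.
by rewrite mulr1 ge_max v0 andbT; lra.
Qed.

Section Block.
Variables (s u : R) (M : nat).
Hypotheses (s_ge0 : 0 <= s) (u_ge0 : 0 <= u).

(** Half-open, so that adjacent blocks tile without overlap. *)
Definition in_block (t : R) := (s < t) && (t <= s + u).
Definition completions (w : W) : R := \sum_(m < M) (in_block (epoch m w))%:R.
(* Only the first [M] epochs are counted; the defect bounds the resulting loss in
   the mean number of completions. *)
Definition renewal_defect : R := Ex mu (fun w => Num.max (s + u - delay 0 M w) 0).

Lemma measurable_in_block m : measurable_fun setT (fun w => in_block (epoch m w)).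
Proof.
by apply: measurable_and; [apply: measurable_fun_ltr|apply: measurable_fun_ler];
  rewrite //; exact: measurable_epoch.
Qed.

Lemma bm_in_block m : bounded_measurable (fun w => (in_block (epoch m w))%:R : R).
Proof. by apply: bm_indicator; exact: measurable_in_block. Qed.

Lemma bm_completions : bounded_measurable completions.
Proof. by apply: bm_sum => m _; exact: bm_in_block. Qed.

Lemma Ex_in_block m : Ex mu (fun w => (in_block (epoch m w))%:R) =
  Pr mu (fun w => epoch m w <= s + u) - Pr mu (fun w => epoch m w <= s).
Proof.
have bi v : bounded_measurable (fun w => (epoch m w <= v)%R%:R : R).
  by apply: bm_indicator; apply: measurable_fun_ler => //; exact: measurable_epoch.
rewrite -ExB//; apply: eq_Ex => w; rewrite /in_block.
case: (ltP s) => h1; case: (leP _ (s + u)) => h2; rewrite ?subr0 ?subrr//=.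
by have u0 := u_ge0; lra.
Qed.

Lemma Ex_completionsE : Ex mu completions =
  u - (renewal_defect - Ex mu (fun w => Num.max (s - delay 0 M w) 0)).
Proof.
rewrite Ex_sum; last by move=> m _; exact: bm_in_block.
under eq_bigr do rewrite Ex_in_block.
by rewrite sumrB !sum_Pr_epoch ?addr_ge0// /renewal_defect; ring.
Qed.

Lemma Ex_completions_le : Ex mu completions <= u.
Proof.
rewrite Ex_completionsE gerBl subr_ge0; apply: le_Ex; try exact: bm_excess.
move=> w; rewrite ge_max !le_max lexx orbT andbT; apply/orP; left.
by rewrite lerB// lerDl.
Qed.

Lemma Ex_completions_ge : u - renewal_defect <= Ex mu completions.
Proof.
rewrite Ex_completionsE lerB// gerBl; apply: Ex_ge0 => w.
by rewrite le_max lexx orbT.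
Qed.

End Block.

Section BlockMoments.
Variables (s u : R) (M : nat).
Hypotheses (s_ge0 : 0 <= s) (u_ge0 : 0 <= u).

(** The coordinates that determine [epoch m]. Delays counted from there read only the others, which
    expresses the renewal at that epoch. *)
Definition started (m : nat) : pred I := fun i => has (fun l => c l == i) (iota 0 m.+1).

Lemma started_le m l : (l <= m)%N -> started m (c l).
Proof. by move=> lm; apply/hasP; exists l => //; rewrite mem_iota. Qed.

Lemma started_gt m l : (m < l)%N -> ~~ started m (c l).
Proof.
move=> ml; apply/hasPn => k; rewrite mem_iota add0n ltnS /= => km.
by rewrite (inj_eq c_inj) neq_ltn (leq_ltn_trans km ml).
Qed.

Lemma depends_on_started_epoch m : depends_on (started m) (epoch m).
Proof. by apply: depends_on_epoch => l; exact: started_le. Qed.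

Lemma depends_on_fresh_delay m q : depends_on (predC (started m)) (delay m q).
Proof.
apply: depends_on_delay => l lq; apply: started_gt.
by rewrite ltnS leq_addr.
Qed.

Lemma epoch_mix m (w w' : W) : epoch m (mix (started m) w w') = epoch m w.
Proof. by apply: depends_on_started_epoch => i si; rewrite /mix si. Qed.

Lemma delay_mix m q (w w' : W) : delay m q (mix (started m) w w') = delay m q w'.
Proof. by apply: depends_on_fresh_delay => i /negbTE si; rewrite /mix si. Qed.

Local Notation Y m w := ((in_block s u (epoch m w))%:R : R).

Definition remaining m (w : W) : R := Y m w * (s + u - epoch m w).

Lemma bm_remaining m : bounded_measurable (remaining m).
Proof.
apply: (@bm_between _ _ _ _ 0 u).
  apply: measurable_funM; first by case: (bm_in_block s u m).
  by apply: measurable_funB => //; exact: measurable_epoch.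
move=> w; rewrite /remaining /in_block; have u0 := u_ge0.
case: (ltP s) => h1; case: (leP _ (s + u)) => h2; rewrite /= ?mul0r ?mul1r; lra.
Qed.

Lemma measurable_delay_remaining m q :
  measurable_fun setT (fun w => delay m q w <= s + u - epoch m w).
Proof.
apply: measurable_fun_ler; first exact: measurable_delay.
by apply: measurable_funB => //; exact: measurable_epoch.
Qed.

(** Given the coordinates in [started m], the time v left in the block is fixed and the delays are
    fresh, so the successors are counted by the renewal function at v. The term q = 0 is epoch m
    itself. *)
Lemma Ex_block_successors (kappa : R) m Q :
  (forall v, 0 <= v <= u ->
    \sum_(q < Q) Pr mu (fun w => delay m q w <= v) <= 1 + v + kappa) ->
  Ex mu (fun w => Y m w * \sum_(q < Q) (delay m q w <= s + u - epoch m w)%R%:R) <=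
  (1 + kappa) * Ex mu (fun w => Y m w) + Ex mu (remaining m).
Proof.
move=> hk.
have bf : bounded_measurable (fun w =>
    Y m w * \sum_(q < Q) (delay m q w <= s + u - epoch m w)%R%:R).
  apply: bmM; first exact: bm_in_block.
  by apply: bm_sum => q _; apply: bm_indicator; exact: measurable_delay_remaining.
have bY := bm_in_block s u m.
have mD w q : measurable_fun setT
    (fun w' : W => delay m q (mix (started m) w w') <= s + u - epoch m w).
  rewrite (_ : (fun w' => _) = (fun w' => delay m q w' <= s + u - epoch m w)).
    exact: measurable_delay_le.
  by apply/funext => w'; rewrite delay_mix.
rewrite (Ex_mix mu_law (started m) bf) -ExZ// -ExD; last exact: bm_remaining.
  apply: le_Ex; first exact: (bm_Ex_mix mu (started m) bf).
    by apply: bmD; [apply: bmM => //; exact: bm_cst|exact: bm_remaining].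
  move=> w; under eq_Ex do rewrite epoch_mix.
  rewrite ExZ; last first.
    by apply: bm_sum => q _; exact: bm_indicator.
  rewrite /remaining; case: (boolP (in_block s u (epoch m w))) => hb; last first.
    by rewrite !mul0r mulr0 addr0.
  rewrite !mul1r mulr1 Ex_sum; last first.
    by move=> q _; exact: bm_indicator.
  have := hk (s + u - epoch m w); rewrite (_ : _ && _ = true); last first.
    by move: hb; rewrite /in_block; lra.
  move=> /(_ erefl) h; apply: le_trans (_ : 1 + (s + u - epoch m w) + kappa <= _).
    apply: le_trans h; rewrite le_eqVlt; apply/orP; left; apply/eqP.
    by apply: eq_bigr => q _; apply: eq_Ex => w'; rewrite delay_mix.
  by lra.
by apply: bmM => //; exact: bm_cst.
Qed.

(** Twice the ordered pairs of epochs, minus the diagonal that was counted twice: 2(1 + kappa) - 1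
    gives the factor 1 + 2 kappa. *)
Lemma Ex_completions_square (kappa : R) :
  (forall m v, 0 <= v <= u ->
    \sum_(q < M) Pr mu (fun w => delay m q w <= v) <= 1 + v + kappa) ->
  Ex mu (fun w => completions s u M w ^+ 2) <=
  (1 + 2 * kappa) * Ex mu (completions s u M) + 2 * \sum_(m < M) Ex mu (remaining m).
Proof.
move=> hk.
have bS m : bounded_measurable (fun w =>
    Y m w * \sum_(q < M) (delay m q w <= s + u - epoch m w)%R%:R).
  apply: bmM; first exact: bm_in_block.
  by apply: bm_sum => q _; apply: bm_indicator; exact: measurable_delay_remaining.
apply: le_trans (_ : \sum_(m < M) (2 * Ex mu (fun w =>
    Y m w * \sum_(q < M) (delay m q w <= s + u - epoch m w)%R%:R) -
    Ex mu (fun w => Y m w)) <= _); last first.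
  rewrite [X in _ * X + _]Ex_sum; last by move=> m _; exact: bm_in_block.
  rewrite !mulr_sumr -big_split /=; apply: ler_sum => m _.
  by have := Ex_block_successors (hk m); lra.
rewrite (eq_bigr (fun m : 'I_M => Ex mu (fun w => 2 * (Y m w *
    \sum_(q < M) (delay m q w <= s + u - epoch m w)%R%:R) - Y m w))); last first.
  move=> m _; rewrite ExB; [|apply: bmM; [exact: bm_cst|exact: bS]|exact: bm_in_block].
  by rewrite ExZ//; exact: bS.
have bD m : bounded_measurable (fun w => 2 * (Y m w *
    \sum_(q < M) (delay m q w <= s + u - epoch m w)%R%:R) - Y m w).
  by apply: bmB; [apply: bmM; [exact: bm_cst|exact: bS]|exact: bm_in_block].
rewrite -Ex_sum//; apply: le_Ex; first exact: bmX (bm_completions _ _ _).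
  by apply: bm_sum => m _; exact: bD.
move=> w; rewrite /completions (sum_square_ordered (fun m => Y m w)).
apply: ler_sum => m _.
case: (boolP (in_block s u (epoch m w))) => hm; last by rewrite !mul0r mulr0 subr0.
rewrite !mul1r lerD2r ler_pM2l//.
rewrite -{1}(add0n m : (0 + m)%N = m) big_addn big_mkord.
apply: le_trans (_ : \sum_(q < M - m) (delay m q w <= s + u - epoch m w)%R%:R <= _).
  apply: ler_sum => q _; rewrite addnC epochD /in_block lerBrDl.
  by rewrite ler_nat; case: (s < _)%R; case: (_ <= s + u)%R.
rewrite -!(big_mkord xpredT (fun q => (delay m q w <= s + u - epoch m w)%R%:R)).
rewrite [leRHS](big_cat_nat (n := M - m)) ?leq_subr//= lerDl.
by apply: sumr_ge0 => q _; rewrite ler0n.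
Qed.

(** Time left in the block is an integral of indicators of shorter blocks; a block of length v holds
    at most v epochs on average, and the integral of v over [0, u] is u^2/2. The last term is the
    Riemann error for mesh u/J. *)
Lemma sum_Ex_remaining J : (0 < J)%N ->
  \sum_(m < M) Ex mu (remaining m) <= u ^+ 2 / 2 + u ^+ 2 / (2 * J%:R).
Proof.
move=> J0; have J0' : 0 < J%:R :> R by rewrite ltr0n.
set h := u / J%:R; have h0 : 0 <= h by rewrite divr_ge0.
have bB j m : bounded_measurable (fun w =>
    h * (in_block s (h * j.+1%:R) (epoch m w))%:R).
  by apply: bmM; [exact: bm_cst|exact: bm_in_block].
apply: le_trans (_ : \sum_(m < M) Ex mu (fun w =>
    \sum_(j < J) h * (in_block s (h * j.+1%:R) (epoch m w))%:R) <= _).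
  apply: ler_sum => m _; apply: le_Ex; first exact: bm_remaining.
    by apply: bm_sum => j _; exact: bB.
  move=> w; rewrite /remaining; case: (boolP (in_block s u (epoch m w))); last first.
    by move=> _; rewrite mul0r; apply: sumr_ge0 => j _; rewrite mulr_ge0.
  move=> /andP[h1 h2]; rewrite mul1r.
  apply: le_trans (_ : u - (epoch m w - s) <= _); first by lra.
  apply: le_trans (riemann_excess (J := J) u_ge0 _ _ J0) _; [lra|lra|].
  apply: ler_sum => j _; rewrite ler_wpM2l// /in_block h1 /= lerBlDr.
  by rewrite [s + _]addrC.
under eq_bigr do rewrite Ex_sum //.
rewrite exchange_big /=.
apply: le_trans (_ : \sum_(j < J) h * (h * j.+1%:R) <= _).
  apply: ler_sum => j _.
  have h1 : 0 <= h * j.+1%:R by rewrite mulr_ge0.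
  have := Ex_completions_le M s_ge0 h1.
  rewrite Ex_sum; last by move=> m _; exact: bm_in_block.
  move=> /(ler_wpM2l h0); apply: le_trans; rewrite mulr_sumr.
  by apply: ler_sum => m _; rewrite ExZ//; exact: bm_in_block.
rewrite -mulr_sumr -mulr_sumr.
have -> : \sum_(j < J) (j.+1%:R : R) = J%:R * (J%:R + 1) / 2.
  elim: (J) => [|k IH]; first by rewrite big_ord0 !mul0r.
  by rewrite big_ord_recr /= IH -natr1; field.
rewrite /h le_eqVlt; apply/orP; left; apply/eqP.
by field; rewrite gt_eqF.
Qed.

(** The leading u^2 of the second moment cancels against the squared mean, which lies between (u -
    1/2) and u before squaring. What remains is linear in u, with a factor governed by the excess
    [kappa] of the renewal function. *)
Lemma Ex_centered_square (kappa : R) : 0 <= kappa -> renewal_defect s u M <= 2^-1 ->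
  (forall m v, 0 <= v <= u ->
    \sum_(q < M) Pr mu (fun w => delay m q w <= v) <= 1 + v + kappa) ->
  Ex mu (fun w => (completions s u M w - Ex mu (completions s u M)) ^+ 2) <=
  (3 + 2 * kappa) * u.
Proof.
move=> k0 hb hk; set e := Ex mu (completions s u M).
have bX := bm_completions s u M.
have -> : Ex mu (fun w => (completions s u M w - e) ^+ 2) =
    Ex mu (fun w => completions s u M w ^+ 2) - e ^+ 2.
  transitivity (Ex mu (fun w => completions s u M w ^+ 2 -
      (2 * e * completions s u M w - e ^+ 2))).
    by apply: eq_Ex => w; ring.
  rewrite ExB; [|exact: bmX|by apply: bmB; [apply: bmM|]; rewrite //; exact: bm_cst].
  rewrite ExB; [|by apply: bmM => //; exact: bm_cst|exact: bm_cst].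
  by rewrite ExZ// Ex_cst -/e; ring.
have := Ex_completions_square hk; rewrite -/e.
(* With J >= u the Riemann error is at most u/2. *)
pose J := (Num.truncn u).+1.
have uJ : u <= J%:R by rewrite ltW//; case/truncn_itv/andP: u_ge0.
have J0 : 0 < J%:R :> R by rewrite ltr0n.
have := sum_Ex_remaining (J := J) erefl.
have : u ^+ 2 / (2 * J%:R) <= u / 2.
  rewrite ler_pdivrMr ?mulr_gt0//; have u0 := u_ge0.
  rewrite (_ : u / 2 * _ = u * J%:R); last by field.
  by rewrite expr2 ler_wpM2l.
have eu : e <= u := Ex_completions_le M s_ge0 u_ge0.
have eb := Ex_completions_ge M s_ge0 u_ge0; rewrite -/e in eb.
have e0 : 0 <= e by apply: Ex_ge0 => w; apply: sumr_ge0 => m _; rewrite ler0n.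
have u0 := u_ge0.
have h1 : u ^+ 2 - e ^+ 2 <= u.
  rewrite subr_sqr -[leRHS]mulr1 mulrC.
  by apply: le_trans (_ : (u + u) * 2^-1 <= _); [apply: ler_pM; lra|lra].
have h2 : (1 + 2 * kappa) * e <= (1 + 2 * kappa) * u by apply: ler_wpM2l => //; lra.
lra.
Qed.

(** The first epoch of the block must have its k-th successor within time u. A union over all epochs
    in the block, of mean number at most u, and renewal at each give the product. The factor u is
    what makes the bound useful for short blocks. *)
Lemma Pr_completions_gt k :
  Pr mu (fun w => k%:R < completions s u M w) <= u * (expR u * laplace ^+ k).
Proof.
have bY m := bm_in_block s u m.
have bD m := bm_indicator R (measurable_delay_le m k u).
apply: le_trans (_ : \sum_(m < M) Ex mu (fun w => Y m w * (delay m k w <= u)%R%:R) <= _).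
  rewrite -Ex_sum; last by move=> m _; exact: bmM.
  apply: le_Ex.
  - apply: bm_indicator; apply: measurable_fun_ltr => //.
    by case: (bm_completions s u M).
  - by apply: bm_sum => m _; exact: bmM.
  move=> w; case: ltP => hk; last by apply: sumr_ge0 => m _; rewrite mulr_ge0.
  have [m0 hm0 mmin] : exists2 m, in_block s u (epoch m w) &
      forall j, in_block s u (epoch j w) -> (m <= j)%N.
    suff ex : exists m, in_block s u (epoch m w).
      by case: (ex_minnP ex) => m hm mmin; exists m.
    apply: contrapT => /forallNP hN; move: hk; rewrite /completions big1 => [|m _].
      by rewrite ltNge ler0n.
    by move/negP: (hN m) => /negbTE ->.
  have hmM : (m0 < M)%N.
    rewrite ltnNge; apply/negP => Mm; move: hk; rewrite /completions big1 => [|m _].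
      by rewrite ltNge ler0n.
    case: (boolP (in_block _ _ _)) => // /mmin.
    by rewrite leqNgt (leq_trans (ltn_ord m) Mm).
  rewrite (bigD1 (Ordinal hmM)) //= hm0 mul1r.
  suff -> : delay m0 k w <= u.
    by rewrite lerDl; apply: sumr_ge0 => m _; rewrite mulr_ge0.
  (* Otherwise the epochs of the block have indices among m0, ..., m0 + k - 1, so there are at most
     k of them. *)
  rewrite leNgt; apply/negP => hd; move: hk; rewrite ltNge => /negP; apply.
  rewrite /completions -natr_sum ler_nat.
  apply: leq_trans (_ : \sum_(m < M | (m0 <= m < m0 + k)%N) 1 <= _)%N.
    rewrite big_mkcond [leqRHS]big_mkcond /=; apply: leq_sum => m _.
    case: (boolP (in_block _ _ _)) => // hm; rewrite (mmin _ hm) /=.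
    case: (ltnP m (m0 + k)) => // km; have := epoch_mono w km; rewrite epochD.
    by move: hm hm0; rewrite /in_block => /andP[h2 h3] /andP[h4 h5] h6; lra.
  rewrite -(big_mkord (fun m => m0 <= m < m0 + k)%N (fun=> 1%N)) -big_filter sum1_size.
  apply: leq_trans (_ : size (index_iota m0 (m0 + k)) <= _)%N; last first.
    by rewrite size_iota addKn.
  apply: uniq_leq_size; first by rewrite filter_uniq ?iota_uniq.
  by move=> m; rewrite mem_filter !mem_index_iota => /andP[].
apply: le_trans (_ : \sum_(m < M) Ex mu (fun w => Y m w) * (expR u * laplace ^+ k) <= _).
  apply: ler_sum => m _; rewrite (Ex_indep (K := started m) mu_law) //.
  - by apply: ler_wpM2l; [apply: Ex_ge0|exact: Pr_delay_le].
  - apply: (@depends_on_comp _ _ _ _ _ (fun x => (in_block s u x)%:R)).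
    exact: depends_on_started_epoch.
  - apply: (@depends_on_comp _ _ _ _ _ (fun x => (x <= u)%R%:R)).
    exact: depends_on_fresh_delay.
rewrite -mulr_suml -Ex_sum//; apply: ler_wpM2r; last exact: Ex_completions_le.
by rewrite mulr_ge0 ?expR_ge0// exprn_ge0// laplace_ge0.
Qed.

Lemma Ex_completions_moment (p r : nat) (C : R) : (0 < p)%N -> 0 <= C ->
  laplace < 1 -> expR u <= 2 ->
  (forall k : nat, k.+1%:R ^+ p - k%:R ^+ p <= C * 'C(k + r, r)%:R) ->
  Ex mu (fun w => completions s u M w ^+ p) <= 2 * C * u / (1 - laplace) ^+ r.+1.
Proof.
move=> p0 C0 l1 u2 hC.
have eN w : completions s u M w = (\sum_(m < M) in_block s u (epoch m w))%N%:R.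
  by rewrite natr_sum.
have NM w : (\sum_(m < M) in_block s u (epoch m w) <= M)%N.
  by rewrite -[leqRHS]card_ord -sum1_card; apply: leq_sum => m _; case: in_block.
have mk (k : nat) : measurable_fun setT (fun w => k%:R < completions s u M w).
  by apply: measurable_fun_ltr => //; case: (bm_completions s u M).
have bk (k : nat) : bounded_measurable (fun w =>
    (k.+1%:R ^+ p - k%:R ^+ p) * (k%:R < completions s u M w)%R%:R).
  by apply: bmM; [exact: bm_cst|exact: bm_indicator].
have -> : Ex mu (fun w => completions s u M w ^+ p) =
    \sum_(k < M) (k.+1%:R ^+ p - k%:R ^+ p) *
      Pr mu (fun w => k%:R < completions s u M w).
  transitivity (Ex mu (fun w => \sum_(k < M) (k.+1%:R ^+ p - k%:R ^+ p) *
      (k%:R < completions s u M w)%R%:R)).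
    apply: eq_Ex => w; rewrite {1}eN (nat_power_layers _ (NM w) p0).
    by apply: eq_bigr => k _; rewrite eN ltr_nat.
  rewrite Ex_sum//; apply: eq_bigr => k _; rewrite ExZ//; exact: bm_indicator.
have l0 := laplace_ge0; have u0 := u_ge0.
apply: le_trans (_ : \sum_(k < M) 2 * C * u * ('C(k + r, r)%:R * laplace ^+ k) <= _).
  apply: ler_sum => k _.
  apply: le_trans (_ : C * 'C(k + r, r)%:R * (u * (2 * laplace ^+ k)) <= _).
    apply: ler_pM => //; first by rewrite subr_ge0 lerXn2r ?nnegrE// ler_nat.
      exact: Pr_ge0.
    apply: le_trans (Pr_completions_gt k) _; apply: ler_wpM2l => //.
    by apply: ler_wpM2r => //; exact: exprn_ge0.
  by rewrite le_eqVlt; apply/orP; left; apply/eqP; ring.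
rewrite -mulr_sumr; apply: ler_wpM2l; first by rewrite !mulr_ge0.
by apply: sum_binomial_geometric; rewrite l0.
Qed.

End BlockMoments.

End Equilibrium.
End Renewal.

(** * Pools of servers *)

Lemma fourth_power_sub_le (R : realType) (x y : R) :
  (x - y) ^+ 4 <= 8 * (x ^+ 4 + y ^+ 4).
Proof.
rewrite -subr_ge0 (_ : _ - _ =
  (x + y) ^+ 4 + 6 * (x ^+ 2 - y ^+ 2) ^+ 2); last by ring.
apply: addr_ge0; first exact: exprn_even_ge0.
by rewrite mulr_ge0 ?sqr_ge0.
Qed.

Lemma Ex_deviation_square d (T : measurableType d) (R : realType)
    (P : probability T R) (f : T -> R) : bounded_measurable f ->
  Ex P (fun w => (Ex P f - f w) ^+ 2) = Ex P (fun w => f w ^+ 2) - Ex P f ^+ 2.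
Proof.
move=> bf; set e := Ex P f.
transitivity (Ex P (fun w => f w ^+ 2 - (2 * e * f w - e ^+ 2))).
  by apply: eq_Ex => w; ring.
rewrite ExB; [|exact: bmX|by apply: bmB; [apply: bmM|]; rewrite //; exact: bm_cst].
rewrite ExB; [|by apply: bmM => //; exact: bm_cst|exact: bm_cst].
by rewrite ExZ// Ex_cst -/e; ring.
Qed.

Section IndependentSums.
Context (I : eqType) (R : realType) (L : I -> probability R R).
Local Notation W := {paths I -> R}.
Context (mu : probability W R) (mu_law : product_law L predT mu).
Context (K : nat -> pred I) (f : nat -> W -> R).
Hypothesis disjointK : forall i j x, K i x -> K j x -> i = j.
Hypothesis bf : forall i, bounded_measurable (f i).
Hypothesis df : forall i, depends_on (K i) (f i).
Hypothesis f0 : forall i, Ex mu (f i) = 0.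

Local Notation S n w := (\sum_(i < n) f i w).

Lemma bm_partial_sum n : bounded_measurable (fun w => S n w).
Proof. by apply: bm_sum => i _; exact: bf. Qed.

Lemma Ex_partial_sum n : Ex mu (fun w => S n w) = 0.
Proof. by rewrite Ex_sum ?big1// => i _; exact: bf. Qed.

Lemma Ex_partial_sum_pow n k l :
  Ex mu (fun w => S n w ^+ k * f n w ^+ l) =
  Ex mu (fun w => S n w ^+ k) * Ex mu (fun w => f n w ^+ l).
Proof.
apply: (Ex_indep (K := predC (K n)) mu_law).
- by apply: bmX; exact: bm_partial_sum.
- by apply: bmX; exact: bf.
- apply: (depends_on_comp (fun x => x ^+ k)) => w w' e.
  apply: eq_bigr => i _; apply: df => x Kx; apply: e => /=; apply/negP => Kn.
  by have := ltn_ord i; rewrite (disjointK Kx Kn) ltnn.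
- move=> w w' e; congr (_ ^+ l); apply: df => x Kx; apply: e => /=.
  by rewrite negbK.
Qed.

Lemma Ex_square_sum n V : (forall i, Ex mu (fun w => f i w ^+ 2) <= V) ->
  Ex mu (fun w => S n w ^+ 2) <= n%:R * V.
Proof.
move=> fV; elim: n => [|n IH].
  by under eq_Ex do rewrite big_ord0 expr0n; rewrite Ex_cst mul0r.
have bS := bm_partial_sum n; have bn := bf n.
have -> : Ex mu (fun w => S n.+1 w ^+ 2) =
  (Ex mu (fun w => S n w ^+ 2 + (2 * (S n w ^+ 1 * f n w ^+ 1) + f n w ^+ 2))).
  by apply: eq_Ex => w; rewrite big_ord_recr /=; ring.
rewrite ExD; [|exact: bmX|apply: bmD; [|exact: bmX]]; last first.
  by apply: bmM; [exact: bm_cst|apply: bmM; exact: bmX].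
rewrite ExD; [|apply: bmM; [exact: bm_cst|apply: bmM; exact: bmX]|exact: bmX].
rewrite ExZ; last by apply: bmM; exact: bmX.
rewrite Ex_partial_sum_pow.
have -> : Ex mu (fun w => S n w ^+ 1) = 0 by exact: Ex_partial_sum.
by rewrite mul0r mulr0 add0r -natr1 mulrDl mul1r lerD.
Qed.

(** All means vanish, so adding one summand f to S contributes only 6 E[S^2] E[f^2] + E[f^4]. The
    first term is at most 6 n V2^2, below the increment of 3 (n V2)^2. *)
Lemma Ex_fourth_sum n V4 V2 : 0 <= V2 ->
  (forall i, Ex mu (fun w => f i w ^+ 2) <= V2) ->
  (forall i, Ex mu (fun w => f i w ^+ 4) <= V4) ->
  Ex mu (fun w => S n w ^+ 4) <= n%:R * V4 + 3 * (n%:R * V2) ^+ 2.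
Proof.
move=> V20 fV2 fV4; elim: n => [|n IH].
  under eq_Ex do rewrite big_ord0 expr0n.
  by rewrite Ex_cst !mul0r expr0n mulr0 addr0.
have bS := bm_partial_sum n; have bn := bf n.
have bb k l : bounded_measurable (fun w => S n w ^+ k * f n w ^+ l).
  by apply: bmM; exact: bmX.
have bc (a : R) k l : bounded_measurable (fun w => a * (S n w ^+ k * f n w ^+ l)).
  by apply: bmM; [exact: bm_cst|exact: bb].
have -> : Ex mu (fun w => S n.+1 w ^+ 4) =
  (Ex mu (fun w => S n w ^+ 4 + (4 * (S n w ^+ 3 * f n w ^+ 1) +
   (6 * (S n w ^+ 2 * f n w ^+ 2) + (4 * (S n w ^+ 1 * f n w ^+ 3) + f n w ^+ 4))))).
  by apply: eq_Ex => w; rewrite big_ord_recr /=; ring.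
have b4 := bmX 4 bn.
have b3 := bmD (bc 4 1%N 3%N) b4.
have b2 := bmD (bc 6 2%N 2%N) b3.
have b1 := bmD (bc 4 3%N 1%N) b2.
rewrite (ExD _ (bmX 4 bS) b1) (ExD _ (bc 4 3%N 1%N) b2) (ExD _ (bc 6 2%N 2%N) b3).
rewrite (ExD _ (bc 4 1%N 3%N) b4) !(ExZ _ _ (bb _ _)) !Ex_partial_sum_pow.
have -> : Ex mu (fun w => S n w ^+ 1) = 0 by exact: Ex_partial_sum.
have -> : Ex mu (fun w => f n w ^+ 1) = 0 by exact: f0.
rewrite mul0r !mulr0 !add0r.
have h2 : Ex mu (fun w => S n w ^+ 2) * Ex mu (fun w => f n w ^+ 2) <= n%:R * V2 * V2.
  apply: ler_pM; [..|exact: Ex_square_sum|exact: fV2];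
    by apply: Ex_ge0 => w; rewrite sqr_ge0.
have h4 := fV4 n; have V22 := mulr_ge0 V20 V20.
rewrite -natr1; set a := n%:R in IH h2 *.
apply: le_trans (_ : a * V4 + 3 * (a * V2) ^+ 2 + (6 * (a * V2 * V2) + V4) <= _).
  by lra.
rewrite -subr_ge0 (_ : _ - _ = 3 * (V2 * V2)); last by ring.
by rewrite mulr_ge0.
Qed.

End IndependentSums.

Section Pool.
Context (I : eqType) (R : realType) (L : I -> probability R R).
Local Notation W := {paths I -> R}.
Context (mu : probability W R) (mu_law : product_law L predT mu).
Context (c : nat -> nat -> I) (c_inj : forall i j m k, c i m = c j k -> i = j /\ m = k).
Context (F : probability R R) (LF : forall i m, L (c i m.+1) = F).
Context (n : nat).
Hypothesis residual_law : forall i v, (i < n)%N -> 0 <= v ->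
  Pr mu (fun w => pos w (c i 0%N) <= v) = mean_cut mu (c i) v.
Context (phi : R) (phi_lt1 : phi < 1) (phiE : forall i, laplace mu (c i) = phi).

Definition pool_completions (s u : R) M (w : W) : R :=
  \sum_(i < n) completions (c i) s u M w.

Definition server_coordinates i : pred I := fun x => `[< exists m, c i m = x >].

Let c_inj1 i : injective (c i).
Proof. by move=> m k /c_inj[]. Qed.

Lemma depends_on_completions i s u M :
  depends_on (server_coordinates i) (completions (c i) s u M : W -> R).
Proof.
move=> w w' e; apply: eq_bigr => m _; congr (in_block _ _ _)%:R.
by apply: (depends_on_epoch (K := server_coordinates i)) e => l _; apply/asboolP; exists l.
Qed.

Section PoolBlock.
Variables (s u : R) (M : nat) (y : R).
Hypotheses (s_ge0 : 0 <= s) (u_ge0 : 0 <= u) (y_gt0 : 0 < y).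
Hypothesis defect_le : forall i, n%:R * renewal_defect mu (c i) s u M <= y / 2.

Let m1 i : R := Ex mu (completions (c i) s u M).
(* Extended by 0 to indices that are not servers. *)
Let X i (w : W) : R := if (i < n)%N then m1 i - completions (c i) s u M w else 0.

Let bX i : bounded_measurable (X i).
Proof.
rewrite /X; case: (i < n)%N; last exact: bm_cst.
by apply: bmB; [exact: bm_cst|exact: bm_completions].
Qed.

Let dX i : depends_on (server_coordinates i) (X i).
Proof.
rewrite /X; case: (i < n)%N => //.
exact: (depends_on_comp (fun x => m1 i - x) (@depends_on_completions i s u M)).
Qed.

Let X0 i : Ex mu (X i) = 0.
Proof.
rewrite /X; case: (i < n)%N; last exact: Ex_cst.
by rewrite ExB ?Ex_cst ?subrr//; [exact: bm_cst|exact: bm_completions].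
Qed.

Let disj i j x : server_coordinates i x -> server_coordinates j x -> i = j.
Proof. by move=> /asboolP[m <-] /asboolP[k] /esym/c_inj[]. Qed.

Definition pool_lags (w : W) : bool := y <= n%:R * u - pool_completions s u M w.

Lemma measurable_pool_completions : measurable_fun setT (pool_completions s u M : W -> R).
Proof. by apply: measurable_sum => i; case: (bm_completions (c i) s u M). Qed.

Lemma measurable_pool_lags : measurable_fun setT pool_lags.
Proof.
apply: measurable_fun_ler => //; apply: measurable_funB => //.
exact: measurable_pool_completions.
Qed.

(** By [defect_le], the total bias from counting only [M] epochs is at most y/2, so the centred sum
    has to account for the other half of [y]; then Markov for an even power. *)
Lemma Pr_pool_lags_le k : ~~ odd k ->
  Pr mu pool_lags <= Ex mu (fun w => (\sum_(i < n) X i w) ^+ k) / (y / 2) ^+ k.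
Proof.
move=> ko; have y2 : 0 < y / 2 by rewrite divr_gt0.
have bS : bounded_measurable (fun w => (\sum_(i < n) X i w) ^+ k).
  by apply: bmX; apply: bm_sum => i _.
apply: le_trans (markov_Pr mu bS _ _); [|by move=> w; rewrite exprn_even_ge0|exact: exprn_gt0].
apply: le_Pr; [exact: measurable_pool_lags| |].
  by apply: measurable_fun_ler => //; case: bS.
move=> w; rewrite /pool_lags => h.
suff hs : y / 2 <= \sum_(i < n) X i w.
  by rewrite lerXn2r ?nnegrE ?(ltW y2)//; apply: le_trans hs; exact: ltW.
have XE : \sum_(i < n) X i w = \sum_(i < n) (m1 i - completions (c i) s u M w).
  by apply: eq_bigr => i _; rewrite /X ltn_ord.
suff : \sum_(i < n) (u - m1 i) <= y / 2.
  move: h; rewrite /pool_completions sumrB sumr_const card_ord.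
  rewrite -mulr_natl XE [X in _ -> _ -> _ <= X]sumrB; lra.
have [->|n0] := posnP n; first by rewrite big_ord0 ltW.
rewrite -(ler_pM2l (_ : 0 < n%:R)) ?ltr0n// mulr_sumr.
apply: le_trans (_ : \sum_(i < n) y / 2 <= _); last first.
  by rewrite sumr_const card_ord mulr_natl.
apply: ler_sum => i _; apply: le_trans (defect_le i); apply: ler_wpM2l => //.
rewrite lerBlDr -lerBlDl.
exact: (Ex_completions_ge mu_law (@c_inj1 i) (LF i)
  (fun v => @residual_law i v (ltn_ord i)) M s_ge0 u_ge0).
Qed.

Lemma Pr_pool_lags_coarse V : 0 <= V ->
  (forall i, (i < n)%N -> Ex mu (fun w => (completions (c i) s u M w - m1 i) ^+ 2) <= V) ->
  Pr mu pool_lags <= 4 * (n%:R * V) / y ^+ 2.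
Proof.
move=> V0 hV; apply: le_trans (Pr_pool_lags_le (k := 2) erefl) _.
have V2 i : Ex mu (fun w => X i w ^+ 2) <= V.
  rewrite /X; case: ltnP => ni; last first.
    by under eq_Ex do rewrite expr0n; rewrite Ex_cst.
  apply: le_trans (hV i ni); rewrite le_eqVlt; apply/orP; left; apply/eqP.
  by apply: eq_Ex => w; ring.
have := Ex_square_sum mu_law disj bX dX X0 n V2.
move=> /(ler_wpM2r (_ : 0 <= ((y / 2) ^+ 2)^-1)) h.
apply: le_trans (h _) _; first by rewrite invr_ge0 exprn_ge0 ?divr_ge0 ?ltW.
rewrite le_eqVlt; apply/orP; left; apply/eqP.
by field; rewrite gt_eqF.
Qed.

(** Halving the length divides the quadratic term by 4 while the number of blocks only doubles, so
    chaining converges even against shrinking thresholds. A variance bound, linear in u, would not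
    allow this. *)
Lemma Pr_pool_lags_fine : u <= 2^-1 ->
  Pr mu pool_lags <= 7000 * (n%:R * u + (n%:R * u) ^+ 2) / ((1 - phi) * y) ^+ 4.
Proof.
move=> u2; have p0 : 0 <= phi by rewrite -(phiE 0); exact: laplace_ge0.
set p := 1 - phi; have pp : 0 < p by rewrite subr_gt0.
have p1 : p <= 1 by rewrite gerBl.
have eu : expR u <= 2.
  apply: le_trans (_ : expR 2^-1 <= _); first by rewrite ler_expR.
  have := expR_ge1Dx (- 2^-1 : R); rewrite expRN.
  have := expR_gt0 (2^-1 : R); move: (expR _) => e e0 he.
  have : e * (1 - 2^-1) <= e * e^-1 by rewrite ler_pM2l.
  by rewrite divff ?gt_eqF//; lra.
have hm q r (C : R) : (0 < q)%N -> 0 <= C ->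
    (forall k : nat, k.+1%:R ^+ q - k%:R ^+ q <= C * 'C(k + r, r)%:R) ->
    forall i, (i < n)%N ->
      Ex mu (fun w => completions (c i) s u M w ^+ q) <= 2 * C * u / p ^+ r.+1.
  move=> q0 C0 hC i ni; rewrite /p -(phiE i).
  by apply: (Ex_completions_moment mu_law (@c_inj1 i) (LF i)
      (fun v => @residual_law i v ni) M s_ge0 u_ge0) => //;
    rewrite phiE.
have h2 := hm 2%N 1%N 2 erefl (ler0n _ _) (@square_layer_le R).
have h4 := hm 4%N 3%N 24 erefl (ler0n _ _) (@fourth_layer_le R).
have bc i := bm_completions (c i) s u M.
have e0 i : 0 <= m1 i.
  by apply: Ex_ge0 => w; apply: sumr_ge0 => m _; rewrite ler0n.
have eu1 i : (i < n)%N -> m1 i <= u.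
  move=> ni; exact: (Ex_completions_le mu_law (@c_inj1 i) (LF i)
    (fun v => @residual_law i v ni) M s_ge0 u_ge0).
have V0 : 0 <= 4 * u / p ^+ 2.
  by apply: divr_ge0; [exact: mulr_ge0|exact/exprn_ge0/ltW].
have V40 : 0 <= 392 * u / p ^+ 4.
  by apply: divr_ge0; [exact: mulr_ge0 (ler0n _ _) u_ge0|exact/exprn_ge0/ltW].
have X2 i : Ex mu (fun w => X i w ^+ 2) <= 4 * u / p ^+ 2.
  rewrite /X; case: ltnP => ni; last by under eq_Ex do rewrite expr0n; rewrite Ex_cst.
  apply: le_trans (_ : Ex mu (fun w => completions (c i) s u M w ^+ 2) <= _); last first.
    by apply: le_trans (h2 i ni) _; rewrite -natrM.
  by rewrite Ex_deviation_square// gerBl sqr_ge0.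
have u4 i : (i < n)%N -> m1 i ^+ 4 <= u.
  move=> ni; have m1' : m1 i <= 1 by have := eu1 i ni; lra.
  apply: le_trans (eu1 i ni); rewrite exprS ler_piMr//.
  by apply: exprn_ile1.
(* 392 = 8 (48 + 1): the moment bound gives 48 u / p^4 for the count, and the fourth power of its
   mean is at most u. *)
have X4 i : Ex mu (fun w => X i w ^+ 4) <= 392 * u / p ^+ 4.
  have [ni|ni] := ltnP i n; last first.
    by rewrite /X ltnNge ni /=; under eq_Ex do rewrite expr0n; rewrite Ex_cst.
  have bc4 := bmX 4 (bc i).
  have b1 : bounded_measurable (fun w => 8 * completions (c i) s u M w ^+ 4).
    by apply: bmM => //; exact: bm_cst.
  apply: le_trans (_ : Ex mu (fun w => 8 * completions (c i) s u M w ^+ 4 + 8 * m1 i ^+ 4) <= _).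
    apply: le_Ex; [exact: bmX|by apply: bmD => //; exact: bm_cst|].
    by move=> w; rewrite /X ni -mulrDr [X in _ <= _ * X]addrC; exact: fourth_power_sub_le.
  rewrite ExD//; last exact: bm_cst.
  rewrite ExZ// Ex_cst; apply: le_trans (_ : 8 * (2 * 24 * u / p ^+ 4) + 8 * (u / p ^+ 4) <= _).
    apply: lerD; rewrite ler_pM2l//; try exact: h4.
    apply: le_trans (u4 i ni) _; rewrite ler_pdivlMr ?exprn_gt0// ler_piMr//.
    by apply: exprn_ile1 => //; exact: ltW.
  by rewrite le_eqVlt; apply/orP; left; apply/eqP; field; rewrite gt_eqF.
apply: le_trans (Pr_pool_lags_le (k := 4) erefl) _.
have := Ex_fourth_sum mu_law disj bX dX X0 n V0 X2 X4.
move=> h; rewrite ler_pdivrMr ?exprn_gt0 ?divr_gt0//; apply: le_trans h _.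
(* After multiplication by 2^4, from (y/2)^4, the constants are 16 * 392 = 6272 and 16 * 3 * 16 =
   768; the identity records their distances to 7000, divided by 16. *)
rewrite -subr_ge0 [X in 0 <= X](_ : _ = (91 / 2 * (n%:R * u) + 779 / 2 * (n%:R * u) ^+ 2) / p ^+ 4).
  apply: divr_ge0; last exact/exprn_ge0/ltW.
  have nu0 : 0 <= n%:R * u by exact: mulr_ge0.
  have q1 : (0 : R) <= 91 / 2 by lra.
  have q2 : (0 : R) <= 779 / 2 by lra.
  exact: addr_ge0 (mulr_ge0 q1 nu0) (mulr_ge0 q2 (exprn_ge0 2 nu0)).
by field; rewrite (gt_eqF pp) (gt_eqF y_gt0).
Qed.

End PoolBlock.
End Pool.

(** * Dyadic chaining over a window *)

Lemma powR_exprn (R : realType) (a e : R) j : 0 <= a ->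
  (a ^+ j) `^ e = (a `^ e) ^+ j.
Proof.
move=> a0; rewrite -(powR_mulrn j a0) -(powR_mulrn j (powR_ge0 a e)).
by rewrite -!powRrM mulrC.
Qed.

Lemma measurable_has d (T : measurableType d) (J : Type) (r : seq J)
    (b : J -> T -> bool) : (forall j, measurable_fun setT (b j)) ->
  measurable_fun setT (fun w => has (b^~ w) r).
Proof.
move=> mb; elim: r => [|j r IH]; first exact: measurable_cst.
exact: measurable_or (mb j) IH.
Qed.

(** Round [j] down to multiples of 2^l for l = 0, ..., N+1. Depending on one binary digit, each
    passage from l to l+1 changes nothing or removes one dyadic block of level l; the last rounding
    gives 0. *)
Lemma dyadic_chaining (R : realType) (f thr : nat -> R) N :
  (forall l i, (l <= N)%N -> (i.+1 * 2 ^ l <= 2 ^ N)%N ->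
     f (i.+1 * 2 ^ l)%N - f (i * 2 ^ l)%N <= thr l) ->
  (forall l, 0 <= thr l) ->
  forall j, (j <= 2 ^ N)%N -> f j - f 0%N <= \sum_(l < N.+1) thr l.
Proof.
move=> hf thr0 j jN.
have H l : (l <= N.+1)%N ->
    f j - f (j %/ 2 ^ l * 2 ^ l)%N <= \sum_(l' < l) thr l'.
  elim: l => [|l IH] lN; first by rewrite expn0 divn1 muln1 subrr big_ord0.
  rewrite big_ord_recr /=; apply: le_trans (lerD (IH (ltnW lN)) (_ :
    f (j %/ 2 ^ l * 2 ^ l)%N - f (j %/ 2 ^ l.+1 * 2 ^ l.+1)%N <= thr l)).
    by rewrite addrA subrK.
  rewrite expnSr divnMA mulnA; set k := (j %/ 2 ^ l)%N.
  have ek : k = (odd k + k %/ 2 * 2)%N by rewrite divn2 muln2 odd_double_half.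
  rewrite -mulnA [(2 ^ l * 2)%N]mulnC mulnA {1}ek.
  case: (odd k) ek => ek; last by rewrite add0n subrr.
  rewrite add1n; apply: hf => //; apply: leq_trans jN.
  by rewrite -add1n -ek /k leq_divM.
have := H N.+1 (leqnn _).
by rewrite divn_small ?mul0n// (leq_ltn_trans jN)// ltn_exp2l.
Qed.

Section Window.
Context (I : eqType) (R : realType) (L : I -> probability R R).
Local Notation W := {paths I -> R}.
Context (mu : probability W R) (mu_law : product_law L predT mu).
Context (c : nat -> nat -> I) (c_inj : forall i j m k, c i m = c j k -> i = j /\ m = k).
Context (F : probability R R) (LF : forall i m, L (c i m.+1) = F).
Context (n : nat).
Hypothesis residual_law : forall i v, (i < n)%N -> 0 <= v ->
  Pr mu (fun w => pos w (c i 0%N) <= v) = mean_cut mu (c i) v.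
Context (phi : R) (phi_lt1 : phi < 1) (phiE : forall i, laplace mu (c i) = phi).

Lemma pool_completions_cat s u v M (w : W) : 0 <= u -> 0 <= v ->
  pool_completions c n s (u + v) M w =
  pool_completions c n s u M w + pool_completions c n (s + u) v M w.
Proof.
move=> u0 v0; rewrite /pool_completions -big_split; apply: eq_bigr => i _ /=.
rewrite /completions -big_split; apply: eq_bigr => m _ /=.
rewrite /in_block; move: (epoch _ _ _) => x.
by rewrite addrA; case: (ltP s x) => h1; case: (leP x (s + u)) => h2;
  case: (ltP (s + u) x) => h3; case: (leP x (s + u + v)) => h4 //=;
  rewrite ?addr0 ?add0r//; lra.
Qed.

Lemma pool_completions_ge0 s u M (w : W) : 0 <= pool_completions c n s u M w.
Proof.
by apply: sumr_ge0 => i _; apply: sumr_ge0 => m _; rewrite ler0n.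
Qed.

Variables (M N : nat) (t u y : R).
Hypotheses (u_gt0 : 0 < u) (ut : u <= t) (y_gt0 : 0 < y).

(** Decay of the thresholds. It must be slow enough for the union bounds, where 1/(2 q^4) < 1 and 2
    * 2^-e / q^2 <= q are used, while the thresholds still sum to at most y/20 * 1/(1 - q) = y/2. *)
Let q : R := 9 / 10.
Let len (l : nat) : R := u * 2^-1 ^+ (N - l).
Let thr (l : nat) : R := y / 20 * q ^+ (N - l).

Let len_gt0 l : 0 < len l.
Proof. by rewrite mulr_gt0// exprn_gt0. Qed.

Let q_gt0 : 0 < q. Proof. by rewrite divr_gt0. Qed.

Let thr_gt0 l : 0 < thr l.
Proof. by rewrite mulr_gt0 ?exprn_gt0 ?divr_gt0. Qed.

Let lenE l : (l <= N)%N -> len l = len 0 * (2 ^ l)%:R.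
Proof.
move=> lN; rewrite /len subn0 -{2}(subnK lN) exprD natrX -mulrA; congr (_ * _).
by rewrite -mulrA -exprMn mulVf// expr1n mulr1.
Qed.

(** Blocks are numbered backwards from [t], since all the intervals to be controlled end there. *)
Let block_bad l i w := pool_lags c n (t - i.+1%:R * len l) (len l) M (thr l) w.

Definition window_lags (w : W) : bool :=
  has (fun l => has (fun i => block_bad l i w) (iota 0 (2 ^ (N - l)))) (iota 0 N.+1).

Lemma sum_geometric_le (r : R) k : 0 <= r < 1 ->
  \sum_(l < k) r ^+ l <= (1 - r)^-1.
Proof.
move=> hr; have := sum_binomial_geometric 0 k hr.
by under eq_bigr do rewrite bin0 mul1r; rewrite expr1.
Qed.

Let sum_rev (g : nat -> R) : \sum_(l < N.+1) g (N - l)%N = \sum_(l < N.+1) g l.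
Proof.
rewrite [RHS](reindex_inj rev_ord_inj) /=; apply: eq_bigr => l _.
by rewrite subSS.
Qed.

(** Chaining costs y/2 at the grid points. Between two of them completions are nonnegative, so at
    most n times one cell is lost, which is the other y/2. *)
Lemma window_lagsN (w : W) : n%:R * (u / (2 ^ N)%:R) <= y / 2 -> ~~ window_lags w ->
  forall s, t - u <= s <= t ->
  n%:R * (t - s) - pool_completions c n s (t - s) M w <= y.
Proof.
move=> hn hw s /andP[us st].
have d0 : 0 < len 0 := len_gt0 0.
have eN : len 0 * (2 ^ N)%:R = u by rewrite -lenE// /len subnn expr0 mulr1.
pose f (j : nat) : R := n%:R * (j%:R * len 0) -
   pool_completions c n (t - j%:R * len 0) (j%:R * len 0) M w.
have hf j : (j <= 2 ^ N)%N -> f j <= y / 2.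
  move=> jN; have f0 : f 0%N = 0.
    rewrite /f mul0r mulr0 subr0 sub0r; apply/eqP; rewrite oppr_eq0; apply/eqP.
    apply: big1 => i _; apply: big1 => m _; rewrite /in_block.
    by rewrite ?subr0 ?addr0; case: ltP => h1 //=; rewrite leNgt h1.
  have := @dyadic_chaining R f thr N _ (fun l => ltW (thr_gt0 l)) j jN.
  rewrite f0 subr0 => h; apply: le_trans (h _) _.
    move=> l i lN il.
    have e k : (k * 2 ^ l)%N%:R * len 0 = k%:R * len l.
      by rewrite natrM (lenE lN); ring.
    have : ~~ block_bad l i w.
      move/hasPn: hw => /(_ l); rewrite mem_iota add0n ltnS => /(_ lN) /hasPn /(_ i).
      rewrite mem_iota add0n; apply; move: il.
      have -> : (2 ^ N = 2 ^ (N - l) * 2 ^ l)%N by rewrite -expnD subnK.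
      by rewrite leq_pmul2r ?expn_gt0.
    rewrite /block_bad /pool_lags -ltNge => /ltW; apply: le_trans.
    rewrite /f !e; have e1 : i.+1%:R * len l = len l + i%:R * len l.
      by rewrite -natr1 mulrDl mul1r addrC.
    have l0 := ltW (len_gt0 l).
    rewrite [X in pool_completions _ _ _ X]e1 pool_completions_cat//; last exact: mulr_ge0.
    rewrite (_ : t - i.+1%:R * len l + len l = t - i%:R * len l); last by rewrite e1; ring.
    by rewrite e1 mulrDr; lra.
  rewrite -mulr_sumr (sum_rev (fun l => q ^+ l)).
  have hq : 0 <= q < 1 by rewrite ltW//= ltr_pdivrMr// mul1r ltr_nat.
  apply: le_trans (_ : y / 20 * (1 - q)^-1 <= _).
    by apply: ler_wpM2l; [rewrite divr_ge0// ltW|exact: sum_geometric_le].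
  by rewrite /q le_eqVlt; apply/orP; left; apply/eqP; field.
pose k := Num.truncn ((t - s) / len 0).
have hk0 : 0 <= (t - s) / len 0 by rewrite divr_ge0 ?subr_ge0// ltW.
have /andP[k1 k2] := truncn_itv hk0.
rewrite -/k ler_pdivlMr// in k1; rewrite -/k ltr_pdivrMr// in k2.
have kN : (k <= 2 ^ N)%N.
  rewrite -(ler_nat R) -(ler_pM2r d0); apply: le_trans k1 _.
  by rewrite mulrC eN; lra.
have := hf k kN; rewrite /f.
have -> : t - s = (t - s - k%:R * len 0) + k%:R * len 0 by ring.
rewrite pool_completions_cat; [|lra|by rewrite mulr_ge0// ltW].
have := pool_completions_ge0 s (t - s - k%:R * len 0) M w.
rewrite (_ : s + (t - s - k%:R * len 0) = t - k%:R * len 0); last by ring.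
have : n%:R * (t - s - k%:R * len 0) <= y / 2.
  apply: le_trans hn; apply: ler_wpM2l => //.
  rewrite (_ : u / _ = len 0); last by rewrite -eN mulfK// pnatr_eq0 expn_eq0.
  by rewrite -natr1 mulrDl mul1r in k2; lra.
move: (pool_completions _ _ _ _ _ _) (pool_completions _ _ _ _ _ _) => p1 p2.
by rewrite mulrDr; lra.
Qed.

Lemma window_room l i : (l <= N)%N -> (i < 2 ^ (N - l))%N -> i.+1%:R * len l <= u.
Proof.
move=> lN il; apply: le_trans (_ : (2 ^ (N - l))%:R * len l <= _).
  by rewrite ler_wpM2r ?ler_nat// ltW// len_gt0.
by rewrite /len natrX mulrCA -exprMn mulfV// expr1n mulr1.
Qed.

Context (G e : R).
(** 729/1000 = q^3, so 2 * 2^-e / q^2 <= q: the coarse union bound decays at the rate q. *)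
Hypothesis e_big : 2^-1 `^ e <= 2^-1 * (729 / 1000).
Hypothesis G_ge0 : 0 <= G.
Hypothesis coarse_variance : forall i s v, (i < n)%N -> 0 <= s -> 2^-1 <= v -> s + v <= t ->
  Ex mu (fun w => (completions (c i) s v M w - Ex mu (completions (c i) s v M)) ^+ 2)
  <= G * v `^ e.
Hypothesis defect_small : forall i s v, 0 <= s -> 0 <= v -> s + v <= t ->
  n%:R * renewal_defect mu (c i) s v M <= y / 40 * (9 / 10) ^+ N.

Lemma measurable_window_lags : measurable_fun setT window_lags.
Proof.
by apply: measurable_has => l; apply: measurable_has => i; exact: measurable_pool_lags.
Qed.

Let fine j : R := 7000 * (n%:R * (u * 2^-1 ^+ j) + (n%:R * (u * 2^-1 ^+ j)) ^+ 2) /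
  ((1 - phi) * (y / 20 * q ^+ j)) ^+ 4.
Let coarse j : R := 4 * (n%:R * (G * (u * 2^-1 ^+ j) `^ e)) / (y / 20 * q ^+ j) ^+ 2.

Let p_gt0 : 0 < 1 - phi. Proof. by rewrite subr_gt0. Qed.

Let fine_ge0 j : 0 <= fine j.
Proof.
have h : 0 <= n%:R * (u * 2^-1 ^+ j) by rewrite !mulr_ge0 ?exprn_ge0// ltW.
apply: divr_ge0; last by rewrite exprn_even_ge0.
exact: mulr_ge0 (ler0n _ _) (addr_ge0 h (exprn_ge0 2 h)).
Qed.

Let coarse_ge0 j : 0 <= coarse j.
Proof.
apply: divr_ge0; last by rewrite exprn_even_ge0.
by rewrite !mulr_ge0 ?powR_ge0.
Qed.

Lemma Pr_block_lags l i : (l <= N)%N -> (i < 2 ^ (N - l))%N ->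
  Pr mu (block_bad l i) <= fine (N - l) + coarse (N - l).
Proof.
move=> lN il; have room := window_room lN il.
have s0 : 0 <= t - i.+1%:R * len l by have := ut; lra.
have v0 := len_gt0 l.
have iv : len l <= i.+1%:R * len l by apply: ler_peMl; [exact: ltW|rewrite ler1n].
have sv : t - i.+1%:R * len l + len l <= t by lra.
have hd j : n%:R * renewal_defect mu (c j) (t - i.+1%:R * len l) (len l) M <= thr l / 2.
  apply: le_trans (defect_small j s0 (ltW v0) sv) _.
  rewrite /thr (_ : y / 20 * q ^+ (N - l) / 2 = y / 40 * q ^+ (N - l)); last by field.
  apply: ler_wpM2l; first by rewrite divr_ge0// ltW.
  by apply: ler_wiXn2l; [exact: ltW|rewrite /q; lra|exact: leq_subr].
(* Both bounds are added at every level, so that the two geometric sums need not be split at length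
   1/2. *)
have [h|h] := leP (len l) 2^-1.
  apply: le_trans (Pr_pool_lags_fine mu_law c_inj LF residual_law phi_lt1 phiE
    s0 (ltW v0) (thr_gt0 l) hd h) _.
  by rewrite lerDl.
apply: le_trans (Pr_pool_lags_coarse mu_law c_inj LF residual_law
  s0 (ltW v0) (thr_gt0 l) hd _
  (fun j jn => coarse_variance jn s0 (ltW h) sv)) _.
  by rewrite mulr_ge0// powR_ge0.
by rewrite lerDr.
Qed.

(** There are 2^j blocks at depth j = N - l. In the fine bound the linear term grows like q^(-4j) <=
    2^j, which produces 2^N, and the quadratic term has a geometric sum at most 5. In the coarse
    bound 4 * 20^2 times 1/(1 - q) = 10 is 16000. *)
Lemma Pr_window_lags : Pr mu window_lags <=
  7000 * 20 ^+ 4 * (2 * (2 ^ N)%:R * (n%:R * u) + 5 * (n%:R * u) ^+ 2) /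
    ((1 - phi) * y) ^+ 4 + 16000 * (n%:R * G * u `^ e) / y ^+ 2.
Proof.
have mb l i : measurable_fun setT (block_bad l i) by exact: measurable_pool_lags.
have mh l : measurable_fun setT (fun w => has (fun i => block_bad l i w)
    (iota 0 (2 ^ (N - l)))).
  exact: measurable_has.
apply: le_trans (_ : \sum_(l < N.+1)
    (2 ^ (N - l))%:R * (fine (N - l) + coarse (N - l)) <= _).
  have H1 := Pr_le_sum mu (r := iota 0 N.+1) measurable_window_lags mh (fun w h => h).
  apply: le_trans H1 _.
  rewrite -(subn0 N.+1) -/(index_iota 0 N.+1) big_mkord; apply: ler_sum => l _.
  have H2 := Pr_le_sum mu (r := iota 0 (2 ^ (N - l))) (mh l) (mb l) (fun w h => h).
  apply: le_trans H2 _.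
  rewrite -[X in iota 0 X]subn0 -/(index_iota 0 _) big_mkord.
  apply: le_trans (_ : \sum_(i < 2 ^ (N - l)) (fine (N - l) + coarse (N - l)) <= _).
    by apply: ler_sum => i _; apply: Pr_block_lags => //; rewrite -ltnS.
  by rewrite sumr_const card_ord mulr_natl.
rewrite (sum_rev (fun j => (2 ^ j)%:R * (fine j + coarse j))).
under eq_bigr do rewrite mulrDr; rewrite big_split /=.
have n0 : (0 : R) <= n%:R by [].
have y0 := y_gt0; have u0 := u_gt0; have p0 := p_gt0.
have q0 := q_gt0.
apply: lerD.
  set D := ((1 - phi) * y) ^+ 4.
  have D0 : 0 < D by rewrite exprn_gt0// mulr_gt0.
  have e1 j : (2 ^ j)%:R * fine j = 7000 * 20 ^+ 4 / D *
     (n%:R * u * (q ^- 4) ^+ j + (n%:R * u) ^+ 2 * (2^-1 * q ^- 4) ^+ j).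
    rewrite /fine natrX [(2^-1 * _) ^+ j]exprMn !exprVn (exprAC q 4 j) /D.
    have a0 : (2 : R) ^+ j != 0 by rewrite expf_neq0.
    have b0 : q ^+ j != 0 by rewrite expf_neq0// gt_eqF.
    move: (2 ^+ j) (q ^+ j) a0 b0 => a b a0 b0.
    by field; rewrite a0 b0 (gt_eqF y0) (gt_eqF p0).
  under eq_bigr do rewrite e1.
  rewrite -mulr_sumr big_split /= -!mulr_sumr.
  rewrite [leRHS]mulrAC; apply: ler_wpM2l.
    exact: divr_ge0 (mulr_ge0 (ler0n _ _) (exprn_ge0 _ (ler0n _ _))) (ltW D0).
  have nu0 : 0 <= n%:R * u by rewrite mulr_ge0// ltW.
  apply: lerD.
    rewrite [leRHS]mulrC; apply: ler_wpM2l => //.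
    have H k : \sum_(j < k) (q ^- 4) ^+ j <= (2 ^ k)%:R.
      elim: k => [|k IH]; first by rewrite big_ord0.
      rewrite big_ord_recr /= expnS mul2n -addnn natrD; apply: lerD => //.
      rewrite natrX; apply: lerXn2r; rewrite ?nnegrE ?invr_ge0 ?exprn_ge0 ?ltW//.
      by rewrite /q -exprVn invf_div !exprS; lra.
    by apply: le_trans (H N.+1) _; rewrite expnS natrM.
  rewrite [leRHS]mulrC; apply: ler_wpM2l; first exact: exprn_ge0.
  have hr : 0 <= 2^-1 * q ^- 4 < 1.
    by rewrite mulr_ge0 ?invr_ge0 ?exprn_ge0 ?ltW//= /q -exprVn invf_div !exprS; lra.
  apply: le_trans (sum_geometric_le _ hr) _.
  rewrite invf_ple ?posrE ?subr_gt0//; last by case/andP: hr.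
  by rewrite /q -exprVn invf_div !exprS; lra.
have K0 : 0 <= 1600 * (n%:R * G * u `^ e) / y ^+ 2.
  apply: divr_ge0; last exact/exprn_ge0/ltW.
  exact: mulr_ge0 (ler0n _ _) (mulr_ge0 (mulr_ge0 n0 G_ge0) (powR_ge0 _ _)).
have e2 j : (2 ^ j)%:R * coarse j <= 1600 * (n%:R * G * u `^ e) / y ^+ 2 * (9 / 10) ^+ j.
  have h0 : 0 <= 2^-1 `^ e := powR_ge0 _ _.
  have eh : (2^-1 ^+ j) `^ e = (2^-1 `^ e) ^+ j.
    by apply: powR_exprn; rewrite invr_ge0.
  rewrite /coarse powRM; [|exact: ltW|by rewrite exprn_ge0// invr_ge0].
  rewrite eh.
  rewrite [leLHS](_ : _ = 1600 * (n%:R * G * u `^ e) / y ^+ 2 *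
     (2 * 2^-1 `^ e / q ^+ 2) ^+ j); last first.
    rewrite natrX [X in _ = _ * X]exprMn [(2 * _) ^+ j]exprMn exprVn (exprAC q 2 j).
    have b0 : q ^+ j != 0 by rewrite expf_neq0// gt_eqF.
    move: (q ^+ j) b0 => b b0.
    by field; rewrite (gt_eqF y0) b0.
  apply: ler_wpM2l; first exact: K0.
  have z0 : 0 <= 2 * 2^-1 `^ e / q ^+ 2.
    by apply: divr_ge0; [exact: mulr_ge0|exact/exprn_ge0/ltW].
  apply: lerXn2r; [by rewrite nnegrE|by rewrite nnegrE; lra|].
  rewrite ler_pdivrMr ?exprn_gt0//; have := e_big; rewrite /q !exprS expr0; lra.
apply: le_trans (_ : \sum_(j < N.+1)
    1600 * (n%:R * G * u `^ e) / y ^+ 2 * (9 / 10) ^+ j <= _).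
  by apply: ler_sum => j _; exact: e2.
rewrite -mulr_sumr (_ : 16000 * _ / _ = 1600 * (n%:R * G * u `^ e) / y ^+ 2 * 10); last first.
  by field; rewrite gt_eqF.
apply: ler_wpM2l; first exact: K0.
have hr : 0 <= q < 1 by rewrite ltW//= ltr_pdivrMr// mul1r ltr_nat.
apply: le_trans (sum_geometric_le _ hr) _.
by rewrite invf_ple ?posrE /q; lra.
Qed.

End Window.

(** * Bursts of arrivals *)

Section Arrivals.
Context (I : eqType) (R : realType) (L : I -> probability R R).
Local Notation W := {paths I -> R}.
Context (mu : probability W R) (mu_law : product_law L predT mu).
Context (a : nat -> I) (a_inj : injective a).

Section MaximalInequality.
Context (g : R -> R) (bg : bounded_measurable g) (V : R).
Local Notation Z i w := (g (w (a i)) : R).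
Hypothesis Z0 : forall i, Ex mu (fun w => Z i w) = 0.
Hypothesis ZV : forall i, Ex mu (fun w => Z i w ^+ 2) <= V.
Variables (y : R).
Hypothesis y_gt0 : 0 < y.

Definition walk_exits i H (d : R) (w : W) : bool :=
  has (fun j => y <= `|d + \sum_(l < j) Z (i + l) w|) (iota 0 H.+1).

Let bZ i : bounded_measurable (fun w : W => Z i w).
Proof. exact: bm_coordinate. Qed.

Lemma measurable_walk_exits i H (f : W -> R) : measurable_fun setT f ->
  measurable_fun setT (fun w => walk_exits i H (f w) w).
Proof.
move=> mf; apply: measurable_has => j; apply: measurable_fun_ler => //.
apply: measurableT_comp => //; apply: measurable_funD => //.
by apply: measurable_sum => l; case: (bZ (i + l)).
Qed.

Lemma walk_exitsS i H d w : walk_exits i H.+1 d w =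
  (y <= `|d|) || walk_exits i.+1 H (d + Z i w) w.
Proof.
rewrite /walk_exits -[iota 0 H.+2]/(0%N :: iota (1 + 0) H.+1) iotaDl.
move: (iota 0 H.+1) => r; rewrite [has _ (_ :: _)]/= has_map big_ord0 addr0.
congr (_ || _); apply: eq_has => j; rewrite /= add1n big_ord_recl addn0 addrA.
congr (_ <= `|_ + _|).
by apply: eq_bigr => l _; rewrite /bump /= addnS.
Qed.

Lemma depends_on_walk_exits i H d :
  depends_on (predC (fun x => has (fun l => a l == x) (iota 0 i))) (walk_exits i H d).
Proof.
move=> w w' e; apply: eq_has => j; congr (_ <= `|_ + _|).
apply: eq_bigr => l _; rewrite e//=; apply/hasPn => k; rewrite mem_iota add0n => /= ki.
by rewrite (inj_eq a_inj) neq_ltn (leq_trans ki (leq_addr _ _)).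
Qed.

(* The starting point [d] is arbitrary so that the induction can condition on
   the first step. *)
Lemma Pr_walk_exits H i d : Pr mu (walk_exits i H d) <= (d ^+ 2 + H%:R * V) / y ^+ 2.
Proof.
have y2 : 0 < y ^+ 2 by rewrite exprn_gt0.
have V0 : 0 <= V by apply: le_trans (ZV 0); apply: Ex_ge0 => w; exact: sqr_ge0.
have mw k K (d' : R) : measurable_fun setT (walk_exits k K d').
  exact: measurable_walk_exits (measurable_cst _).
have far k K (d' : R) : y <= `|d'| ->
    Pr mu (walk_exits k K d') <= (d' ^+ 2 + K%:R * V) / y ^+ 2.
  move=> yd; apply: le_trans (Pr_le1 _ (mw k K d')) _.
  rewrite ler_pdivlMr// mul1r -[leLHS]addr0; apply: lerD; last exact: mulr_ge0.
  by rewrite -[leRHS]real_normK ?num_real// lerXn2r ?nnegrE// ltW.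
elim: H i d => [|H IH] i d; have [yd|yd] := leP y `|d|; [exact: far| |exact: far|].
  rewrite [leLHS](_ : _ = 0); last first.
    rewrite /Pr -[RHS](Ex_cst mu 0); apply: eq_Ex => w.
    by rewrite /walk_exits /= big_ord0 addr0 orbF leNgt yd.
  by rewrite mul0r addr0 divr_ge0 ?sqr_ge0// ltW.
have e w : walk_exits i H.+1 d w = walk_exits i.+1 H (d + Z i w) w.
  by rewrite walk_exitsS leNgt yd.
have bw : bounded_measurable (fun w => (walk_exits i H.+1 d w)%:R : R).
  exact: bm_indicator.
have bd : bounded_measurable (fun w : W => d + Z i w) by apply: bmD => //; exact: bm_cst.
have bq : bounded_measurable (fun w : W => (d + Z i w) ^+ 2) by exact: bmX.
rewrite /Pr (Ex_mix mu_law (pred1 (a i)) bw).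
apply: le_trans (_ : Ex mu (fun w => (y ^+ 2)^-1 * ((d + Z i w) ^+ 2 + H%:R * V)) <= _).
  apply: le_Ex; first exact: (bm_Ex_mix mu (pred1 (a i)) bw).
    by apply: bmM; [exact: bm_cst|apply: bmD => //; exact: bm_cst].
  move=> w; rewrite mulrC; apply: le_trans (IH i.+1 (d + Z i w)).
  rewrite le_eqVlt; apply/orP; left; apply/eqP; apply: eq_Ex => w'.
  rewrite e {1}/mix /= eqxx; congr (nat_of_bool _)%:R.
  apply: depends_on_walk_exits => x hx; rewrite /mix /=.
  move/hasPn: (hx : ~~ has (fun l => a l == x) (iota 0 i.+1)) => {}hx.
  case: eqP => // xa; have := hx i; rewrite mem_iota add0n ltnS leqnn xa eqxx.
  by move=> /(_ erefl).
rewrite ExZ; last by apply: bmD => //; exact: bm_cst.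
rewrite ExD//; last exact: bm_cst.
rewrite Ex_cst mulrC; apply: ler_wpM2r; first by rewrite invr_ge0 ltW.
have -> : Ex mu (fun w => (d + Z i w) ^+ 2) = d ^+ 2 + Ex mu (fun w => Z i w ^+ 2).
  transitivity (Ex mu (fun w => d ^+ 2 + (2 * d * Z i w + Z i w ^+ 2))).
    by apply: eq_Ex => w; ring.
  have bz2 : bounded_measurable (fun w : W => Z i w ^+ 2) by exact: bmX.
  have bdz : bounded_measurable (fun w : W => 2 * d * Z i w).
    by apply: bmM => //; exact: bm_cst.
  rewrite ExD; [|exact: bm_cst|exact: bmD].
  by rewrite ExD// ExZ// Z0 mulr0 add0r Ex_cst.
rewrite -natr1 mulrDl mul1r -addrA; apply: lerD => //.
by rewrite addrC; apply: lerD.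
Qed.

End MaximalInequality.

(** The first arrival is put at time 1, so that no job is present or arriving at time 0 apart from
    those in service. *)
Definition arrival (k : nat) (w : W) : R := 1 + \sum_(i < k) pos w (a i).

Lemma arrivalS k w : arrival k.+1 w = arrival k w + pos w (a k).
Proof. by rewrite /arrival big_ord_recr /= addrA. Qed.

Lemma arrival_mono w : {homo arrival^~ w : m k / (m <= k)%N >-> m <= k}.
Proof.
move=> m k mk; rewrite -(subnKC mk); elim: (k - m)%N => [|j IH]; first by rewrite addn0.
by rewrite addnS arrivalS; apply: le_trans IH _; rewrite lerDl pos_ge0.
Qed.

Lemma measurable_arrival k : measurable_fun setT (arrival k).
Proof.
by apply: measurable_funD => //; apply: measurable_sum => i; exact: measurable_pos.
Qed.

(** A stopping rule: it reads only the gaps before index [i], hence is independent of the walk that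
    starts there. *)
Definition first_after (r : R) (i : nat) (w : W) : bool :=
  (r < arrival i w) && all (fun l => arrival l w <= r) (iota 0 i).

Lemma measurable_first_after r i : measurable_fun setT (first_after r i).
Proof.
apply: measurable_and.
  by apply: measurable_fun_ltr => //; exact: measurable_arrival.
elim: (iota 0 i) => [|l s IH]; first exact: measurable_cst.
apply: (measurable_and (f := fun w => arrival l w <= r) _ IH).
by apply: measurable_fun_ler => //; exact: measurable_arrival.
Qed.

Lemma depends_on_first_after r i :
  depends_on (fun x => has (fun l => a l == x) (iota 0 i)) (first_after r i).
Proof.
move=> w w' e.
have ea l : (l <= i)%N -> arrival l w = arrival l w'.
  move=> li; congr (_ + _); apply: eq_bigr => k _; rewrite /pos e//.
  by apply/hasP; exists (k : nat) => //; rewrite mem_iota add0n (leq_trans (ltn_ord k) li).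
rewrite /first_after ea//; congr (_ && _); apply: eq_in_all => l.
by rewrite mem_iota add0n => /= li; rewrite ea// ltnW.
Qed.

Lemma first_after_inj r i j w : first_after r i w -> first_after r j w -> i = j.
Proof.
rewrite /first_after => /andP[ri /allP hi] /andP[rj /allP hj].
case: (ltngtP i j) => // lt.
  by have := hj i; rewrite mem_iota add0n => /(_ lt); rewrite leNgt ri.
by have := hi j; rewrite mem_iota add0n => /(_ lt); rewrite leNgt rj.
Qed.

Section Burst.
Variables (lambda cut V : R).
Hypothesis lambda_ge0 : 0 <= lambda.
Hypothesis cut_ge0 : 0 <= cut.
(** Gaps rescaled to mean about one and cut to be bounded. Cutting only shortens gaps, and
    [no_burst] uses them only as lower bounds for elapsed time. *)
Let xi (z : R) : R := Num.min (lambda * Num.max z 0) cut.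
Variable m1 : R.
Hypothesis mean_xi : forall i, Ex mu (fun w => xi (w (a i))) = m1.
Hypothesis variance_xi : forall i, Ex mu (fun w => (m1 - xi (w (a i))) ^+ 2) <= V.
Hypothesis m1_le1 : m1 <= 1.
Variables (t u y : R) (J H : nat).
Hypothesis y_ge2 : 2 <= y.
Hypotheses (H_ge : lambda * u + y <= H%:R) (H_le : H%:R <= lambda * u + 2 * y).
Hypothesis mean_loss : H%:R * (1 - m1) <= 2^-1.

Let g z := m1 - xi z.

Lemma bm_truncated_step : bounded_measurable g.
Proof.
apply: (@bm_between _ _ _ _ (m1 - cut) m1).
  apply: measurable_funB => //; apply: measurable_minr => //.
  apply: measurable_funM => //; exact: measurable_maxr.
move=> z; have h0 : 0 <= lambda * Num.max z 0 by rewrite mulr_ge0// le_max lexx orbT.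
have x0 : 0 <= xi z by rewrite le_min h0.
have x1 : xi z <= cut by rewrite ge_min lexx orbT.
by rewrite /g; lra.
Qed.

Definition burst (w : W) : bool :=
  has (fun i => first_after (t - u) i w && walk_exits g (y / 8) i H 0 w) (iota 0 J).

Lemma measurable_burst : measurable_fun setT burst.
Proof.
apply: measurable_has => i; apply: measurable_and; first exact: measurable_first_after.
exact: (measurable_walk_exits bm_truncated_step _ _ _ (measurable_cst _)).
Qed.

(** The events [first_after] are disjoint in [i], and each is independent of the following walk;
    hence Kolmogorov's bound is paid once and not [J] times. The constant is 8^2. *)
Lemma Pr_burst : Pr mu burst <= 64 * V * (lambda * u + 2 * y) / y ^+ 2.
Proof.
have y0 : 0 < y by apply: lt_le_trans y_ge2.
have y8 : 0 < y / 8 by rewrite divr_gt0.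
have mf i := measurable_first_after (t - u) i.
have mw i : measurable_fun setT (walk_exits g (y / 8) i H 0).
  exact: (measurable_walk_exits bm_truncated_step _ _ _ (measurable_cst _)).
have V0 : 0 <= V.
  by apply: le_trans (variance_xi 0); apply: Ex_ge0 => w; exact: sqr_ge0.
have bx i : bounded_measurable (fun w : W => xi (w (a i))).
  apply: (bm_coordinate (g := xi)); apply: (@bm_between _ _ _ _ 0 cut).
    apply: measurable_minr => //; apply: measurable_funM => //; exact: measurable_maxr.
  by move=> z; rewrite le_min cut_ge0 mulr_ge0 ?le_max ?lexx ?orbT//= ge_min lexx orbT.
have g0 i : Ex mu (fun w => g (w (a i))) = 0.
  by rewrite ExB ?Ex_cst ?mean_xi ?subrr//; exact: bm_cst.
set B := H%:R * V / (y / 8) ^+ 2.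
have B0 : 0 <= B by apply: divr_ge0; [exact: mulr_ge0|exact: sqr_ge0].
apply: le_trans (_ : \sum_(i <- iota 0 J) Pr mu (fun w =>
    first_after (t - u) i w && walk_exits g (y / 8) i H 0 w) <= _).
  apply: (Pr_le_sum mu (r := iota 0 J) measurable_burst _ (fun w h => h)) => i.
  exact: measurable_and.
apply: le_trans (_ : \sum_(i <- iota 0 J) Pr mu (first_after (t - u) i) * B <= _).
  apply: ler_sum => i _.
  have -> : Pr mu (fun w => first_after (t - u) i w && walk_exits g (y / 8) i H 0 w) =
      Pr mu (first_after (t - u) i) * Pr mu (walk_exits g (y / 8) i H 0).
    rewrite -(Ex_indep (K := fun x => has (fun l => a l == x) (iota 0 i)) mu_law).
    - by apply: eq_Ex => w; rewrite -natrM mulnb.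
    - exact: bm_indicator.
    - exact: bm_indicator.
    - exact: (depends_on_comp (fun b : bool => b%:R) (@depends_on_first_after (t - u) i)).
    - exact: (depends_on_comp (fun b : bool => b%:R) (@depends_on_walk_exits g (y / 8) i H 0)).
  apply: ler_wpM2l; first exact: Pr_ge0.
  apply: le_trans (Pr_walk_exits bm_truncated_step g0 variance_xi y8 H i 0) _.
  by rewrite expr0n add0r.
rewrite -mulr_suml; apply: le_trans (_ : 1 * B <= _).
  apply: ler_wpM2r => //; rewrite -Ex_sum; last by move=> i _; exact: bm_indicator.
  apply: Ex_le; first by apply: bm_sum => i _; exact: bm_indicator.
  move=> w; case: (boolP (has (fun i => first_after (t - u) i w) (iota 0 J))).
    move=> /hasP[i iJ hi]; rewrite (bigD1_seq i) ?iota_uniq//= hi big1 ?addr0// => j ji.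
    case: (boolP (first_after (t - u) j w)) => // hj.
    by rewrite (first_after_inj hj hi) eqxx in ji.
  move=> /hasPn hn; rewrite big_seq big1 ?ler01// => i /hn /negbTE ->.
  by [].
rewrite mul1r /B.
have -> : H%:R * V / (y / 8) ^+ 2 = 64 * V * H%:R / y ^+ 2.
  by field; rewrite gt_eqF.
apply: ler_wpM2r; first by rewrite invr_ge0 sqr_ge0.
by apply: ler_wpM2l => //; rewrite mulr_ge0.
Qed.

(** There are l - 1 gaps between the l arrivals, and they fit in time t - s. Their number differs
    from the rescaled time by at most two walk values of size y/8 and the truncation loss 1/2; as y
    >= 2, this and the missing gap are within y. *)
Lemma no_burst w s k l : ~~ burst w -> (k < J)%N -> (0 < l)%N -> t - u <= s ->
  s < arrival k w -> arrival (k + l).-1 w <= t ->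
  l%:R <= lambda * (t - s) + y.
Proof.
move=> nb kJ l0 us sk kt; rewrite leNgt; apply/negP => hl.
have ex : exists i, (t - u < arrival i w) by exists k; exact: le_lt_trans us sk.
have fk : (t - u < arrival k w) by exact: le_lt_trans us sk.
case: (ex_minnP ex) => i hi imin.
have ik : (i <= k)%N by exact: imin.
have fi : first_after (t - u) i w.
  rewrite /first_after hi; apply/allP => j; rewrite mem_iota add0n /= => ji.
  by rewrite leNgt; apply/negP => /imin; rewrite leqNgt ji.
move/hasPn: nb => /(_ i); rewrite mem_iota add0n => /(_ (leq_ltn_trans ik kJ)).
rewrite fi /= => /hasPn nw.
have D j : (j <= H)%N -> `|\sum_(l < j) g (w (a (i + l)%N))| < y / 8.
  by move=> jH; have := nw j; rewrite mem_iota add0n ltnS add0r -ltNge; apply.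
have sumx p q : (p <= q)%N -> \sum_(p <= j < q) xi (w (a (i + j)%N)) <=
    lambda * (arrival (i + q) w - arrival (i + p) w).
  move=> pq; rewrite -(subnKC pq); elim: (q - p)%N => [|r IH].
    by rewrite addn0 big_geq// subrr mulr0.
  rewrite addnS big_nat_recr ?leq_addr//= addnS arrivalS.
  have h : xi (w (a (i + (p + r))%N)) <= lambda * pos w (a (i + (p + r))%N).
    by rewrite ge_min lexx.
  by move: IH h; rewrite !mulrDr; lra.
have sumg q : \sum_(l < q) g (w (a (i + l)%N)) =
    q%:R * m1 - \sum_(0 <= j < q) xi (w (a (i + j)%N)).
  by rewrite sumrB sumr_const card_ord mulr_natl big_mkord.
have lam0 := lambda_ge0; have yy := y_ge2; have hH := H_ge; have ml := mean_loss.
have m11 := m1_le1.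
set e := (k + l).-1 in kt.
have eE : (e = k + l.-1)%N by rewrite /e -[in LHS](prednK l0) addnS.
have ke : (k <= e)%N by rewrite eE leq_addr.
(* Either the last arrival is within the controlled stretch of the walk, and the gaps from k on are
   a difference of two of its values, or too many arrivals follow index i. *)
have [eH|He] := leqP (e - i) H.
  have h1 := D (e - i)%N eH; have h2 := D (k - i)%N (leq_trans (leq_sub2r i ke) eH).
  rewrite !sumg in h1 h2; rewrite (@big_cat_nat _ _ _ (k - i)) //= in h1; last exact: leq_sub2r.
  have h3 := sumx (k - i)%N (e - i)%N (leq_sub2r i ke).
  rewrite !subnKC// in h3; last exact: leq_trans ke.
  have h4 : lambda * (arrival e w - arrival k w) <= lambda * (t - s).
    by apply: ler_wpM2l => //; lra.
  have h5 : (e - i)%N%:R * m1 - (k - i)%N%:R * m1 = (l%:R - 1) * m1.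
    rewrite -mulrBl; congr (_ * _); rewrite -natrB ?leq_sub2r//.
    rewrite -[1]/(1%:R) -natrB//; congr (_%:R).
    by rewrite eE -addnBAC// addKn subn1.
  have h6 : (l%:R - 1) * (1 - m1) <= 2^-1.
    apply: le_trans ml; apply: ler_wpM2r; first by rewrite subr_ge0.
    rewrite -[1]/(1%:R) -natrB// ler_nat subn1; apply: leq_trans eH.
    by rewrite eE -addnBAC// leq_addl.
  move: h1 h2; rewrite !ltr_norml => /andP[_ h1] /andP[h2 _].
  rewrite mulrBr mulr1 in h6; lra.
(* Here H gaps would fit in the window of length u, contradicting H >= lambda u + y. *)
have h1 := D H (leqnn _); rewrite sumg in h1.
have h3 := sumx 0%N H (leq0n _); rewrite addn0 in h3.
have h4 : lambda * (arrival (i + H) w - arrival i w) <= lambda * u.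
  apply: ler_wpM2l => //; have : arrival (i + H) w <= t.
    apply: le_trans kt; apply: arrival_mono.
    by rewrite -(subnKC (leq_trans ik ke)) leq_add2l ltnW.
  by lra.
move: h1; rewrite ltr_norml => /andP[_ h1].
rewrite mulrBr mulr1 in ml; lra.
Qed.

End Burst.
End Arrivals.

(** * Servers that never idle *)

Section SortedCounts.
Context (R : realType).
Implicit Types (F : seq R) (x : R).

Definition above x F : nat := count (fun r => x < r) F.

Lemma above_sort x F : above x (sort <=%R F) = above x F.
Proof. by apply/permP; rewrite perm_sort. Qed.

Lemma above_behead_low x F : head 0 F <= x -> above x (behead F) = above x F.
Proof. by case: F => //= r F rx; rewrite ltNge rx. Qed.

Lemma above_head F x : sorted <=%R F -> x < head 0 F -> above x F = size F.
Proof.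
case: F => //= r F; rewrite (path_sortedE le_trans) => /andP[/allP rF _] xr.
by rewrite xr add1n; congr _.+1; apply/eqP; rewrite -all_count; apply/allP => z /rF;
  exact: lt_le_trans.
Qed.

End SortedCounts.

Section AlwaysBusy.
Context (R : realType) (p : nat).
Local Notation n := p.+1.
Variables (T : 'I_n -> nat -> R) (arr : nat -> R).

Definition history := seq ('I_n * bool).
Implicit Types (h : history).

Definition counts h (i : 'I_n) : nat := count (fun d => d.1 == i) h.
Definition assigned h : nat := count snd h.
(** [counts h i] epochs of server [i] have been processed, so [T i (counts h i)] ends its present
    service and the minimum is the server that is free first. *)
Definition next_server h : 'I_n := [arg min_(i < ord0) T i (counts h i)]%O.
Definition next_epoch h : R := T (next_server h) (counts h (next_server h)).
Definition decide h : 'I_n * bool :=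
  (next_server h, arr (assigned h) <= next_epoch h).
(* Histories list the most recent decision first; the boolean tells whether the
   server takes a real job or a dummy one. *)
Fixpoint hist (q : nat) : history :=
  if q is q'.+1 then decide (hist q') :: hist q' else [::].

Fixpoint slot_of h (k : nat) : option ('I_n * nat) :=
  if h is d :: h' then
    if d.2 && (k == assigned h') then Some (d.1, counts h' d.1) else slot_of h' k
  else None.

Definition coupled_services h (Z : 'I_n -> nat -> R) (e : nat -> R) (k : nat) : R :=
  if slot_of h k is Some (j, m) then Z j m else e k.

Lemma histS q : hist q.+1 = decide (hist q) :: hist q. Proof. by []. Qed.

Lemma slot_of_cons d h k : slot_of (d :: h) k =
  if d.2 && (k == assigned h) then Some (d.1, counts h d.1) else slot_of h k.
Proof. by []. Qed.

Lemma assignedS q : assigned (hist q.+1) = ((decide (hist q)).2 + assigned (hist q))%N.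
Proof. by []. Qed.

Lemma size_hist q : size (hist q) = q.
Proof. by elim: q => //= q ->. Qed.

Lemma sum_counts h : (\sum_(i < n) counts h i = size h)%N.
Proof.
elim: h => [|d h IH]; first by rewrite big1.
rewrite /counts /= big_split /= -/(counts h) IH -[RHS]add1n; congr addn.
by rewrite (bigD1 d.1)//= eqxx big1 ?addn0// => i /negbTE; rewrite eq_sym => ->.
Qed.

Lemma next_epoch_le h i : next_epoch h <= T i (counts h i).
Proof.
rewrite /next_epoch /next_server.
by case: Order.TotalTheory.arg_minP => //= j _; apply.
Qed.

Lemma assigned_hist_mono q q' : (q <= q')%N -> (assigned (hist q) <= assigned (hist q'))%N.
Proof.
move=> qq'; rewrite -(subnKC qq'); elim: (q' - q)%N => [|r IH]; first by rewrite addn0.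
by rewrite addnS /=; apply: leq_trans IH _; rewrite leq_addl.
Qed.

Lemma coupled_services_assigned P q Z e : (q < P)%N -> (decide (hist q)).2 ->
  coupled_services (hist P) Z e (assigned (hist q)) =
  Z (next_server (hist q)) (counts (hist q) (next_server (hist q))).
Proof.
move=> qP dq; rewrite /coupled_services.
suff -> : slot_of (hist P) (assigned (hist q)) =
    Some (next_server (hist q), counts (hist q) (next_server (hist q))) by [].
elim: P qP => // P IH; rewrite ltnS leq_eqVlt => /predU1P[eq|qP];
  rewrite histS slot_of_cons.
  by rewrite -eq dq eqxx.
have := assigned_hist_mono qP; rewrite assignedS dq add1n => lt; rewrite (ltn_eqF lt) andbF; exact: IH.
Qed.

Hypothesis T_mono : forall i, {homo T i : m k / (m <= k)%N >-> m <= k}.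
Hypothesis T_ge0 : forall i m, 0 <= T i m.

Lemma next_epochS q : next_epoch (hist q) <= next_epoch (hist q.+1).
Proof.
apply: le_trans (next_epoch_le (hist q) (next_server (hist q.+1))) _.
by apply: T_mono; rewrite /counts /= leq_addl.
Qed.

Lemma processed_le q i m : (m < counts (hist q.+1) i)%N -> T i m <= next_epoch (hist q).
Proof.
elim: q i m => [|q IH] i m.
  by rewrite /counts /= addn0; case: eqP => // <-; case: m.
rewrite [hist q.+2]/= {1}/counts [count _ _]/= -/(counts (hist q.+1) i).
have [<-|_] := eqVneq; last by rewrite add0n => /IH h; apply: le_trans h (next_epochS q).
rewrite add1n ltnS leq_eqVlt => /predU1P[->|/IH h]; first exact: lexx.
by apply: le_trans h (next_epochS q).
Qed.

(** By pigeonhole, after n (M + 1) decisions some server has processed more than M epochs. The bound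
    on [q] does not depend on the path, which allows the coupling to run for a fixed number of
    decisions. *)
Lemma exists_late_step (M : nat) (t : R) : (forall i, t < T i M) ->
  exists2 q, t < next_epoch (hist q) & (forall q', (q' < q)%N -> next_epoch (hist q') <= t)
    /\ (q <= (n * M.+1).+1)%N.
Proof.
move=> TM.
have ex : exists q, (t < next_epoch (hist q)) && (q <= n * M.+1)%N.
  set P := (n * M.+1)%N.
  have [i hi] : exists i, (M < counts (hist P) i)%N.
    apply: contrapT => /forallNP H; have := sum_counts (hist P).
    rewrite size_hist => e; have : (P <= \sum_(i < n) M)%N.
      rewrite -e; apply: leq_sum => i _; rewrite leqNgt; exact/negP.
    by rewrite sum_nat_const card_ord leq_pmul2l// ltnn.
  exists P; rewrite leqnn andbT.
  have P0 : (0 < P)%N by rewrite muln_gt0.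
  rewrite -(prednK P0) in hi *.
  apply: lt_le_trans (TM i) _; apply: le_trans (processed_le hi) (next_epochS _).
case: (ex_minnP ex) => q /andP[hq qP] qmin; exists q => //; split; last exact: leqW.
move=> q' lt; rewrite leNgt; apply/negP => h.
have := qmin q'; rewrite h (leq_trans (ltnW lt) qP) => /(_ erefl).
by rewrite leqNgt lt.
Qed.

Lemma last_idle_epoch (t : R) q : 0 <= t -> 0 < arr 0%N ->
  (forall q', (q' < q)%N -> next_epoch (hist q') <= t) ->
  exists s k1 (c0 : 'I_n -> nat), [/\ 0 <= s <= t, s < arr k1,
    (k1 <= assigned (hist q))%N,
    (forall i m, (m < c0 i)%N -> T i m <= s) /\
      (forall i, (c0 i <= counts (hist q) i)%N) &
    (\sum_(i < n) counts (hist q) i + k1 <= \sum_(i < n) c0 i + assigned (hist q))%N].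
Proof.
move=> t0 a0; elim: q => [|q IH] hq.
  exists 0, 0%N, (fun=> 0%N); split=> //; first by rewrite lexx.
have [|s [k1 [c0 [st sk kq [hc hc'] hs]]]] := IH; first by move=> q' lt; apply: hq; exact: ltnW.
have hS : (\sum_(i < n) counts (hist q.+1) i = (\sum_(i < n) counts (hist q) i).+1)%N.
  by rewrite !sum_counts !size_hist.
case dq : (decide (hist q)).2.
  have aS : assigned (hist q.+1) = (assigned (hist q)).+1.
    by rewrite assignedS dq add1n.
  exists s, k1, c0; split=> //; first by rewrite aS leqW.
    split=> // i; apply: leq_trans (hc' i) _.
    by rewrite /counts /= leq_addl.
  by rewrite hS aS addSn addnS ltnS.
have aS : assigned (hist q.+1) = assigned (hist q).
  by rewrite assignedS dq add0n.
exists (next_epoch (hist q)), (assigned (hist q)), (counts (hist q.+1)); split.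
- by rewrite hq// andbT; exact: T_ge0.
- by rewrite ltNge; move/negbT: dq.
- by rewrite aS.
- by split=> // i m; exact: processed_le.
- by rewrite aS.
Qed.

Section Domination.
Variables (c : initial_condition R n) (a s : nat -> R) (Z : 'I_n -> nat -> R) (P : nat).
Hypothesis residual_T : forall i, tnth (residual c) i = T i 0%N.
Hypothesis arrE : forall k, arrival_time c a k = arr k.
Hypothesis T_step : forall i m, T i m.+1 = T i m + Z i m.
Hypothesis s_assigned : forall q, (q < P)%N -> (decide (hist q)).2 ->
  s (assigned (hist q)) = Z (next_server (hist q)) (counts (hist q) (next_server (hist q))).

Local Notation F k := (server_free_times c a s k).

Lemma size_free k : size (F k) = n.
Proof.
by elim: k => [|k IH] /=; rewrite size_sort ?size_tuple//= size_behead IH.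
Qed.

Lemma sorted_free k : sorted <=%R (F k).
Proof. by case: k => [|k] /=; apply: sort_sorted; exact: le_total. Qed.

Lemma above_freeS x k : above x (F k.+1) =
  ((x < departure_time c a s k)%R + above x (behead (F k)))%N.
Proof. by rewrite [F k.+1]/= above_sort. Qed.

Definition busy_above x q : nat := (\sum_(i < n) (x < T i (counts (hist q) i))%R)%N.

Lemma above_tuple x : above x (residual c) = (\sum_(i < n) (x < T i 0%N)%R)%N.
Proof.
rewrite /above -sum1_count big_tuple big_mkcond /=.
by apply: eq_bigr => i _; rewrite residual_T; case: ifP.
Qed.

Lemma busy_above_others x q j :
  busy_above x q = ((x < T j (counts (hist q) j))%R +
    \sum_(i < n | i != j) (x < T i (counts (hist q) i))%R)%N.
Proof. by rewrite /busy_above (bigD1 j). Qed.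

Lemma others_full x q j : (forall i, x < T i (counts (hist q) i)) ->
  (\sum_(i < n | i != j) (x < T i (counts (hist q) i))%R = p)%N.
Proof.
move=> h; rewrite (eq_bigr (fun=> 1%N)) => [|i _]; last by rewrite h.
by rewrite sum1_card cardC1 card_ord.
Qed.

Lemma head_le_next q : (forall x, (above x (F (assigned (hist q))) <= busy_above x q)%N) ->
  head 0 (F (assigned (hist q))) <= next_epoch (hist q).
Proof.
move=> dom; rewrite leNgt; apply/negP => lt.
have := dom (next_epoch (hist q)); rewrite (above_head (sorted_free _) lt) size_free.
rewrite (busy_above_others _ _ (next_server (hist q))) ltxx add0n => h.
have : (n <= p)%N.
  apply: leq_trans h _; apply: leq_trans (_ : \sum_(i < n | i != next_server (hist q)) 1 <= _)%N.
    by apply: leq_sum => i _; case: (_ < _).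
  by rewrite sum1_card cardC1 card_ord.
by rewrite ltnn.
Qed.

(** The two sets of free times are compared through their counting functions at all levels [x] at
    once. This is the order of sorted vectors, and it spares any matching of the servers of the
    queue with those of the pool. *)
Lemma free_dominated q x : (q <= P)%N ->
  (above x (F (assigned (hist q))) <= busy_above x q)%N.
Proof.
elim: q x => [|q IH] x qP.
  by rewrite [F _]/= above_sort above_tuple.
have {}IH y := IH y (ltnW qP).
set j := next_server (hist q); set k := assigned (hist q).
have cj : counts (hist q.+1) j = (counts (hist q) j).+1.
  by rewrite /counts /= eqxx.
have ci i : i != j -> counts (hist q.+1) i = counts (hist q) i.
  by rewrite /counts /= eq_sym => /negbTE ->.
have rest : (\sum_(i < n | i != j) (x < T i (counts (hist q.+1) i))%R =
    \sum_(i < n | i != j) (x < T i (counts (hist q) i))%R)%N.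
  by apply: eq_bigr => i ij; rewrite ci.
rewrite (busy_above_others _ _ j) rest cj.
case dq : (decide (hist q)).2; last first.
  have -> : assigned (hist q.+1) = k.
    by rewrite assignedS dq add0n.
  apply: leq_trans (IH x) _; rewrite (busy_above_others _ _ j) leq_add2r.
  case: ltP => // h; rewrite (lt_le_trans h)//; exact: T_mono.
have -> : assigned (hist q.+1) = k.+1.
  by rewrite assignedS dq add1n.
have hd : head 0 (F k) <= next_epoch (hist q) := head_le_next IH.
rewrite above_freeS; apply: leq_add.
  (* The job has arrived by the epoch and, by [head_le_next], a server of the queue is free by then;
     with the same service time it departs no later than the pool server. *)
  case: ltP => // h; rewrite (lt_le_trans h)//.
  rewrite /departure_time /service_start arrE T_step s_assigned//.
  by rewrite lerD2r ge_max hd andbT.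
(* Below the next epoch all the other pool servers are still busy, so the count n - 1 cannot be
   exceeded; above it, the discarded head was not counted. *)
have [xg|gx] := ltP x (next_epoch (hist q)).
  rewrite others_full; last by move=> i; exact: lt_le_trans xg (next_epoch_le _ _).
  by apply: leq_trans (count_size _ _) _; rewrite size_behead size_free.
rewrite above_behead_low; last exact: le_trans hd gx.
by apply: leq_trans (IH x) _; rewrite (busy_above_others _ _ j) ltNge gx.
Qed.

(** Every head discarded while assigning jobs is at most the epoch, hence at most [t]; so exactly
    the jobs still in service at [t] remain visible in the free times. *)
Lemma in_service_count q (t : R) : (q <= P)%N ->
  (forall q', (q' < q)%N -> next_epoch (hist q') <= t) ->
  (above t (residual c) + \sum_(k < assigned (hist q)) (t < departure_time c a s k)%R)%N =
  above t (F (assigned (hist q))).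
Proof.
elim: q => [|q IH] qP hq.
  by rewrite [F _]/= above_sort big_ord0 addn0.
have {}IH := IH (ltnW qP) (fun q' lt => hq q' (ltnW lt)).
case dq : (decide (hist q)).2; last first.
  have -> : assigned (hist q.+1) = assigned (hist q).
    by rewrite assignedS dq add0n.
  exact: IH.
have -> : assigned (hist q.+1) = (assigned (hist q)).+1.
  by rewrite assignedS dq add1n.
rewrite big_ord_recr /= addnA IH above_freeS addnC; congr addn.
rewrite above_behead_low//; apply: le_trans (hq q (ltnSn q)).
by apply: head_le_next => x; apply: free_dominated; exact: ltnW.
Qed.

(** Assigned jobs present at [t] occupy at most the n servers, the next Y jobs count at most Y, and
    the later ones have not arrived. *)
Lemma jobs_count_le q (t : R) Y K : (q <= P)%N ->
  (forall q', (q' < q)%N -> next_epoch (hist q') <= t) ->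
  {homo arr : k l / (k <= l)%N >-> k <= l} ->
  t < arr (assigned (hist q) + Y)%N ->
  (above t (residual c) +
   \sum_(k < K) (arrival_time c a k <= t < departure_time c a s k)%R <= n + Y)%N.
Proof.
move=> qP hq arr_mono ht; set k0 := assigned (hist q) in ht *.
pose b k : nat := (arrival_time c a k <= t < departure_time c a s k)%R.
have -> : (\sum_(k < K) (arrival_time c a k <= t < departure_time c a s k)%R =
    \sum_(k < K) b k)%N by [].
apply: leq_trans (_ : above t (residual c) + \sum_(k < k0 + Y) b k <= _)%N.
  rewrite leq_add2l; apply: leq_trans (_ : \sum_(k < (k0 + Y) + K) b k <= _)%N.
    by rewrite addnC big_split_ord /= leq_addr.
  rewrite big_split_ord /= [X in (_ + X)%N]big1 ?addn0// => k _.
  rewrite /b arrE; have := lt_le_trans ht (arr_mono _ _ (leq_addr k (k0 + Y)%N)).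
  by rewrite ltNge => /negbTE ->.
rewrite big_split_ord /= addnA; apply: leq_add.
  apply: leq_trans (_ : above t (residual c) +
     \sum_(k < k0) (t < departure_time c a s k)%R <= _)%N.
    rewrite leq_add2l; apply: leq_sum => k _; rewrite /b.
    by case: (_ <= _)%R => //=; exact: leq0n.
  rewrite in_service_count//; apply: leq_trans (count_size _ _) _.
  by rewrite size_free.
apply: leq_trans (_ : \sum_(k < Y) 1 <= _)%N; last by rewrite sum1_card card_ord.
by apply: leq_sum => k _; exact: leq_b1.
Qed.

Lemma queue_overload M M' (t : R) Y : P = (n * M.+1).+1 -> 0 <= t -> 0 < arr 0%N ->
  (forall i, t < T i M) -> {homo arr : k l / (k <= l)%N >-> k <= l} ->
  exists s0 k1 k0, [/\ 0 <= s0 <= t, s0 < arr k1, (k1 <= k0)%N,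
    (\sum_(i < n) \sum_(m < M') (s0 < T i m <= t)%R + k1 <= k0)%N &
    t < arr (k0 + Y)%N -> forall K, (above t (residual c) +
      \sum_(k < K) (arrival_time c a k <= t < departure_time c a s k)%R <= n + Y)%N].
Proof.
move=> eP t0 a0 TM arr_mono.
have [q hq [hmin]] := exists_late_step TM; rewrite -eP => qP.
have [s0 [k1 [c0 [st sk k1k [hc hc'] hs]]]] := last_idle_epoch t0 a0 hmin.
exists s0, k1, (assigned (hist q)); split=> //; last first.
  by move=> ht K; exact: (jobs_count_le K qP hmin arr_mono ht).
(* An epoch of server i in (s0, t] is neither among the c0 i processed by s0 nor still ahead,
   because the pending epoch of each server is later than t. *)
have e i : (c0 i + \sum_(m < M') (s0 < T i m <= t)%R <= counts (hist q) i)%N.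
  rewrite -leq_subRL//.
  apply: leq_trans (_ : \sum_(m < M' | (c0 i <= m < counts (hist q) i)%N) 1 <= _)%N.
    rewrite [leqRHS]big_mkcond /=; apply: leq_sum => m _.
    case: (ltP s0) => //= h1; case: leP => //= h2.
    have -> : (c0 i <= m)%N.
      by rewrite leqNgt; apply/negP => /hc; rewrite leNgt h1.
    suff -> : (m < counts (hist q) i)%N by [].
    rewrite ltnNge; apply/negP => /(T_mono i) h3.
    have := lt_le_trans hq (next_epoch_le (hist q) i).
    by rewrite ltNge (le_trans h3 h2).
  rewrite -(big_mkord (fun m => c0 i <= m < counts (hist q) i)%N (fun=> 1%N)) -big_filter.
  rewrite sum1_size -[leqRHS](size_iota (c0 i)).
  apply: uniq_leq_size; first by rewrite filter_uniq ?iota_uniq.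
  by move=> m; rewrite mem_filter mem_index_iota mem_iota => /andP[/andP[h1 h2] _];
    rewrite h1 subnKC// (leq_trans h1)// ltnW.
have e' : (\sum_(i < n) (c0 i + \sum_(m < M') (s0 < T i m <= t)%R) <=
    \sum_(i < n) counts (hist q) i)%N by apply: leq_sum => i _; exact: e.
rewrite big_split /= in e'.
have := leq_trans (leq_add e' (leqnn k1)) hs.
by rewrite -addnA leq_add2l.
Qed.

End Domination.
End AlwaysBusy.

(** * Coupling job services with the services of the pool *)

Definition coord : eqType := ((nat + nat) + (nat * nat))%type.

Definition arrival_coord (k : nat) : coord := inl (inl k).
Definition job_coord (k : nat) : coord := inl (inr k).
(* [server_coord i 0] is the residual service of server [i]. *)
Definition server_coord (i m : nat) : coord := inr (i, m).

Definition primitive_coord : pred coord :=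
  fun x => if x is inr (_, _.+1) then false else true.

Lemma measurable_finite_data d (T : measurableType d) (J : finType) (S : eqType)
    (b : J -> T -> bool) (Phi : {ffun J -> bool} -> S) (s : S) :
  (forall j, measurable_fun setT (b j)) ->
  measurable_fun setT (fun w => Phi [ffun j => b j w] == s).
Proof.
move=> mb.
rewrite (_ : (fun w => _) = (fun w => has (fun f : {ffun J -> bool} =>
    (Phi f == s) && all (fun j => b j w == f j) (enum J)) (enum {ffun J -> bool}))).
  apply: measurable_has => f; case: (Phi f == s) => /=; last exact: measurable_cst.
  elim: (enum J) => [|j r IH]; first exact: measurable_cst.
  apply: (measurable_and (f := fun w => b j w == f j) _ IH).
  case: (f j); last by under eq_fun do rewrite eqbF_neg; exact: measurable_neg.
  by under eq_fun do rewrite eqb_id; exact: mb.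
apply/funext => w; apply/idP/hasP => [h|[f _ /andP[h /allP hf]]].
  exists [ffun j => b j w]; first by rewrite mem_enum.
  by rewrite h; apply/allP => j _; rewrite ffunE eqxx.
suff -> : [ffun j => b j w] = f by [].
by apply/ffunP => j; rewrite ffunE; apply/eqP/hf; rewrite mem_enum.
Qed.

Section Coupling.
Context (R : realType) (p : nat) (L : coord -> probability R R).
Local Notation W := {paths coord -> R}.
Local Notation n := p.+1.
Context (mu : probability W R) (mu_law : product_law L predT mu).
Context (F : probability R R).
Hypothesis job_law : forall k, L (job_coord k) = F.
Hypothesis server_law : forall i m, L (server_coord i m.+1) = F.

Definition server_epoch (w : W) (i : 'I_n) (m : nat) : R := epoch (server_coord i) m w.
Definition arrival_epoch (w : W) (k : nat) : R := arrival arrival_coord k w.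
Definition path_hist (q : nat) (w : W) : history p :=
  hist (server_epoch w) (arrival_epoch w) q.

(** Arrivals and pool are left unchanged, so the decisions read from [w] are also those of the
    coupled path. The inner default 0 is never reached, since [k'] is an [inr]. *)
Definition coupled (q : nat) (w : W) : W := fun x =>
  if x is inl (inr _ as k') then
    (if k' is inr k then coupled_services (path_hist q w)
       (fun i m => w (server_coord i m.+1)) (fun k => w (job_coord k)) k else 0)
  else w x.

Lemma coupled_job q w k : coupled q w (job_coord k) =
  coupled_services (path_hist q w)
    (fun i m => w (server_coord i m.+1)) (fun k => w (job_coord k)) k.
Proof. by []. Qed.

(* The part of a path that determines the decision taken after history [h]. *)
Definition agree (h : history p) (w w' : W) :=
  (forall k, w (arrival_coord k) = w' (arrival_coord k)) /\
  (forall (i : 'I_n) m, (m <= counts h i)%N ->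
     w (server_coord i m) = w' (server_coord i m)).

Lemma agree_cons d h w w' : agree (d :: h) w w' -> agree h w w'.
Proof.
move=> [ha hs]; split=> // i m mh; apply: hs; apply: leq_trans mh _.
by rewrite /counts /= leq_addl.
Qed.

Lemma agree_epoch h w w' i m : agree h w w' -> (m <= counts h i)%N ->
  server_epoch w i m = server_epoch w' i m.
Proof.
move=> [_ hs] mh; rewrite /server_epoch /epoch /delay; congr (_ + _).
  by rewrite /pos hs.
apply: eq_bigr => l _; rewrite /service /pos add0n hs//.
exact: leq_trans (ltn_ord l) mh.
Qed.

Lemma agree_decide h w w' : agree h w w' ->
  decide (server_epoch w) (arrival_epoch w) h = decide (server_epoch w') (arrival_epoch w') h.
Proof.
move=> ag.
have eT i : server_epoch w i (counts h i) = server_epoch w' i (counts h i).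
  exact: agree_epoch ag (leqnn _).
have ej : next_server (server_epoch w) h = next_server (server_epoch w') h.
  rewrite /next_server /Order.arg_min /extremum; congr odflt; apply: eq_pick => i /=.
  by apply: eq_forallb => j; rewrite /= !eT.
rewrite /decide /next_epoch ej eT; congr (_, _ <= _).
rewrite /arrival_epoch /arrival; congr (_ + _); apply: eq_bigr => k _.
by case: ag => ha _; rewrite /pos ha.
Qed.

(** The history is adapted: it is determined by the coordinates that it has itself revealed. *)
Lemma agree_hist q w w' : agree (path_hist q w) w w' -> path_hist q w' = path_hist q w.
Proof.
rewrite /path_hist; elim: q => // q IH ag; rewrite histS in ag *.
have ag' := agree_cons ag; rewrite histS IH//.
by rewrite (agree_decide ag').
Qed.

Lemma measurable_decide (h : history p) (d : 'I_n * bool) :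
  measurable_fun setT (fun w => decide (server_epoch w) (arrival_epoch w) h == d).
Proof.
pose b (j : 'I_n * 'I_n + 'I_n) w := match j with
  | inl (i, i') => server_epoch w i (counts h i) <= server_epoch w i' (counts h i')
  | inr i => arrival_epoch w (assigned h) <= server_epoch w i (counts h i) end.
pose Phi (f : {ffun 'I_n * 'I_n + 'I_n -> bool}) : 'I_n * bool :=
  let j := odflt ord0 [pick i | [forall i', f (inl (i, i'))]] in (j, f (inr j)).
have e w : decide (server_epoch w) (arrival_epoch w) h = Phi [ffun j => b j w].
  rewrite /decide /Phi ffunE /b /next_epoch.
  have -> : next_server (server_epoch w) h =
      odflt ord0 [pick i | [forall i', [ffun j => b j w] (inl (i, i'))]].
    rewrite /next_server /Order.arg_min /extremum; congr odflt; apply: eq_pick => i /=.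
    by apply: eq_forallb => j; rewrite /= ffunE.
  by [].
rewrite (_ : (fun w => _) = (fun w : W => Phi [ffun j => b j w] == d)); last first.
  by apply/funext => w; rewrite e.
apply: measurable_finite_data => -[[i i']|i]; apply: measurable_fun_ler;
  first [exact: measurable_epoch | exact: measurable_arrival].
Qed.

Lemma measurable_path_hist q (h : history p) :
  measurable_fun setT (fun w => path_hist q w == h).
Proof.
elim: q h => [|q IH] [|d h].
- exact: measurable_cst.
- exact: measurable_cst.
- by rewrite (_ : (fun w => _) = (fun=> false)) //; exact: measurable_cst.
rewrite (_ : (fun w => _) = (fun w => (path_hist q w == h) &&
    (decide (server_epoch w) (arrival_epoch w) h == d))).
  by apply: measurable_and; [exact: IH|exact: measurable_decide].
apply/funext => w; rewrite {1}/path_hist histS eqseq_cons andbC -/(path_hist q w).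
by case: eqP => //= ->.
Qed.

Lemma size_path_hist q w : size (path_hist q w) = q.
Proof. exact: size_hist. Qed.

(** Histories of a given length are finitely many, so a quantity depending on the history can be
    treated one history at a time. *)
Lemma sum_path_hist q w (V : zmodType) (f : history p -> V) :
  \sum_(h : q.-tuple ('I_n * bool)) (if path_hist q w == h then f h else 0) =
  f (path_hist q w).
Proof.
have sq : size (path_hist q w) == q by rewrite size_path_hist.
rewrite (bigD1 (Tuple sq))//= eqxx big1 ?addr0// => h hn.
by case: eqP => // e; case/eqP: hn; apply/val_inj; rewrite /= -e.
Qed.

Lemma measurable_coupled q x : measurable_fun setT (fun w => coupled q w x).
Proof.
case: x => [[k|k]|[i m]]; try exact: measurable_coordinate.
rewrite (_ : (fun w => _) = (fun w => \sum_(h : q.-tuple ('I_n * bool))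
   (path_hist q w == h)%:R * (w (if slot_of h k is Some (i, m)
     then server_coord i m.+1 else job_coord k)))).
  apply: measurable_sum => h; apply: measurable_funM; last exact: measurable_coordinate.
  by apply: measurable_indicator; exact: measurable_path_hist.
apply/funext => w; rewrite -[LHS]/(coupled q w (job_coord k)) coupled_job.
rewrite -(sum_path_hist q w (fun h => coupled_services h
    (fun i m => w (server_coord i m.+1)) (fun k => w (job_coord k)) k)).
apply: eq_bigr => h _; case: eqP => _; last by rewrite mul0r.
by rewrite mul1r /coupled_services; case: slot_of => [[i m]|].
Qed.

Lemma slot_of_old (h : history p) k i m : slot_of h k = Some (i, m) ->
  (m < counts h i)%N /\ (k < assigned h)%N.
Proof.
elim: h => // d h IH; rewrite slot_of_cons; case: ifP => [/andP[d2 /eqP ->] [<- <-]|_ /IH[h1 h2]].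
  by rewrite /counts /assigned /= eqxx d2 !add1n !ltnS !leqnn.
split; first by apply: leq_trans h1 _; rewrite /counts /= leq_addl.
by apply: leq_trans h2 _; rewrite /assigned /= leq_addl.
Qed.

(* The decision after a history depends only on coordinates revealed so far, so
   exchanging the job it assigns with the next, still unrevealed, service of the
   chosen server preserves the law. *)
Definition transfer (h : history p) (w : W) : W :=
  if h is d :: h' then
    if d.2 then swap (job_coord (assigned h')) (server_coord d.1 (counts h' d.1).+1) w
    else w
  else w.

Lemma transfer_arrival h w k : transfer h w (arrival_coord k) = w (arrival_coord k).
Proof. by case: h => //= -[j []] h. Qed.

Lemma transfer_server h w (i : 'I_n) m : (m <= counts (behead h) i)%N ->
  transfer h w (server_coord i m) = w (server_coord i m).
Proof.
case: h => //= -[j []] h mh //; rewrite /swap /=.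
case: eqP => // -[ei em]; move: mh; rewrite em.
by rewrite (val_inj ei : i = j) ltnn.
Qed.

Lemma transferK h : involutive (transfer h).
Proof. by case: h => //= -[j []] h w //; exact: swapK. Qed.

(** Neither exchanged coordinate has been read: decisions never look at job services, and the
    service of the chosen server follows its last revealed epoch. *)
Lemma path_hist_transfer q h w : path_hist q.+1 w = h -> path_hist q.+1 (transfer h w) = h.
Proof.
move=> e; have := e; rewrite {1}/path_hist histS -/(path_hist q w) => e'.
have ag : agree (path_hist q w) w (transfer h w).
  split=> [k|i m mh]; first by rewrite transfer_arrival.
  by rewrite transfer_server// -e'.
rewrite /path_hist histS -/(path_hist q _) (agree_hist ag) -(agree_decide ag).
exact: e'.
Qed.

(** Only on primitive coordinates: the exchange also leaves the old service of the job in the slot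
    of the server. *)
Lemma coupledS q w x : primitive_coord x ->
  coupled q.+1 w x = coupled q (transfer (path_hist q.+1 w) w) x.
Proof.
set h := path_hist q.+1 w.
have eh : h = decide (server_epoch w) (arrival_epoch w) (path_hist q w) :: path_hist q w by [].
have ehq : path_hist q (transfer h w) = path_hist q w.
  apply: agree_hist; split=> [k|i m mh]; first by rewrite transfer_arrival.
  by rewrite transfer_server// eh.
case: x => [[k|k]|[i [|m]]] // _.
- by rewrite [RHS]transfer_arrival.
- rewrite -[inl (inr k)]/(job_coord k) !coupled_job ehq /coupled_services -/h {1}eh.
  rewrite slot_of_cons; set d := decide _ _ _ in eh *; set hq := path_hist q w in eh ehq *.
  case sl : (slot_of hq k) => [[i m]|].
    have [mi kh] := slot_of_old sl.
    by rewrite (ltn_eqF kh) andbF transfer_server// eh.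
  rewrite eh; case: d {eh} => j [] //=; rewrite /swap /=.
  have -> : (job_coord k == job_coord (assigned hq)) = (k == assigned hq) by [].
  by case: eqP.
rewrite -[LHS]/(w (server_coord i 0)) -[RHS]/(transfer h w (server_coord i 0)) eh.
by case: (decide _ _ _) => j [] //=; rewrite /swap /=; case: eqP.
Qed.

(** One decision at a time: for each history h the exchange [transfer h] is an involution that
    preserves the law and the event that the history is h. *)
Lemma Ex_coupled q (f : W -> R) : bounded_measurable f -> depends_on primitive_coord f ->
  Ex mu (fun w => f (coupled q w)) = Ex mu f.
Proof.
move=> bf df.
have bc r : bounded_measurable (fun w => f (coupled r w)).
  case: bf => mf [C fC]; split; last by exists C.
  apply: measurableT_comp => //; apply: measurable_to_paths => x.
  exact: measurable_coupled.
elim: q => [|q IH].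
  by apply: eq_Ex => w; apply: df => -[[k|k]|[i m]].
rewrite -[RHS]IH.
have bh (h : history p) : bounded_measurable (fun w => (path_hist q.+1 w == h)%:R : R).
  by apply: bm_indicator; exact: measurable_path_hist.
have bg (h : history p) : bounded_measurable
    (fun w => f (coupled q w) * (path_hist q.+1 w == h)%:R) by exact: bmM.
(* Only the term of the actual history survives, because [transfer h] maps paths with history h onto
   such paths. *)
transitivity (Ex mu (fun w => \sum_(h : q.+1.-tuple ('I_n * bool))
    f (coupled q (transfer h w)) * (path_hist q.+1 (transfer h w) == h)%:R)).
  apply: eq_Ex => w.
  rewrite -[LHS](sum_path_hist q.+1 w (fun h => f (coupled q.+1 w)) : _ = _).
  apply: eq_bigr => h _; case: eqP => [e|ne].
    rewrite (path_hist_transfer e) eqxx mulr1; apply: df => x px.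
    by rewrite coupledS// e.
  case: eqP => [e|_]; last by rewrite mulr0.
  by case: ne; have := path_hist_transfer e; rewrite transferK.
have tr (h : history p) : Ex mu (fun w => f (coupled q (transfer h w)) *
    (path_hist q.+1 (transfer h w) == h)%:R) =
    Ex mu (fun w => f (coupled q w) * (path_hist q.+1 w == h)%:R).
  case: h => [|[j []] h]; [exact: erefl| |exact: erefl].
  apply: (Ex_swap mu_law (f := fun w => f (coupled q w) *
    (path_hist q.+1 w == (j, true) :: h)%:R)).
    by rewrite job_law server_law.
  exact: bg.
have bt (h : history p) : bounded_measurable (fun w => f (coupled q (transfer h w)) *
    (path_hist q.+1 (transfer h w) == h)%:R).
  have [mg [C gC]] := bg h; split; last by exists C => w; exact: gC.
  apply: (measurableT_comp (f := fun w => f (coupled q w) * (path_hist q.+1 w == h)%:R)) => //.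
  apply: measurable_to_paths => x; rewrite /transfer.
  case: h {mg gC} => [|[j []] h]; try exact: measurable_coordinate.
  exact: measurable_swap.
rewrite Ex_sum => [|h _]; last exact: bt.
under eq_bigr do rewrite tr.
rewrite -Ex_sum => [|h _]; last exact: bg.
apply: eq_Ex => w; rewrite -[RHS](sum_path_hist q.+1 w (fun h => f (coupled q w)) : _ = _).
by apply: eq_bigr => h _; case: eqP => _; rewrite ?mulr1 ?mulr0.
Qed.

End Coupling.

(** * Measurability of the number of jobs *)

Section Jobs.
Context (R : realType).

(** Replaces the possibly infinite count by its partial sums, on which domination and measurability
    are finite statements. *)
Lemma jobs_in_system_le n (c : initial_condition R n) (a s : nat -> R) (t z : R) :
  (jobs_in_system c a s t <= z%:E)%E <->
  (forall K, (above t (residual c) + \sum_(k < K)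
     (arrival_time c a k <= t < departure_time c a s k)%R)%N%:R <= z).
Proof.
set A := [set k | (arrival_time c a k <= t < departure_time c a s k)%R].
have dE k : (\d_k A : \bar R) = ((arrival_time c a k <= t < departure_time c a s k)%R%:R)%:E.
  by rewrite diracE mem_setE.
have part K : (\sum_(0 <= k < K) \d_k A)%E =
   ((\sum_(k < K) (arrival_time c a k <= t < departure_time c a s k)%R)%N%:R : R)%:E.
  by rewrite big_mkord natr_sum -sumEFin; apply: eq_bigr => k _; rewrite dE.
have -> : jobs_in_system c a s t =
    ((above t (residual c))%:R%:E + \sum_(0 <= k <oo) \d_k A)%E.
  by rewrite /jobs_in_system -counting_dirac.
split=> [h K|h].
  rewrite -lee_fin natrD EFinD -part; apply: le_trans h; apply: leeD2l.
  by apply: nneseries_lim_ge => k _ _; rewrite dE lee_fin.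
rewrite -leeBrDl// -EFinB; apply: lime_le.
  by apply: is_cvg_nneseries => k _ _; rewrite dE lee_fin.
by apply: nearW => K; rewrite part lee_fin lerBrDl -natrD.
Qed.

Context d (Om : measurableType d).

Lemma measurable_from_gt (f : Om -> R) :
  (forall x, measurable_fun setT (fun w => x < f w)) -> measurable_fun setT f.
Proof.
move=> h; apply: (measurability _ (RGenOInfty.measurableE R)).
move=> _ [_ [x ->] <-]; rewrite setTI.
have := h x measurableT [set true] I; rewrite setTI.
congr (measurable _); apply/seteqP; split=> w /=; rewrite in_itv/= andbT; first by move=> ->.
by [].
Qed.

End Jobs.

Section QueueMeasurability.
Context (R : realType) (p : nat).
Local Notation n := p.+1.

Lemma start_residual_ge0 (r : 'I_n -> R) i : 0 <= tnth [tuple Num.max (r i) 0 | i < n] i.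
Proof. by rewrite tnth_mktuple le_max lexx orbT. Qed.

Definition start_with (r : 'I_n -> R) : initial_condition R n :=
  @InitialCondition R n [tuple Num.max (r i) 0 | i < n] 0 1
    (start_residual_ge0 r) (fun h => False_ind _ (notF h)) ler01.

Section RandomQueue.
Context d (Om : measurableType d).
Variables (r : 'I_n -> Om -> R) (a s : nat -> Om -> R).
Hypotheses (mr : forall i, measurable_fun setT (r i)).
Hypotheses (ma : forall k, measurable_fun setT (a k)).
Hypotheses (ms : forall k, measurable_fun setT (s k)).

Local Notation start w := (start_with (r^~ w)).
Local Notation F k w := (server_free_times (start w) (a^~ w) (s^~ w) k).

(** The sorted list is accessed through counts only: its head exceeds x exactly when all n entries
    do. *)
Lemma measurable_head_free k :
  (forall y : Om -> R, measurable_fun setT y ->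
    measurable_fun setT (fun w => (above (y w) (F k w))%:R : R)) ->
  measurable_fun setT (fun w => head 0 (F k w)).
Proof.
move=> h; apply: measurable_from_gt => x.
rewrite (_ : (fun w => _) = (fun w => n%:R <= (above x (F k w))%:R :> R)).
  by apply: measurable_fun_ler => //; apply: h; exact: measurable_cst.
apply/funext => w; rewrite ler_nat; apply/idP/idP => [xh|].
  by rewrite above_head ?size_free// sorted_free.
rewrite ltNge; apply: contraL => hx; rewrite -ltnNge.
rewrite -above_behead_low//; apply: leq_ltn_trans (count_size _ _) _.
by rewrite size_behead size_free.
Qed.

Lemma measurable_arrival_time k :
  measurable_fun setT (fun w => arrival_time (start w) (a^~ w) k).
Proof.
rewrite (_ : (fun w => _) = (fun w => 1 + \sum_(i < k) a i w)).
  by apply: measurable_funD => //; exact: measurable_sum.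
by apply/funext => w; rewrite /arrival_time /= subn0.
Qed.

Lemma measurable_departure k :
  measurable_fun setT (fun w => head 0 (F k w)) ->
  measurable_fun setT (fun w => departure_time (start w) (a^~ w) (s^~ w) k).
Proof.
move=> mh; apply: measurable_funD; last exact: ms.
by apply: measurable_maxr => //; exact: measurable_arrival_time.
Qed.

Lemma measurable_above_free k (y : Om -> R) : measurable_fun setT y ->
  measurable_fun setT (fun w => (above (y w) (F k w))%:R : R).
Proof.
elim: k y => [|k IH] y my.
  rewrite (_ : (fun w => _) =
      (fun w => \sum_(i < n) (y w < Num.max (r i w) 0)%R%:R)).
    apply: measurable_sum => i; apply: measurable_indicator; apply: measurable_fun_ltr => //.
    exact: measurable_maxr.
  apply/funext => w; rewrite -[F 0 w]/(sort <=%R (residual (start w))).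
  rewrite above_sort -natr_sum; congr (_%:R).
  rewrite /above -sum1_count big_tuple big_mkcond /=.
  by apply: eq_bigr => i _; rewrite tnth_mktuple; case: ifP.
have mh := measurable_head_free IH.
(* Discarding the head leaves p entries above y if the head was above y, and otherwise does not
   change the count. *)
rewrite (_ : (fun w => _) = (fun w =>
    (y w < departure_time (start w) (a^~ w) (s^~ w) k)%R%:R +
    (if y w < head 0 (F k w) then p%:R else (above (y w) (F k w))%:R))).
  apply: measurable_funD.
    apply: measurable_indicator; apply: measurable_fun_ltr => //.
    exact: measurable_departure.
  apply: measurable_fun_ifT; [exact: measurable_fun_ltr|exact: measurable_cst|exact: IH].
apply/funext => w; rewrite above_freeS natrD; congr (_ + _).
case: ltP => h; last by rewrite above_behead_low.
congr (_%:R); have := above_head (sorted_free _ _ _ _) h; rewrite size_free.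
have := size_free (start w) (a^~ w) (s^~ w) k.
case: (F k w) h => //= x G rh sz; rewrite rh add1n => -[->//].
Qed.

Lemma measurable_jobs_in_system_le t z :
  measurable_fun setT (fun w => `[< (jobs_in_system (start w) (a^~ w) (s^~ w) t <= z%:E)%E >]).
Proof.
pose f K w : R := (above t (residual (start w)))%:R +
  \sum_(k < K) (arrival_time (start w) (a^~ w) k <= t <
     departure_time (start w) (a^~ w) (s^~ w) k)%R%:R.
have mf K : measurable_fun setT (fun w => f K w <= z).
  apply: measurable_fun_ler => //; apply: measurable_funD.
    rewrite (_ : (fun w => _) = (fun w => (above t (F 0 w))%:R : R)).
      exact: (measurable_above_free 0 (measurable_cst t)).
    by apply/funext => w; rewrite [F 0 w]/= above_sort.
  apply: measurable_sum => k; apply: measurable_indicator; apply: measurable_and.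
    by apply: measurable_fun_ler => //; exact: measurable_arrival_time.
  apply: measurable_fun_ltr => //; apply: measurable_departure.
  by apply: measurable_head_free => y my; exact: measurable_above_free.
move=> _; apply: (measurable_fun_bool true) => //; rewrite setTI.
rewrite (_ : _ @^-1` _ = \bigcap_K [set w | f K w <= z]).
  apply: bigcap_measurable => // K _.
  by have := mf K measurableT [set true] I; rewrite setTI.
apply/seteqP; split=> w /=.
  by move=> /asboolP/jobs_in_system_le h K _; have := h K; rewrite natrD natr_sum.
move=> h; apply/asboolP/jobs_in_system_le => K.
by rewrite natrD natr_sum; exact: h.
Qed.

End RandomQueue.

Local Notation W := {paths coord -> R}.

Definition start (w : W) : initial_condition R n :=
  start_with (fun i => w (server_coord i 0)).
Definition arrivals (w : W) (k : nat) : R := pos w (arrival_coord k).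
Definition jobs (w : W) (k : nat) : R := pos w (job_coord k).

Lemma arrival_timeE (w w' : W) k :
  arrival_time (start w') (arrivals w) k = arrival arrival_coord k w.
Proof. by rewrite /arrival_time /= subn0. Qed.

Definition jobs_le (t z : R) (w : W) : bool :=
  `[< (jobs_in_system (start w) (arrivals w) (jobs w) t <= z%:E)%E >].

Lemma measurable_jobs_le t z : measurable_fun setT (jobs_le t z).
Proof.
have mr (i : 'I_n) : measurable_fun setT (fun w : W => w (server_coord i 0)).
  exact: measurable_coordinate.
have ma k : measurable_fun setT (fun w : W => arrivals w k) by exact: measurable_pos.
have ms k : measurable_fun setT (fun w : W => jobs w k) by exact: measurable_pos.
exact: (measurable_jobs_in_system_le mr ma ms t z).
Qed.

Lemma depends_on_jobs_le t z : depends_on primitive_coord (jobs_le t z).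
Proof.
move=> w w' e; rewrite /jobs_le.
have -> : start w = start w'.
  by rewrite /start; congr start_with; apply/funext => i; exact: e.
have -> : arrivals w = arrivals w' by apply/funext => k; rewrite /arrivals /pos e.
by have -> : jobs w = jobs w' by apply/funext => k; rewrite /jobs /pos e.
Qed.

Lemma coupled_queue_overload (w : W) M M' (t : R) Y : 0 <= t ->
  (forall i : 'I_n, t < epoch (server_coord i) M w) ->
  exists s k1 k0, [/\ 0 <= s <= t, s < arrival arrival_coord k1 w, (k1 <= k0)%N,
    pool_completions server_coord n s (t - s) M' w + k1%:R <= k0%:R :> R &
    t < arrival arrival_coord (k0 + Y)%N w ->
      jobs_le t (n + Y)%:R (coupled p (n * M.+1).+1 w)].
Proof.
move=> t0 TM; set P := (n * M.+1).+1; set v := coupled p P w.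
have sE : start v = start w by [].
have aE : arrivals v = arrivals w by [].
have jE : jobs v = coupled_services (path_hist p P w)
    (fun i m => service (server_coord i) m w) (jobs w).
  apply/funext => k; rewrite /jobs /pos /v coupled_job /coupled_services.
  by case: slot_of => [[i m]|].
have T_mono (i : 'I_n) : {homo server_epoch w i : m k / (m <= k)%N >-> m <= k}.
  exact: epoch_mono.
have T_ge0 i m : 0 <= server_epoch (p := p) w i m by exact: epoch_ge0.
have res i : tnth (residual (start v)) i = server_epoch w i 0.
  by rewrite sE tnth_mktuple /server_epoch /epoch delay0 addr0.
have arrE k : arrival_time (start v) (arrivals v) k = arrival_epoch w k.
  by rewrite aE arrival_timeE.
have T_step i m : server_epoch (p := p) w i m.+1 =
    server_epoch w i m + service (server_coord i) m w.
  by rewrite /server_epoch /epoch delayS addrA add0n.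
have sa q : (q < P)%N -> (decide (server_epoch w) (arrival_epoch w) (path_hist p q w)).2 ->
    jobs v (assigned (path_hist p q w)) =
    service (server_coord (next_server (server_epoch w) (path_hist p q w)))
      (counts (path_hist p q w) (next_server (server_epoch w) (path_hist p q w))) w.
  by move=> qP dq; rewrite jE; exact: coupled_services_assigned.
have a0 : 0 < arrival_epoch w 0 by rewrite /arrival_epoch /arrival big_ord0 addr0.
have am : {homo arrival_epoch w : k l / (k <= l)%N >-> k <= l} by exact: arrival_mono.
have [s [k1 [k0 [st sk kk hs hj]]]] := queue_overload T_mono T_ge0 res arrE T_step sa
  M' Y erefl t0 a0 TM am.
exists s, k1, k0; split=> //.
  apply: le_trans (_ : ((\sum_(i < n) \sum_(m < M')
      (s < server_epoch w i m <= t)%R + k1)%N%:R : R) <= _); last by rewrite ler_nat.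
  rewrite natrD lerD2r natr_sum; apply: ler_sum => i _; rewrite natr_sum.
  by apply: ler_sum => m _; rewrite /in_block subrKC.
move=> ht; apply/asboolP/jobs_in_system_le => K; rewrite ler_nat.
exact: hj.
Qed.

End QueueMeasurability.

(** * Moments and the excess law *)

Section Moments.
Context d (T : measurableType d) (R : realType) (P : probability T R).

Lemma integral_bounded (f : T -> R) : bounded_measurable f ->
  (\int[P]_w (f w)%:E)%E = (Ex P f)%:E.
Proof.
move=> bf; rewrite /Ex /Rintegral fineK//.
exact: integrable_fin_num (bm_integrable P bf).
Qed.

Lemma integral_le_moment (f g : T -> R) : (forall w, 0 <= f w <= g w) ->
  measurable_fun setT f -> measurable_fun setT g ->
  (\int[P]_w (f w)%:E <= \int[P]_w (g w)%:E)%E.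
Proof.
move=> fg mf mg; apply: ge0_le_integral => //.
- by move=> w _; rewrite lee_fin; case/andP: (fg w).
- exact/measurable_EFinP.
- exact/measurable_EFinP.
- by move=> w _; rewrite lee_fin; case/andP: (fg w).
Qed.

(** Above the cut, x <= (x/c)^eps x. *)
Lemma truncation_tail (x c eps : R) : 0 <= x -> 0 < c -> 0 < eps ->
  x <= Num.min x c + c `^ (- eps) * x `^ (1 + eps).
Proof.
move=> x0 c0 e0; have [xc|cx] := leP x c; first by rewrite lerDl mulr_ge0 ?powR_ge0.
have xp : 0 < x by exact: lt_trans cx.
apply: le_trans (_ : c `^ (- eps) * x `^ (1 + eps) <= _); last by rewrite lerDr ltW.
rewrite powRD; last by rewrite (gt_eqF xp) implybT.
rewrite (powRr1 x0) powRN mulrCA -[leLHS]mulr1 ler_pM2l//.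
rewrite mulrC ler_pdivlMr ?powR_gt0// mul1r.
by apply: ge0_ler_powR; rewrite ?nnegrE ?ltW.
Qed.

Context (X : {RV P >-> R}).
Hypothesis X_ge0 : forall w, 0 <= X w.
Hypothesis EX : ('E_P[X] = 1)%E.

Let mX : measurable_fun setT (X : T -> R). Proof. exact: measurable_funPT. Qed.

Lemma bm_min_rv c : 0 <= c -> bounded_measurable (fun w => Num.min (X w) c).
Proof.
move=> c0; apply: (@bm_between _ _ _ _ 0 c).
  exact: measurable_minr.
by move=> w; rewrite le_min X_ge0 c0/= ge_min lexx orbT.
Qed.

Lemma truncated_mean_le c : 0 <= c -> Ex P (fun w => Num.min (X w) c) <= 1.
Proof.
move=> c0; rewrite -lee_fin -EX expectation_def -integral_bounded; last exact: bm_min_rv.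
apply: integral_le_moment => //; last by case: (bm_min_rv c0).
by move=> w; rewrite le_min X_ge0 c0 ge_min lexx.
Qed.

Lemma truncated_mean_ge c eps : 0 < c -> 0 < eps ->
  ('E_P[(fun w => X w `^ (1 + eps))%R] < +oo)%E ->
  1 - Ex P (fun w => Num.min (X w) c) <=
  c `^ (- eps) * fine 'E_P[(fun w => X w `^ (1 + eps))%R].
Proof.
move=> c0 e0 fin.
have mp : measurable_fun setT (fun w => X w `^ (1 + eps)).
  exact: (measurableT_comp (f := fun z : R => z `^ (1 + eps)) (measurable_powR (1 + eps)) mX).
have e_fin : 'E_P[(fun w => X w `^ (1 + eps))%R]%E \is a fin_num.
  rewrite ge0_fin_numE//; apply: expectation_ge0 => w; exact: powR_ge0.
rewrite lerBlDl -lee_fin EFinD EFinM (fineK e_fin) -EX !expectation_def unlock.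
rewrite -integral_bounded; last exact: bm_min_rv (ltW c0).
have mm : measurable_fun setT (fun w => (Num.min (X w) c)%:E).
  by apply/measurable_EFinP; case: (bm_min_rv (ltW c0)).
rewrite -ge0_integralZl_EFin ?powR_ge0//; last 2 first.
- by move=> w _; rewrite lee_fin powR_ge0.
- exact/measurable_EFinP.
rewrite -ge0_integralD//; last 3 first.
- by move=> w _; rewrite lee_fin le_min X_ge0 ltW.
- by move=> w _; rewrite mule_ge0 ?lee_fin ?powR_ge0.
- by apply/measurable_EFinP; apply: measurable_funM.
apply: integral_le_moment => //.
  by move=> w; rewrite X_ge0; exact: truncation_tail.
apply: measurable_funD; first by case: (bm_min_rv (ltW c0)).
exact: measurable_funM.
Qed.

(** From x <= x^(1+eps) + 1/4, where for x < 1 one compares with x^2. It ensures 2m >= 1, so that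
    the truncation levels built from 2m are at least 1. *)
Lemma moment_ge_half eps : 0 < eps -> eps <= 1 ->
  ('E_P[(fun w => X w `^ (1 + eps))%R] < +oo)%E ->
  2^-1 <= fine 'E_P[(fun w => X w `^ (1 + eps))%R].
Proof.
move=> e0 e1 fin.
have mp : measurable_fun setT (fun w => X w `^ (1 + eps)).
  exact: (measurableT_comp (f := fun z : R => z `^ (1 + eps)) (measurable_powR (1 + eps)) mX).
have e_fin : 'E_P[(fun w => X w `^ (1 + eps))%R]%E \is a fin_num.
  rewrite ge0_fin_numE//; apply: expectation_ge0 => w; exact: powR_ge0.
suff h : (1 <= fine 'E_P[(fun w => X w `^ (1 + eps))%R] + 4^-1 :> R) by lra.
rewrite -lee_fin EFinD (fineK e_fin) -EX !expectation_def unlock.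
rewrite -(Ex_cst P 4^-1) -integral_bounded; last exact: bm_cst.
rewrite -ge0_integralD//; last 2 first.
- by move=> w _; rewrite lee_fin powR_ge0.
- exact/measurable_EFinP.
apply: integral_le_moment => //; last exact: measurable_funD.
move=> w; rewrite X_ge0/=; have := X_ge0 w; move: (X w) => x x0.
have [x1|x1] := leP 1 x.
  apply: le_trans (_ : x `^ (1 + eps) <= _); last by rewrite lerDl.
  rewrite -[leLHS](powRr1 x0); apply: ler_powR => //; lra.
have [->|xn0] := eqVneq x 0; first by rewrite addr_ge0 ?powR_ge0.
apply: le_trans (_ : x ^+ 2 + 4^-1 <= _).
  by rewrite -subr_ge0 (_ : _ - _ = (x - 2^-1) ^+ 2) ?sqr_ge0//; field.
rewrite lerD2r -(powR_mulrn 2 x0); apply: ger_powR; last by rewrite /=; lra.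
by rewrite lt_neqAle eq_sym xn0 x0 /= ltW.
Qed.

(** The mean minimises the quadratic deviation, so centring at 1 only increases it; and as c >= 1,
    cutting moves values towards 1. *)
Lemma truncated_variance_le c : 1 <= c -> ('E_P[(fun w => X w ^+ 2)%R] < +oo)%E ->
  Ex P (fun w => (Ex P (fun w => Num.min (X w) c) - Num.min (X w) c) ^+ 2) <=
  fine 'V_P[X].
Proof.
move=> c1 fin; have c0 : 0 <= c by lra.
have bX := bm_min_rv c0.
have vE : 'V_P[X]%E = (\int[P]_w ((X w - 1) ^+ 2)%:E)%E.
  rewrite /variance unlock EX unlock; apply: eq_integral => w _.
  by rewrite fctE /= /cst /= expr2.
have m1 : measurable_fun setT (fun w => (X w - 1) ^+ 2).
  by apply: measurable_funX; exact: measurable_funB.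
have m2 : measurable_fun setT (fun w => X w ^+ 2) by exact: measurable_funX.
have v_fin : 'V_P[X]%E \is a fin_num.
  rewrite ge0_fin_numE ?variance_ge0// vE.
  apply: le_lt_trans (_ : \int[P]_w (2 * X w ^+ 2 + 2)%:E < +oo)%E.
    apply: integral_le_moment => //.
      move=> w; rewrite sqr_ge0/= -subr_ge0.
      by rewrite (_ : _ - _ = (X w + 1) ^+ 2) ?sqr_ge0//; ring.
    by apply: measurable_funD => //; exact: measurable_funM.
  under eq_integral do rewrite EFinD EFinM.
  rewrite ge0_integralD//; last 2 first.
  - by move=> w _; rewrite mule_ge0// lee_fin sqr_ge0.
  - by apply: measurable_funeM; exact/measurable_EFinP.
  rewrite ge0_integralZl_EFin//; last 2 first.
  - by move=> w _; rewrite lee_fin sqr_ge0.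
  - exact/measurable_EFinP.
  rewrite (integral_bounded (bm_cst _ 2)) Ex_cst lte_add_pinfty ?ltry//.
  by rewrite lte_mul_pinfty// -[X in (X < _)%E]/(\int[P]_w _)%E; rewrite unlock in fin.
rewrite -lee_fin (fineK v_fin) vE -integral_bounded; last first.
  by apply: bmX; apply: bmB => //; exact: bm_cst.
set e := Ex P _.
apply: le_trans (_ : \int[P]_w ((Num.min (X w) c - 1) ^+ 2)%:E <= _)%E.
  rewrite !integral_bounded; last 2 first.
  - by apply: bmX; apply: bmB => //; exact: bm_cst.
  - by apply: bmX; apply: bmB => //; exact: bm_cst.
  rewrite lee_fin Ex_deviation_square//.
  have -> : Ex P (fun w => (Num.min (X w) c - 1) ^+ 2) =
      Ex P (fun w => Num.min (X w) c ^+ 2) - 2 * e + 1.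
    transitivity (Ex P (fun w => Num.min (X w) c ^+ 2 - (2 * Num.min (X w) c - 1))).
      by apply: eq_Ex => w; ring.
    have b2 : bounded_measurable (fun w => 2 * Num.min (X w) c).
      by apply: bmM => //; exact: bm_cst.
    have b1 := bm_cst T (1 : R).
    by rewrite (ExB _ (bmX 2 bX) (bmB b2 b1)) (ExB _ b2 b1) ExZ// Ex_cst -/e; ring.
  by rewrite -subr_ge0 (_ : _ - _ = (e - 1) ^+ 2) ?sqr_ge0// -/e; ring.
apply: integral_le_moment => //.
  move=> w; rewrite sqr_ge0/=; have [xc|cx] := leP (X w) c => //.
  by rewrite lerXn2r ?nnegrE; lra.
by case: (bmX 2 (bmB bX (bm_cst T 1))).
Qed.

Lemma laplace_bounds c : 1 <= c -> 0 < Ex P (fun w => Num.min (X w) c) ->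
  0 < 1 - Ex P (fun w => expR (- X w)) <= 1.
Proof.
move=> c1 hc; have c0 : 0 <= c by lra.
have be : bounded_measurable (fun w => expR (- X w)).
  apply: (@bm_between _ _ _ _ 0 1).
    by apply: measurableT_comp => //; exact: measurable_funN.
  by move=> w; rewrite expR_ge0 expR_le1 oppr_le0 X_ge0.
have bm := bm_min_rv c0.
rewrite gerBl Ex_ge0 ?andbT; last by move=> w; exact: expR_ge0.
apply: lt_le_trans (_ : (2 * c)^-1 * Ex P (fun w => Num.min (X w) c) <= _).
  by rewrite mulr_gt0 ?invr_gt0; lra.
rewrite -ExZ// -[X in X - _](Ex_cst P 1) -ExB//; last exact: bm_cst.
apply: le_Ex.
- by apply: bmM => //; exact: bm_cst.
- by apply: bmB => //; exact: bm_cst.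
move=> w; have := X_ge0 w; move: (X w) => x x0; rewrite mulrC ler_pdivrMr; last by lra.
(* Thus 1 - exp(-x) >= x/(1+x), which is at least min(x, c)/(2c) when c >= 1. *)
have h : expR (- x) * (1 + x) <= 1.
  rewrite expRN mulrC ler_pdivrMr ?expR_gt0// mul1r; exact: expR_ge1Dx.
have e1 : 0 <= expR (- x) := expR_ge0 _.
have e2 : expR (- x) <= 1 by rewrite expR_le1 oppr_le0.
move: (expR _) h e1 e2 => e h e1 e2; have [xc|cx] := leP x c.
  by nra.
by nra.
Qed.

End Moments.

Section ExcessLaw.
Context d (T : measurableType d) (R : realType) (P : probability T R).
Context (X : {RV P >-> R}) (eps : R).
Hypotheses (X_ge0 : forall w, 0 <= X w) (EX : ('E_P[X] = 1)%E) (eps_gt0 : 0 < eps).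
Hypothesis Xeps : ('E_P[(fun w => X w `^ (1 + eps))%R] < +oo)%E.

(** For v >= 0 this is the integral of P(X > z) over [0, v], a distribution function because X has
    mean one. *)
Definition excess_cdf (v : R) : R := Ex P (fun w => Num.min (X w) (Num.max v 0)).

Let max0 (v : R) : 0 <= Num.max v 0. Proof. by rewrite le_max lexx orbT. Qed.

Let bX v := bm_min_rv X_ge0 (max0 v).

Lemma excess_cdf_nondecreasing : nondecreasing excess_cdf.
Proof.
move=> u v uv; apply: le_Ex; [exact: bX|exact: bX|move=> w].
have : Num.max u 0 <= Num.max v 0.
  by rewrite /Num.max; case: (ltP u 0) => h1; case: (ltP v 0) => h2; lra.
move: (Num.max u 0) (Num.max v 0) (X w) => a b x ab.
by rewrite /Num.min; case: (ltP x a) => h1; case: (ltP x b) => h2; lra.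
Qed.

Lemma excess_cdf_lipschitz u v : `|excess_cdf u - excess_cdf v| <= `|u - v|.
Proof.
wlog vu : u v / v <= u.
  by move=> H; case: (leP v u) => [/H//|/ltW/H]; rewrite distrC (distrC v).
rewrite !ger0_norm ?subr_ge0//; last exact: excess_cdf_nondecreasing.
rewrite -ExB; [|exact: bX|exact: bX].
apply: Ex_le; first by apply: bmB; exact: bX.
have h : Num.max v 0 <= Num.max u 0 <= Num.max v 0 + (u - v).
  by rewrite /Num.max; case: (ltP u 0) => h1; case: (ltP v 0) => h2; apply/andP; split; lra.
move=> w; move: (Num.max u 0) (Num.max v 0) (X w) h => a b x /andP[h1 h2].
by rewrite /Num.min; case: (ltP x a) => h3; case: (ltP x b) => h4; lra.
Qed.

Lemma excess_cdf_continuous : continuous excess_cdf.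
Proof.
move=> x; apply/cvgrPdist_le => e e0; near=> y.
apply: le_trans (excess_cdf_lipschitz _ _) _.
by near: y; apply: cvgr_dist_le.
Unshelve. all: by end_near. Qed.

Lemma excess_cdf_right_continuous : right_continuous excess_cdf.
Proof. by move=> x; apply: cvg_at_right_filter; exact: excess_cdf_continuous. Qed.

Lemma excess_cdfNy : excess_cdf @ -oo --> (0 : R).
Proof.
apply: cvg_near_cst; near=> v.
rewrite /excess_cdf (_ : Num.max v 0 = 0); last by apply/max_idPr; near: v; exact: nbhs_ninfty_le.
by rewrite -[RHS](Ex_cst P 0); apply: eq_Ex => w; apply/min_idPr.
Unshelve. all: by end_near. Qed.

Lemma excess_cdfy : excess_cdf @ +oo --> (1 : R).
Proof.
set m := fine 'E_P[(fun w => X w `^ (1 + eps))%R].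
have m0 : 0 <= m by apply: fine_ge0; apply: expectation_ge0 => w; exact: powR_ge0.
apply/cvgrPdist_le => e e0; near=> v.
have v0 : 0 < v by near: v; exact: nbhs_pinfty_gt.
have vE : Num.max v 0 = v by apply/max_idPl; exact: ltW.
rewrite /excess_cdf vE ger0_norm; last first.
  by rewrite subr_ge0; apply: (truncated_mean_le X_ge0 EX); exact: ltW.
apply: le_trans (truncated_mean_ge X_ge0 EX v0 eps_gt0 Xeps) _; rewrite -/m.
rewrite powRN mulrC ler_pdivrMr ?powR_gt0// mulrC -ler_pdivrMr//.
have q0 : 0 <= m / e by rewrite divr_ge0// ltW.
rewrite -[leLHS](powRr1 q0) -[X in _ `^ X](@mulVf _ eps) ?gt_eqF// powRrM.
apply: ge0_ler_powR; [exact: ltW|by rewrite nnegrE powR_ge0|by rewrite nnegrE ltW|].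
by near: v; exact: nbhs_pinfty_ge.
Unshelve. all: by end_near. Qed.

HB.instance Definition _ := isCumulative.Build R _ R excess_cdf
  excess_cdf_nondecreasing excess_cdf_right_continuous.
HB.instance Definition _ := isCumulativeBounded.Build R 0 1 excess_cdf
  excess_cdfNy excess_cdfy.

Let idTR : measurableTypeR R -> R := idfun.

HB.instance Definition _ :=
  @isMeasurableFun.Build _ _ _ _ idTR (@measurable_id _ _ setT).

(* As the law of the first epoch, it gives a renewal process stationary
   increments. *)
Definition excess_law : probability R R :=
  distribution (lebesgue_stieltjes_measure excess_cdf) idTR.

Lemma excess_lawE v : excess_law `]-oo, v]%classic = (excess_cdf v)%:E.
Proof. exact: cdf_lebesgue_stieltjes_id. Qed.

End ExcessLaw.

(** * Transfer of the primitives to path space *)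

Lemma bigsetIP (I : eqType) (T : Type) (J : seq I) (A : I -> set T) (x : T) :
  (\big[setI/setT]_(i <- J) A i) x <-> (forall i, i \in J -> A i x).
Proof.
elim: J => [|j J IH]; first by rewrite big_nil.
rewrite big_cons; split=> [[Aj /IH AJ] i|AJ].
  by rewrite inE => /predU1P[->//|]; exact: AJ.
split; first by apply: AJ; rewrite mem_head.
by apply/IH => i iJ; apply: AJ; rewrite inE iJ orbT.
Qed.

Section IndependentFamily.
Context d (T : measurableType d) (R : realType) (P : probability T R).
Context (I I' : eqType) (X : I' -> {RV P >-> R}) (X_indep : mutually_independent X).
Context (L : I -> probability R R) (K : pred I) (f : I -> I').
Context (psi : T -> {paths I -> R}).
Hypothesis mpsi : forall i, measurable_fun setT (fun t => psi t i).
Hypothesis f_inj : {in K &, injective f}.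
Hypothesis psiE : forall x t, K x -> psi t x = X (f x) t.
Hypothesis X_law : forall x U, K x -> measurable U -> P (X (f x) @^-1` U) = L x U.

Lemma product_law_family : product_law L K (path_law P mpsi).
Proof.
case=> [|x0 J0] U; first by move=> _ _ _; rewrite /cylinder !big_nil; exact: probability_setT.
set J := x0 :: J0 => uJ KJ mU.
(* The sets [U] are carried over to indices by inverting [f] on [J]; the default [x0] is why the
   empty [J] was treated apart. *)
pose V j := U (nth x0 J (index j (map f J))).
have VE x : x \in J -> V (f x) = U x.
  move=> xJ; rewrite /V; congr U.
  have fx : f x \in map f J by exact: map_f.
  have lt : (index (f x) (map f J) < size J)%N by rewrite -(size_map f) index_mem.
  apply: f_inj; [exact: (allP KJ _ (mem_nth _ lt))|exact: (allP KJ)|].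
  by rewrite -(nth_map _ (f x0))// nth_index.
transitivity (P (\big[setI/setT]_(j <- map f J) (X j @^-1` V j))).
  apply: (congr1 P); apply/seteqP; split=> t.
    move=> /cylinderE h; apply/bigsetIP => _ /mapP[x xJ ->].
    by rewrite /preimage /= VE// -psiE; [exact: h|exact: (allP KJ)].
  move=> /bigsetIP h; apply/cylinderE => x xJ.
  by have := h _ (map_f f xJ); rewrite /preimage /= VE// -psiE//; exact: (allP KJ).
have uf : uniq (map f J).
  by rewrite map_inj_in_uniq// => x y xJ yJ; apply: f_inj; exact: (allP KJ).
rewrite (X_indep uf); last by move=> j; exact: mU.
rewrite big_map !big_seq; apply: eq_bigr => x xJ.
by rewrite VE// X_law//; exact: (allP KJ).
Qed.

End IndependentFamily.

Section QueueSpace.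
Context d (T : measurableType d) (R : realType) (P : probability T R).
Context (a s : nat -> {RV P >-> R}) (FA FS FE : probability R R).
Hypothesis a_law : forall k U, measurable U -> P (a k @^-1` U) = FA U.
Hypothesis s_law : forall k U, measurable U -> P (s k @^-1` U) = FS U.
Hypothesis as_indep : mutually_independent
  (fun i : nat + nat => match i with inl k => a k | inr k => s k end).
Local Notation W := {paths coord -> R}.

Definition coord_law (n : nat) (x : coord) : probability R R :=
  match x with
  | inl (inl _) => FA
  | inr (i, 0%N) => if (i < n)%N then FE else FS
  | _ => FS
  end.

Definition primitive_path (t : T) : W := fun x =>
  match x with inl (inl k) => a k t | inl (inr k) => s k t | inr _ => 0 end.

(** A source of i.i.d. services for the pool, taken from [s] by numbering the pairs. It is not
    independent of [primitive_path] on the given space; only its law is used, in a product with the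
    other. *)
Definition spare_path (t : T) : W := fun x =>
  match x with inl _ => 0 | inr q => s (pickle q) t end.

Definition is_primitive : pred coord := fun x => if x is inl _ then true else false.

Lemma measurable_primitive_path x : measurable_fun setT (fun t => primitive_path t x).
Proof.
case: x => [[k|k]|q]; [exact: measurable_funPT|exact: measurable_funPT|].
exact: measurable_cst.
Qed.

Lemma measurable_spare_path x : measurable_fun setT (fun t => spare_path t x).
Proof. by case: x => [x|q]; [exact: measurable_cst|exact: measurable_funPT]. Qed.

Lemma primitive_path_law n :
  product_law (coord_law n) is_primitive (path_law P measurable_primitive_path).
Proof.
apply: (product_law_family as_indep (f := fun x : coord =>
  match x with inl y => y | inr _ => inl 0%N end)).
- by case=> [x|q] [y|q'] //= _ _ ->.
- by case=> [[k|k]|q].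
- by case=> [[k|k]|q] U //= _ mU; [exact: a_law|exact: s_law].
Qed.

Lemma spare_path_law :
  product_law (coord_law 0) (predC is_primitive) (path_law P measurable_spare_path).
Proof.
apply: (product_law_family as_indep (f := fun x : coord =>
  match x with inl y => inl 0%N | inr q => inr (pickle q) end)).
- by case=> [x|q] [y|q'] //= _ _ [/(pcan_inj pickleK) ->].
- by case=> [x|q].
- by case=> [x|[i [|m]]] U //= _ mU; exact: s_law.
Qed.

(** At stage 0 every pool coordinate has the service law; each stage then replaces the residual of
    one more server by an independent draw from [FE]. The second clause keeps the link with the
    given primitives. *)
Lemma queue_space n : exists mu : probability W R,
  product_law (coord_law n) predT mu /\
  (forall g : W -> R, bounded_measurable g -> depends_on is_primitive g ->
     Ex mu g = Ex P (g \o primitive_path)).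
Proof.
elim: n => [|n [mu [hmu hg]]].
  exists (mix_law is_primitive (path_law P measurable_primitive_path)
    (path_law P measurable_spare_path)); split.
    by apply: product_law_mix; [exact: primitive_path_law|exact: spare_path_law].
  move=> g bg dg; rewrite Ex_mix_law// -(Ex_path_law _ measurable_primitive_path)//.
  apply: eq_Ex => w; rewrite -[RHS](Ex_cst (path_law P measurable_spare_path)).
  by apply: eq_Ex => w'; apply: dg => x px; rewrite /mix px.
pose x0 := server_coord n 0.
have mc (x : coord) : measurable_fun setT (fun z : R => (fun=> z) x : R).
  exact: measurable_id.
pose nu := @path_law coord R _ R FE (fun z _ => z) mc.
exists (mix_law (pred1 x0) nu mu); split.
  apply: product_law_mix.
    move=> J U uJ KJ mU; case: J uJ KJ => [|x [|y J]] uJ KJ.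
    - by rewrite /cylinder !big_nil; exact: probability_setT.
    - rewrite big_seq1; move: KJ; rewrite /= andbT => /eqP ->.
      rewrite /= ltnSn; apply: (congr1 FE); apply/seteqP; split=> z.
        by move=> /cylinderE /(_ x0); rewrite mem_head; apply.
      by move=> Uz; apply/cylinderE => y; rewrite inE => /eqP ->.
    - move: KJ uJ => /= /and3P[/eqP -> /eqP -> _].
      by rewrite mem_head.
  move=> J U uJ KJ mU; rewrite (hmu J U uJ (all_predT J) mU).
  rewrite !big_seq; apply: eq_bigr => x xJ.
  have := allP KJ x xJ; case: x {xJ} => [[k|k]|[i [|m]]] //= ix.
  have [e|ni] := eqVneq i n; first by move/negP: ix; case; rewrite e; exact: (eqxx x0).
  by rewrite ltnS [(i <= n)%N]leq_eqVlt (negbTE ni).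
move=> g bg dg; rewrite Ex_mix_law// -hg//.
rewrite -[RHS](Ex_cst nu); apply: eq_Ex => w; apply: eq_Ex => w'.
by apply: dg => -[y|q] // _.
Qed.

End QueueSpace.

(** * Finite-time bound *)

Section RealBounds.
Context (R : realType).
Implicit Types (x y u v B : R).

Lemma geometric_small (r C y : R) : 0 <= r < 1 -> 0 < y ->
  exists M : nat, C * r ^+ M <= y.
Proof.
move=> /andP[r0 r1] y0.
have h : (C * r ^+ M) @[M --> \oo] --> (0 : R).
  rewrite -(mulr0 C); apply: cvgM; first exact: cvg_cst.
  by apply: cvg_expr; rewrite ger0_norm.
have /cvgrPdist_le /(_ y y0) [M _ /(_ M (leqnn M))] := h.
by rewrite /= sub0r normrN => hM; exists M; apply: le_trans hM; exact: ler_norm.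
Qed.

Lemma dyadic_level y : 1 < y -> exists N : nat, y <= (2 ^ N)%:R /\ (2 ^ N)%:R <= 2 * y.
Proof.
move=> y1; have ex : exists N : nat, y <= (2 ^ N)%:R.
  exists (Num.truncn y).+1.
  have /andP[_ h] := truncn_itv (ltW (lt_trans ltr01 y1)).
  apply: le_trans (ltW h) _; rewrite ler_nat ltnW//; exact: ltn_expl.
case: (ex_minnP ex) => -[|N] hN Nmin; first by rewrite expn0 leNgt y1 in hN.
exists N.+1; split=> //; rewrite expnS natrM ler_pM2l// leNgt.
by apply/negP => /ltW /Nmin; rewrite ltnn.
Qed.

Variable eps : R.
Hypotheses (eps_gt0 : 0 < eps) (eps_le1 : eps <= 1).

Definition tail_exponent : R := eps / (1 + eps).
Local Notation d := tail_exponent.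

Let e1 : 0 < 1 + eps. Proof. by rewrite addr_gt0. Qed.

Lemma tail_exponent_gt0 : 0 < d. Proof. by rewrite divr_gt0. Qed.

Lemma tail_exponent_le : d <= 2^-1.
Proof. by rewrite /d ler_pdivrMr//; have := eps_le1; lra. Qed.

Lemma tail_exponent_ge : eps / 2 <= d.
Proof.
rewrite /d ler_pdivlMr//; have := eps_gt0; have := eps_le1 => h1 h0.
by rewrite mulrAC ler_pdivrMr// ler_wpM2l//; lra.
Qed.

Lemma half_powR_le : (2^-1 : R) `^ (2 - d) <= 2^-1 * (729 / 1000).
Proof.
have dle := tail_exponent_le; have h0 : (0 : R) <= 2^-1 by [].
apply: le_trans (_ : (2^-1 : R) `^ (1 + 2^-1) <= _).
  by apply: ger_powR; lra.
rewrite powRD ?invr_eq0 ?pnatr_eq0 ?implybT// powRr1// powR12_sqrt// ler_pM2l ?invr_gt0//.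
rewrite leNgt; apply/negP => lt; have := sqr_sqrtr h0; rewrite expr2; nra.
Qed.

Section Truncation.
Variables (m v mc : R).
Hypotheses (m_ge : 2^-1 <= m) (v_ge : 2^-1 <= v).

(** The level a = (2m)^(1/eps) U^(1/(1+eps)) balances two errors: the overshoot a in Wald's
    identity, and the mean lost over time U, at most a^-eps m U = U^(1-d)/2 <= a/2. *)
Definition cut_scale : R := (2 * m) `^ eps^-1.
Definition cut_level : R := cut_scale * Num.max 1 v `^ (1 + eps)^-1.
Local Notation a := cut_level.
Local Notation U := (Num.max 1 v).

Hypothesis mc_ge : 1 - mc <= a `^ (- eps) * m.

Let m2 : 1 <= 2 * m. Proof. by have := m_ge; lra. Qed.
Let U1 : 1 <= U. Proof. by rewrite le_max lexx. Qed.
Let U0 : 0 < U. Proof. exact: lt_le_trans U1. Qed.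

Lemma cut_scale_ge1 : 1 <= cut_scale.
Proof.
rewrite /cut_scale -[leLHS](powRr0 (2 * m)); apply: ler_powR => //.
by rewrite invr_ge0 ltW.
Qed.

Let A1 := cut_scale_ge1.

Let Up : 1 <= U `^ (1 + eps)^-1.
Proof.
rewrite -[leLHS](powRr0 U); apply: ler_powR => //.
by rewrite invr_ge0 ltW.
Qed.

Lemma cut_level_ge1 : 1 <= a.
Proof. by rewrite /cut_level -[leLHS]mulr1 ler_pM. Qed.

Lemma truncation_loss_le : 1 - mc <= 2^-1 * U `^ (- d).
Proof.
have m0 := m_ge; apply: le_trans mc_ge _; rewrite /cut_level powRM ?powR_ge0//.
rewrite /cut_scale -!powRrM mulrN mulVf ?gt_eqF// powR_inv1; last by lra.
rewrite mulrN [(1 + eps)^-1 * eps]mulrC -/d mulrAC ler_wpM2r ?powR_ge0//.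
by rewrite invfM mulfVK// gt_eqF//; have := m_ge; lra.
Qed.

Lemma mean_cut_ge_half : 2^-1 <= mc.
Proof.
have : U `^ (- d) <= 1.
  rewrite -[leRHS](powRr0 U); apply: ler_powR => //.
  by rewrite oppr_le0 ltW// tail_exponent_gt0.
by have := truncation_loss_le; lra.
Qed.

(** Since mc >= 1/2 and (1 - mc) v' <= a/2, the right side times mc is at least v' - a/2 + 3a/2. *)
Lemma renewal_excess_le v' : 0 <= v' <= v -> (v' + a) / mc <= 1 + v' + 3 * a.
Proof.
move=> /andP[v0 vv]; have mh := mean_cut_ge_half; have a1 := cut_level_ge1.
rewrite ler_pdivrMr; last by lra.
have h : (1 - mc) * v' <= a / 2.
  have [hm|hm] := leP (1 - mc) 0.
    by apply: le_trans (_ : 0 <= _); [rewrite mulr_le0_ge0|lra].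
  apply: le_trans (_ : 2^-1 * U `^ (- d) * U <= _).
    apply: ler_pM; [exact: ltW|exact: v0|exact: truncation_loss_le|].
    by apply: le_trans vv _; rewrite le_max lexx orbT.
  rewrite -mulrA -{2}(powRr1 (ltW U0)) -powRD ?(gt_eqF U0) ?implybT//.
  have -> : - d + 1 = (1 + eps)^-1 by rewrite /d; field; rewrite gt_eqF.
  by rewrite mulrC ler_wpM2r ?invr_ge0// /cut_level ler_peMl// powR_ge0.
nra.
Qed.

(** As a >= 1 the factor is at most 9a; a further factor 2 covers v between 1/2 and 1, where max(1,
    v) is not v. *)
Lemma renewal_variance_le : (3 + 2 * (3 * a)) * v <= 18 * cut_scale * v `^ (2 - d).
Proof.
have v0 : 0 < v by apply: lt_le_trans v_ge.
have dle := tail_exponent_le; have d0 := tail_exponent_gt0.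
have -> : v `^ (2 - d) = v * v `^ (1 - d).
  rewrite (_ : 2 - d = 1 + (1 - d)); last by ring.
  by rewrite powRD ?(gt_eqF v0) ?implybT// powRr1// ltW.
have hU : U `^ (1 + eps)^-1 <= 2 * v `^ (1 - d).
  have -> : (1 + eps)^-1 = 1 - d by rewrite /d; field; rewrite gt_eqF.
  have [v1|v1] := leP 1 v; first by rewrite ler_peMl ?powR_ge0// ler1n.
  rewrite powR1; apply: le_trans (_ : 2 * v <= _); first by have := v_ge; lra.
  rewrite ler_pM2l// -{1}(powRr1 (ltW v0)); apply: ger_powR; last by lra.
  by rewrite v0 ltW.
have a1 := cut_level_ge1.
have h : a <= cut_scale * (2 * v `^ (1 - d)).
  by rewrite /cut_level ler_wpM2l// (le_trans _ A1).
apply: le_trans (_ : 9 * a * v <= _); first by apply: ler_wpM2r; [exact: ltW|lra].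
rewrite [leRHS](_ : _ = 9 * (cut_scale * (2 * v `^ (1 - d))) * v); last by ring.
by apply: ler_wpM2r; [exact: ltW|rewrite ler_pM2l].
Qed.

End Truncation.

Lemma ln2_ge_half : 2^-1 <= ln 2 :> R.
Proof.
rewrite -ler_expR lnK ?posrE//.
have := expR_ge1Dx (- 2^-1 : R); rewrite expRN.
have := expR_gt0 (2^-1 : R); move: (expR _) => z z0 hz.
have : z * (1 - 2^-1) <= z * z^-1 by rewrite ler_pM2l.
by rewrite divff ?gt_eqF//; lra.
Qed.

(** Source of the factor 1/eps: d >= eps/2 and ln 2 >= 1/2 give 1 - 2^-d >= eps/8. *)
Lemma sum_half_powR_le K : \sum_(k < K) ((2 : R) `^ (- d)) ^+ k <= 8 / eps.
Proof.
have d0 := tail_exponent_gt0; have dle := tail_exponent_le; have dge := tail_exponent_ge.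
have l2 := ln2_ge_half; have e0 := eps_gt0.
have hr : (2 : R) `^ (- d) <= 1 - eps / 8.
  rewrite /powR pnatr_eq0 /= mulNr expRN.
  have h1 : 1 + eps / 4 <= expR (d * ln 2).
    apply: le_trans (expR_ge1Dx _); rewrite lerD2l.
    by apply: le_trans (_ : eps / 2 * 2^-1 <= _); [lra|apply: ler_pM; lra].
  rewrite invf_ple ?posrE ?expR_gt0//; last by have := eps_le1; lra.
  apply: le_trans h1; rewrite -[leLHS]mul1r ler_pdivrMr; last by have := eps_le1; lra.
  by have := eps_le1; nra.
have r0 : 0 <= (2 : R) `^ (- d) by exact: powR_ge0.
have hr1 : 0 <= (2 : R) `^ (- d) < 1 by rewrite r0; lra.
apply: le_trans (sum_geometric_le _ hr1) _.
have e8 : 0 < eps / 8 by lra.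
apply: le_trans (_ : (eps / 8)^-1 <= _); last by rewrite invf_div.
rewrite lef_pV2 ?posrE; lra.
Qed.

(** The exponent lies between -2 and -1, so one of the two terms suffices according to whether B is
    below or above 1. *)
Lemma powR_two_sided B : 0 < B -> B `^ (d - 2) <= B^-1 + B ^- 2.
Proof.
move=> B0; have dle := tail_exponent_le; have d0 := tail_exponent_gt0.
have i1 : 0 <= B^-1 by rewrite invr_ge0 ltW.
have i2 : 0 <= B ^- 2 by rewrite invr_ge0 exprn_ge0 ?ltW.
have [b1|b1] := leP 1 B.
  apply: le_trans (_ : B^-1 <= _); last by rewrite lerDl.
  by rewrite -(powR_inv1 (ltW B0)); apply: ler_powR => //; lra.
apply: le_trans (_ : B ^- 2 <= _); last by rewrite lerDr.
rewrite -(powR_invn 2 (ltW B0)); apply: ger_powR; last by lra.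
by rewrite B0 ltW.
Qed.

End RealBounds.

Lemma bm_min_scaled (R : realType) (lambda cut : R) : 0 <= lambda -> 0 <= cut ->
  bounded_measurable (fun z : R => Num.min (lambda * Num.max z 0) cut).
Proof.
move=> l0 c0; apply: (bm_between (a := 0) (c := cut)).
  apply: measurable_minr => //; apply: measurable_funM => //; exact: measurable_maxr.
by move=> z; rewrite ge_min lexx orbT le_min c0 mulr_ge0// le_max lexx orbT.
Qed.

Section FiniteTime.
Context (R : realType) (p : nat).
Local Notation n := p.+1.
Local Notation W := {paths coord -> R}.
Context (FA FS FE : probability R R) (mu : probability W R).
Context (mu_law : product_law (coord_law FA FS FE n) predT mu).
Hypothesis residual_law : forall v, 0 <= v ->
  Ex FE (fun z => (Num.max z 0 <= v)%R%:R) = Ex FS (fun z => Num.min (Num.max z 0) v).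

Lemma server_coord_inj i j m k : server_coord i m = server_coord j k -> i = j /\ m = k.
Proof. by case. Qed.

Let sinj i : injective (server_coord i).
Proof. by move=> m k []. Qed.

Let LF i m : coord_law FA FS FE n (server_coord i m.+1) = FS.
Proof. by []. Qed.

Lemma pool_laplaceE i :
  laplace mu (server_coord i) = Ex FS (fun z => expR (- Num.max z 0)).
Proof.
exact: (Ex_coordinate mu_law (bm_coordinate _ (bm_exp_pos R)) (bm_exp_pos R)).
Qed.

Lemma pool_mean_cutE i v :
  mean_cut mu (server_coord i) v = Ex FS (fun z => Num.min (Num.max z 0) v).
Proof.
exact: (Ex_coordinate mu_law (bm_coordinate _ (bm_min_pos v)) (bm_min_pos v)).
Qed.

Lemma pool_residual_law i v : (i < n)%N -> 0 <= v ->
  Pr mu (fun w => pos w (server_coord i 0) <= v) = mean_cut mu (server_coord i) v.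
Proof.
move=> ni v0; rewrite pool_mean_cutE -residual_law//.
have bg : bounded_measurable (fun z : R => (Num.max z 0 <= v)%R%:R : R).
  by apply: bm_indicator; apply: measurable_fun_ler => //; exact: measurable_maxr.
rewrite /Pr (Ex_coordinate mu_law (bm_coordinate _ bg) bg) /=.
by rewrite ni.
Qed.

Local Notation phi := (Ex FS (fun z => expR (- Num.max z 0))).
Hypothesis phi_lt1 : phi < 1.

Let phi_ge0 : 0 <= phi. Proof. by rewrite -(pool_laplaceE 0); exact: laplace_ge0. Qed.

(** Beyond a large index, epochs fall before [t] with geometrically small probability, so one [M]
    makes all truncation errors up to time [t] negligible. *)
Lemma exists_truncation (t y : R) : 0 <= t -> 0 < y -> exists M : nat,
  forall i, Pr mu (fun w => epoch (server_coord i) M w <= t) <= y /\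
    (forall s v, 0 <= s -> 0 <= v -> s + v <= t ->
      renewal_defect mu (server_coord i) s v M <= y).
Proof.
move=> t0 y0; have hphi : 0 <= phi < 1 by rewrite phi_ge0.
have [M hM] := geometric_small ((1 + t) * expR t) hphi y0.
have e0 : 0 <= expR t * phi ^+ M by rewrite mulr_ge0 ?expR_ge0 ?exprn_ge0.
rewrite -mulrA in hM.
exists M => i; split.
  apply: le_trans (_ : Pr mu (fun w => delay (server_coord i) 0 M w <= t) <= _).
    apply: le_Pr; [|exact: measurable_delay_le|].
      by apply: measurable_fun_ler => //; exact: measurable_epoch.
    by move=> w; apply: le_trans; rewrite lerDr pos_ge0.
  apply: le_trans (Pr_delay_le mu_law (@sinj i) (LF i) 0 M t) _.
  rewrite pool_laplaceE; apply: le_trans hM.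
  by rewrite mulrDl mul1r lerDl mulr_ge0.
move=> s v s0 v0 sv.
apply: le_trans (_ : Ex mu (fun w => Num.max (t - delay (server_coord i) 0 M w) 0) <= _).
  apply: le_Ex; [exact: bm_excess|exact: bm_excess|move=> w].
  rewrite ge_max !le_max lexx orbT andbT; apply/orP; left; exact: lerB.
apply: le_trans (Ex_excess_le mu_law (@sinj i) (LF i) M t0) _.
rewrite pool_laplaceE; apply: le_trans hM.
by rewrite mulrDl mul1r lerDr.
Qed.

Context (eps m : R).
Hypotheses (eps_gt0 : 0 < eps) (eps_le1 : eps <= 1) (m_ge : 2^-1 <= m).
Hypothesis service_tail : forall c, 0 < c ->
  1 - Ex FS (fun z => Num.min (Num.max z 0) c) <= c `^ (- eps) * m.
Local Notation d := (tail_exponent eps).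

Lemma pool_coarse_variance M i s v : (i < n)%N -> 0 <= s -> 2^-1 <= v ->
  renewal_defect mu (server_coord i) s v M <= 2^-1 ->
  Ex mu (fun w => (completions (server_coord i) s v M w -
    Ex mu (completions (server_coord i) s v M)) ^+ 2) <=
  18 * cut_scale eps m * v `^ (2 - d).
Proof.
move=> ni s0 v2 hd; have v0 : 0 <= v by apply: le_trans v2.
have a1 := cut_level_ge1 eps_gt0 v m_ge.
have a0 : 0 < cut_level eps m v by apply: lt_le_trans a1.
have ht := service_tail a0.
have mh := mean_cut_ge_half eps_gt0 m_ge ht.
apply: le_trans (renewal_variance_le eps_gt0 eps_le1 m_ge v2).
apply: (Ex_centered_square mu_law (@sinj i) (LF i)
  (fun z => @pool_residual_law i z ni) s0 v0 _ hd).
  by rewrite mulr_ge0// ltW.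
move=> k v' hv'; case/andP: (hv') => v'0 _.
have mcp : 0 < mean_cut mu (server_coord i) (cut_level eps m v).
  by rewrite pool_mean_cutE; apply: lt_le_trans mh.
apply: le_trans (renewal_function_le mu_law (@sinj i) (LF i) k M v'0 (ltW a0) mcp) _.
rewrite pool_mean_cutE.
exact: (renewal_excess_le eps_gt0 m_ge ht hv').
Qed.

Local Notation psi := (Ex FA (fun z => expR (- Num.max z 0))).
Hypothesis psi_lt1 : psi < 1.

Lemma exists_arrival_bound (t y : R) : 0 < y -> exists J : nat,
  Pr mu (fun w => arrival arrival_coord J w <= t) <= y.
Proof.
(* The arrival stream is read as the services of one more server, so that [Pr_delay_le] applies;
   [c 0] is a filler, as [delay] reads only later coordinates. *)
move=> y0; pose c (k : nat) : coord := if k is k'.+1 then arrival_coord k' else job_coord 0.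
have c_inj : injective c by move=> [|k] [|l] //= [->].
have cF k : coord_law FA FS FE n (c k.+1) = FA by [].
have psiE : laplace mu c = psi.
  exact: (Ex_coordinate mu_law (bm_coordinate _ (bm_exp_pos R)) (bm_exp_pos R)).
have hpsi : 0 <= psi < 1 by rewrite -{1}psiE laplace_ge0.
have [J hJ] := geometric_small (expR t) hpsi y0.
exists J; apply: le_trans (_ : Pr mu (fun w => delay c 0 J w <= t) <= _).
  apply: le_Pr; [|exact: measurable_delay_le|].
    by apply: measurable_fun_ler => //; exact: measurable_arrival.
  by move=> w; apply: le_trans; rewrite lerDr ler01.
by apply: le_trans (Pr_delay_le mu_law c_inj cF 0 J t) _; rewrite psiE.
Qed.

Context (lambda B r sigma2 q : R).
Hypotheses (lambda_ge0 : 0 <= lambda) (B_gt0 : 0 < B) (r_gt0 : 0 < r).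
Hypotheses (r2 : r ^+ 2 = n%:R) (Br : 2 * B < r) (lambdaE : lambda = n%:R - B * r).
Let mean1 c := Ex FA (fun z => Num.min (lambda * Num.max z 0) c).
Hypothesis arrival_mean_le : forall c, 1 <= c -> mean1 c <= 1.
Hypothesis arrival_mean_ge : forall c, 1 <= c -> 1 - mean1 c <= q / c.
Hypothesis arrival_variance : forall c, 1 <= c ->
  Ex FA (fun z => (mean1 c - Num.min (lambda * Num.max z 0) c) ^+ 2) <= sigma2.

Variables (x : R) (N K Y : nat).
Hypotheses (x_ge : 16 <= x) (N_ge : 8 * r / B <= (2 ^ N)%:R).
Hypothesis Y_ge : r * x / 4 < Y%:R + 1.

(** The observation time is itself a window length, t = u_K: the windows k <= K stay in [0, t] and
    the last one covers it. *)
Definition window_length (k : nat) : R := x / (2 * B) * 2 ^+ k.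
(* Twice the level is the drift [B * r] accumulated over half the window; for
   [0 < k] this is at most the drift over [t - s] if [u_k] is the shortest window
   that is at least [t - s]. *)
Definition window_level (k : nat) : R := r * B * window_length k / 4.
Local Notation u := window_length.
Local Notation y := window_level.
Local Notation t := (u K).

Definition window_failure (k : nat) : R :=
  7000 * 20 ^+ 4 * (2 * (2 ^ N)%:R * (n%:R * u k) + 5 * (n%:R * u k) ^+ 2) /
    ((1 - phi) * y k) ^+ 4 +
  16000 * (n%:R * (18 * cut_scale eps m) * u k `^ (2 - d)) / y k ^+ 2 +
  64 * sigma2 * (lambda * u k + 2 * y k) / y k ^+ 2.

Lemma window_length_gt0 k : 0 < u k.
Proof.
by rewrite mulr_gt0 ?exprn_gt0// divr_gt0 ?mulr_gt0//; have := x_ge; lra.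
Qed.

Lemma window_level_gt0 k : 0 < y k.
Proof. by rewrite divr_gt0// (mulr_gt0 (mulr_gt0 r_gt0 B_gt0) (window_length_gt0 k)). Qed.

Lemma window_length_mono k l : (k <= l)%N -> u k <= u l.
Proof.
move=> kl; rewrite ler_wpM2l//; last by rewrite ler_weXn2l// ler1n.
by rewrite divr_ge0 ?mulr_ge0 ?(ltW B_gt0)//; have := x_ge; lra.
Qed.

(** Here x >= 16 is needed: the smallest level is y_0 = r x / 8 with r >= 1, and [no_burst] requires
    levels of at least 2. *)
Lemma window_level_ge2 k : 2 <= y k.
Proof.
apply: le_trans (_ : y 0 <= _); last first.
  rewrite ler_wpM2r ?invr_ge0// ler_wpM2l ?window_length_mono//.
  by rewrite mulr_ge0 ?ltW.
rewrite /window_level /window_length expr0 mulr1.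
have -> : r * B * (x / (2 * B)) / 4 = r * x / 8 by field; rewrite gt_eqF.
have r1 : 1 <= r.
  have r0 := ltW r_gt0; rewrite -(@ler_pXn2r _ 2) ?nnegrE// expr1n r2 ler1n//.
by have := x_ge; nra.
Qed.

(** If job k0 + Y arrived by time t, arrivals in (s, t] would exceed completions by at least Y + 1.
    Let u_k be the shortest window covering t - s: the excess is at most 2 y_k - B r (t - s), which
    the choice of levels makes too small. *)
Lemma queue_not_overloaded (M J : nat) (cut : R) (H : nat -> nat) (w : W) :
  let g k := burst arrival_coord lambda cut (mean1 cut) t (u k) (y k) J (H k) w in
  1 <= cut ->
  (forall k, lambda * u k + y k <= (H k)%:R) ->
  (forall k, (k <= K)%N -> (H k)%:R * (1 - mean1 cut) <= 2^-1) ->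
  (forall k, (k <= K)%N -> ~~ window_lags server_coord n M N t (u k) (y k) w) ->
  (forall k, (k <= K)%N -> ~~ g k) ->
  (forall i : 'I_n, t < epoch (server_coord i) M w) ->
  t < arrival arrival_coord J w ->
  jobs_le p t (n + Y)%:R (coupled p (n * M.+1).+1 w).
Proof.
move=> g cut1 hH hloss hwin hburst hM hJ.
have t0 : 0 <= t by rewrite ltW// window_length_gt0.
have [s [k1 [k0 [/andP[s0 st] sk kk hN hj]]]] := coupled_queue_overload M Y t0 hM.
have [/hj//|late] := ltP t (arrival arrival_coord (k0 + Y) w).
exfalso.
have k1J : (k1 < J)%N.
  rewrite ltnNge; apply/negP => Jk.
  have := le_trans (arrival_mono arrival_coord w Jk)
    (arrival_mono arrival_coord w (leq_trans kk (leq_addr Y k0))).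
  by move=> /le_trans/(_ late); rewrite leNgt hJ.
have ex : exists k, (t - s <= u k) && (k <= K)%N by exists K; rewrite leqnn andbT gerBl.
case: (ex_minnP ex) => k /andP[tsk kK] kmin.
(* Jobs k1, ..., k0 + Y all arrive in (s, t]; both ends are included. *)
pose l := (k0 + Y - k1).+1.
have lE : (k1 + l).-1 = (k0 + Y)%N.
  by rewrite /l addnS /= subnKC// (leq_trans kk)// leq_addr.
have lR : l%:R = k0%:R + Y%:R - k1%:R + 1 :> R.
  by rewrite /l -natr1 natrB ?natrD// (leq_trans kk)// leq_addr.
have us : t - u k <= s by lra.
have h1 : l%:R <= lambda * (t - s) + y k.
  apply: (no_burst (m1 := mean1 cut) (cut := cut) (H := H k) (J := J) (t := t) (u := u k)
    lambda_ge0 (arrival_mean_le cut1) (window_level_ge2 k) (hH k) (hloss k kK)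
    (hburst k kK) k1J _ us sk) => //.
  by rewrite lE.
(* [N] was chosen for this: n u / 2^N <= r B u / 8 = y / 2. *)
have hgrid : n%:R * (u k / (2 ^ N)%:R) <= y k / 2.
  have P0 : 0 < (2 ^ N)%:R :> R by rewrite ltr0n expn_gt0.
  rewrite mulrA ler_pdivrMr// -r2 /window_level.
  have := N_ge; rewrite ler_pdivrMr// => h.
  have u0 := window_length_gt0 k.
  apply: le_trans (_ : r * u k / 8 * (8 * r) <= _); first by rewrite expr2; lra.
  apply: le_trans (_ : r * u k / 8 * ((2 ^ N)%:R * B) <= _); last by lra.
  by apply: ler_wpM2l => //; rewrite divr_ge0// mulr_ge0// ltW.
have h2 := window_lagsN (window_length_gt0 k) (window_level_gt0 k) hgrid (hwin k kK)
  (s := s).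
have {}h2 : n%:R * (t - s) - pool_completions server_coord n s (t - s) M w <= y k.
  by apply: h2; rewrite us st.
have h3 : Y%:R + 1 <= 2 * y k - B * r * (t - s).
  move: h1 h2 hN; rewrite lR lambdaE.
  move: (pool_completions _ _ _ _ _ _) => Q.
  by rewrite mulrBl; lra.
have Br0 : 0 < B * r by rewrite mulr_gt0.
have Y0 : 0 <= Y%:R :> R by [].
(* For k = 0, 2 y_0 = r x / 4 < Y + 1. For k + 1, minimality gives t - s > u_k, and the drift over
   that time already uses up 2 y_(k+1) = B r u_k. *)
case: k => [|k] in tsk kK kmin us h1 hgrid h2 h3 *.
  have e : 2 * y 0 = r * x / 4.
    by rewrite /window_level /window_length expr0; field; rewrite gt_eqF.
  have ts : 0 <= B * r * (t - s) by rewrite mulr_ge0 ?subr_ge0// ltW.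
  have := Y_ge; lra.
have lt : u k < t - s.
  rewrite ltNge; apply/negP => le; have := kmin k.
  by rewrite le (ltnW kK) => /(_ erefl); rewrite ltnn.
have e : 2 * y k.+1 = B * r * u k.
  by rewrite /window_level /window_length exprS; field; rewrite gt_eqF.
have : B * r * u k <= B * r * (t - s) by rewrite ler_pM2l// ltW.
lra.
Qed.

Lemma window_level_mono k l : (k <= l)%N -> y k <= y l.
Proof.
move=> kl; rewrite /window_level ler_pM2r ?invr_gt0// ler_pM2l ?mulr_gt0//.
exact: window_length_mono.
Qed.

Lemma Pr_window_lags_le M k : (k <= K)%N ->
  (forall i s v, 0 <= s -> 0 <= v -> s + v <= t ->
    renewal_defect mu (server_coord i) s v M <= 2^-1) ->
  (forall i s v, 0 <= s -> 0 <= v -> s + v <= t ->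
    n%:R * renewal_defect mu (server_coord i) s v M <= y 0 / 40 * (9 / 10) ^+ N) ->
  Pr mu (window_lags server_coord n M N t (u k) (y k)) <=
  7000 * 20 ^+ 4 * (2 * (2 ^ N)%:R * (n%:R * u k) + 5 * (n%:R * u k) ^+ 2) /
    ((1 - phi) * y k) ^+ 4 +
  16000 * (n%:R * (18 * cut_scale eps m) * u k `^ (2 - d)) / y k ^+ 2.
Proof.
move=> kK hd hs.
apply: (Pr_window_lags mu_law server_coord_inj LF pool_residual_law phi_lt1
  pool_laplaceE (window_length_gt0 k) (window_length_mono kK) (window_level_gt0 k)
  (half_powR_le eps_gt0 eps_le1)).
- by rewrite mulr_ge0// (le_trans _ (cut_scale_ge1 eps_gt0 m_ge)).
- move=> i s v ni s0 v2 sv; apply: pool_coarse_variance => //.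
  by apply: hd => //; apply: le_trans v2.
- move=> i s v s0 v0 sv; apply: le_trans (hs i s v s0 v0 sv) _.
  rewrite ler_pM2r ?exprn_gt0 ?divr_gt0// ler_pM2r ?invr_gt0//.
  exact: window_level_mono.
Qed.

Lemma Pr_burst_le cut J H k : 1 <= cut -> H%:R <= lambda * u k + 2 * y k ->
  Pr mu (burst arrival_coord lambda cut (mean1 cut) t (u k) (y k) J H) <=
  64 * sigma2 * (lambda * u k + 2 * y k) / y k ^+ 2.
Proof.
move=> c1 hH; have c0 : 0 <= cut by apply: le_trans c1.
have inj : injective arrival_coord by move=> i j [].
have bg := bm_min_scaled lambda_ge0 c0.
have bz : bounded_measurable (fun z : R =>
    (mean1 cut - Num.min (lambda * Num.max z 0) cut) ^+ 2).
  by apply: bmX; apply: bmB => //; exact: bm_cst.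
apply: (Pr_burst mu_law inj lambda_ge0 c0 _ _ _ _ (window_level_ge2 k) hH).
  by move=> i; exact: (Ex_coordinate mu_law (bm_coordinate _ bg) bg).
move=> i; apply: le_trans (arrival_variance c1).
by rewrite le_eqVlt; apply/orP; left; apply/eqP;
  exact: (Ex_coordinate mu_law (bm_coordinate _ bz) bz).
Qed.

(** The cut, [M] and [J] are chosen after the horizon and an arbitrary error e, so they leave no
    trace in the bound. The probability is computed on the coupled path, which has the same law as
    far as the queue is concerned. *)
Lemma finite_time_bound :
  1 - \sum_(k < K.+1) window_failure k <= Pr mu (jobs_le p t (n + Y)%:R).
Proof.
rewrite lerBlDl -lerBlDr; apply/ler_addgt0Pr => e e0; rewrite lerBlDr.
have t0 : 0 <= t by rewrite ltW// window_length_gt0.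
pose H k := (Num.truncn (lambda * u k + y k)).+1.
have ly0 k : 0 <= lambda * u k + y k.
  apply: addr_ge0 (ltW (window_level_gt0 k)).
  exact: mulr_ge0 lambda_ge0 (ltW (window_length_gt0 k)).
have H_ge k : lambda * u k + y k <= (H k)%:R.
  by have /andP[_ /ltW] := truncn_itv (ly0 k).
have H_le k : (H k)%:R <= lambda * u k + 2 * y k.
  have /andP[h _] := truncn_itv (ly0 k).
  by rewrite /H -natr1; have := window_level_ge2 k; lra.
pose Hs := (\sum_(k < K.+1) H k)%N.
(* The mean loses at most q / cut per step, hence at most 1/2 over any of the H k steps. *)
pose cut := 1 + 2 * `|q| * Hs%:R.
have cut1 : 1 <= cut by rewrite lerDl !mulr_ge0.
have hloss k : (k <= K)%N -> (H k)%:R * (1 - mean1 cut) <= 2^-1.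
  rewrite -ltnS => kK; have HH : (H k)%:R <= Hs%:R :> R.
    by rewrite ler_nat /Hs (bigD1 (Ordinal kK))//= leq_addr.
  apply: le_trans (_ : (H k)%:R * (`|q| / cut) <= _).
    rewrite ler_wpM2l//; apply: le_trans (arrival_mean_ge cut1) _.
    by rewrite ler_wpM2r ?ler_norm// invr_ge0 (le_trans _ cut1).
  rewrite mulrA ler_pdivrMr; last exact: lt_le_trans cut1.
  have q0 := normr_ge0 q; have : (H k)%:R * `|q| <= Hs%:R * `|q| by rewrite ler_wpM2r.
  by rewrite /cut; lra.
have n0 : 0 < n%:R :> R by [].
pose z0 := y 0 / 40 * (9 / 10) ^+ N.
have z0p : 0 < z0.
  by apply: mulr_gt0; [apply: divr_gt0 (window_level_gt0 0) _|apply: exprn_gt0; lra].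
(* Three demands: a defect of at most 1/2 in the variance bound, total probability e/2 that some
   server reaches epoch M by time t, and a total bias below every chaining threshold. *)
pose ym := Num.min 2^-1 (Num.min (e / 2 / n%:R) (z0 / n%:R)).
have ym0 : 0 < ym by rewrite !lt_min invr_gt0 ltr0n (divr_gt0 z0p n0) !divr_gt0.
have ym1 : ym <= 2^-1 by rewrite /ym ge_min lexx.
have ym2 : n%:R * ym <= e / 2.
  by rewrite mulrC -ler_pdivlMr// /ym !ge_min lexx orbT.
have ym3 : n%:R * ym <= z0.
  by rewrite mulrC -ler_pdivlMr// /ym !ge_min lexx !orbT.
have [M hM] := exists_truncation t0 ym0.
have e2 : 0 < e / 2 by rewrite divr_gt0.
have [J hJ] := exists_arrival_bound t e2.
pose bl k := window_lags server_coord n M N t (u k) (y k).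
pose bb k := burst arrival_coord lambda cut (mean1 cut) t (u k) (y k) J (H k).
pose be i (w : W) := epoch (server_coord i) M w <= t.
pose ba (w : W) := arrival arrival_coord J w <= t.
have mbl k : measurable_fun setT (bl k) by exact: measurable_window_lags.
have mbb k : measurable_fun setT (bb k) by apply: measurable_burst => //; apply: le_trans cut1.
have mbe i : measurable_fun setT (be i).
  by apply: measurable_fun_ler => //; exact: measurable_epoch.
have mba : measurable_fun setT ba.
  by apply: measurable_fun_ler => //; exact: measurable_arrival.
pose Q := (n * M.+1).+1.
have mj : measurable_fun setT (jobs_le (R := R) p t (n + Y)%:R) by exact: measurable_jobs_le.
have mjc : measurable_fun setT (fun w => jobs_le p t (n + Y)%:R (coupled p Q w)).
  apply: (measurableT_comp mj); apply: measurable_to_paths => i.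
  exact: measurable_coupled.
have -> : Pr mu (jobs_le p t (n + Y)%:R) =
    Pr mu (fun w => jobs_le p t (n + Y)%:R (coupled p Q w)).
  apply/esym; apply: (Ex_coupled (f := fun w => (jobs_le p t (n + Y)%:R w)%:R) p mu_law
    (fun=> erefl) (fun _ _ => erefl) Q); first exact: bm_indicator.
  by move=> w w' ww; congr ((nat_of_bool _)%:R); exact: depends_on_jobs_le.
have bad : Pr mu (fun w => ~~ jobs_le p t (n + Y)%:R (coupled p Q w)) <=
    \sum_(k <- iota 0 K.+1) Pr mu (bl k) + \sum_(k <- iota 0 K.+1) Pr mu (bb k) +
    (\sum_(i <- iota 0 n) Pr mu (be i) + Pr mu ba).
  have ml := measurable_has (iota 0 K.+1) mbl.
  have mb := measurable_has (iota 0 K.+1) mbb.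
  have me := measurable_has (iota 0 n) mbe.
  apply: le_trans (_ : Pr mu (fun w =>
    (has (bl^~ w) (iota 0 K.+1) || has (bb^~ w) (iota 0 K.+1)) ||
    (has (be^~ w) (iota 0 n) || ba w)) <= _).
    apply: le_Pr; [exact: measurable_neg| |].
      by apply: measurable_or; [exact: measurable_or|exact: measurable_or].
    move=> w; apply: contraNT => /norP[/norP[h1 h2] /norP[h3 h4]].
    have inK k : (k <= K)%N -> k \in iota 0 K.+1 by rewrite mem_iota add0n ltnS.
    apply: (queue_not_overloaded (M := M) (J := J) (H := H) cut1 H_ge hloss).
    - by move=> k kK; exact: (hasPn h1 k (inK k kK)).
    - by move=> k kK; exact: (hasPn h2 k (inK k kK)).
    - by move=> i; rewrite ltNge; apply: (hasPn h3 i); rewrite mem_iota add0n ltn_ord.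
    - by rewrite ltNge.
  apply: le_trans (Pr_or _ _ _) _; [exact: measurable_or|exact: measurable_or|].
  apply: lerD.
    by apply: le_trans (Pr_or _ ml mb) _; apply: lerD; apply: Pr_le_sum.
  by apply: le_trans (Pr_or _ me mba) _; rewrite lerD2r; apply: Pr_le_sum.
rewrite (Pr_neg _ mjc) in bad.
have s1 : \sum_(k <- iota 0 K.+1) Pr mu (bl k) + \sum_(k <- iota 0 K.+1) Pr mu (bb k) <=
    \sum_(k < K.+1) window_failure k.
  rewrite -big_split -[iota 0 K.+1]/(index_iota 0 K.+1) big_mkord.
  apply: ler_sum => k _ /=; have kK : (k <= K)%N by rewrite -ltnS.
  apply: lerD; last exact: Pr_burst_le.
  apply: Pr_window_lags_le => // i s v s0 v0 sv; have [_ h] := hM i.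
    exact: le_trans (h s v s0 v0 sv) ym1.
  by apply: le_trans ym3; rewrite ler_pM2l//; exact: h.
have s2 : \sum_(i <- iota 0 n) Pr mu (be i) <= e / 2.
  apply: le_trans ym2; rewrite -[iota 0 n]/(index_iota 0 n) big_mkord.
  apply: le_trans (_ : \sum_(i < n) ym <= _).
    by apply: ler_sum => i _; have [] := hM i.
  by rewrite sumr_const card_ord mulr_natl.
have s3 : Pr mu ba <= e / 2 by [].
lra.
Qed.

End FiniteTime.

(** * Summing the failure probabilities *)

Section SumBound.
Context (R : realType) (B r x lambda sigma2 eps A0 psi : R) (P : R).
Hypotheses (B_gt0 : 0 < B) (r_ge1 : 1 <= r) (Br : 2 * B < r) (x_ge : 16 <= x).
Hypotheses (P_le : P <= 16 * r / B) (lambda_le : lambda <= r ^+ 2).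
Hypotheses (eps_gt0 : 0 < eps) (eps_le1 : eps <= 1) (A0_ge0 : 0 <= A0) (psi_gt0 : 0 < psi).
Hypothesis sigma2_ge0 : 0 <= sigma2.
Local Notation d := (tail_exponent eps).
Local Notation u := (window_length B x).
Local Notation y := (window_level B r x).

Let r_gt0 : 0 < r. Proof. exact: lt_le_trans r_ge1. Qed.
Let x_gt0 : 0 < x. Proof. by have := x_ge; lra. Qed.

Let BuE k : B * u k = x / 2 * 2 ^+ k.
Proof. by rewrite /window_length; field; rewrite gt_eqF. Qed.

Let u_gt0 k : 0 < u k.
Proof. by rewrite mulr_gt0 ?exprn_gt0// divr_gt0 ?mulr_gt0. Qed.

Let Bu_ge k : 8 <= B * u k.
Proof.
rewrite BuE; apply: le_trans (_ : x / 2 <= _); first by have := x_ge; lra.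
by rewrite ler_peMr ?divr_ge0 ?(ltW x_gt0)// exprn_ege1// ler1n.
Qed.

(** As B u >= 8 and P <= 16 r / B, the term linear in r^2 u is at most four times its square, so 9
    r^4 u^2 remains; 9216 = 9 * 4^4 * 4 after inserting y = r B u / 4 and u = 2^k x / (2B). *)
Lemma fine_failure_le C k : 0 <= C ->
  C * (2 * P * (r ^+ 2 * u k) + 5 * (r ^+ 2 * u k) ^+ 2) / (psi * y k) ^+ 4 <=
  C * 9216 / psi ^+ 4 * B ^- 2 * x ^- 2 * 4 ^- k.
Proof.
move=> C0; have u0 := u_gt0 k; have Bu := Bu_ge k.
have -> : C * 9216 / psi ^+ 4 * B ^- 2 * x ^- 2 * 4 ^- k =
    C * (9 * r ^+ 4 * u k ^+ 2) / (psi * y k) ^+ 4.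
  have e4 : (4 : R) ^- k = (2 ^+ k) ^- 2.
    by rewrite -exprM mulnC exprM; congr (_ ^- _); lra.
  rewrite e4 /window_level /window_length; field.
  by rewrite !gt_eqF// ?exprn_gt0.
have yp : 0 < (psi * y k) ^+ 4.
  by rewrite exprn_gt0// mulr_gt0// divr_gt0// mulr_gt0// mulr_gt0.
rewrite ler_pM2r ?invr_gt0// ler_wpM2l//.
have r0 := r_gt0; have r1 := r_ge1.
suff : 2 * P * (r ^+ 2 * u k) <= 4 * r ^+ 2 * u k * (r ^+ 2 * u k) by lra.
have ru : 0 <= r ^+ 2 * u k by rewrite mulr_ge0 ?exprn_ge0 ?ltW.
rewrite ler_wpM2r//; apply: le_trans (_ : 32 * r / B <= _); first by have := P_le; lra.
rewrite ler_pdivrMr// expr2.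
apply: le_trans (_ : 4 * r * 8 <= _); first by lra.
apply: le_trans (_ : 4 * r * (B * u k) <= _); first by rewrite ler_pM2l ?mulr_gt0.
apply: le_trans (_ : 4 * r * (B * u k) * r <= _); last by lra.
apply: ler_peMr => //.
exact: mulr_ge0 (mulr_ge0 (ler0n _ 4) (ltW r0)) (ltW (mulr_gt0 B_gt0 u0)).
Qed.

(** The slowest of the three decays: u^-d supplies x^-d and the ratio 2^-d, and its B^d combines
    with B^-2. *)
Lemma coarse_failure_le C k : 0 <= C ->
  C * (r ^+ 2 * (18 * A0) * u k `^ (2 - d)) / y k ^+ 2 <=
  C * 576 * A0 * (B^-1 + B ^- 2) * x `^ (- d) * (2 `^ (- d)) ^+ k.
Proof.
move=> C0; have u0 := u_gt0 k; have d0 := tail_exponent_gt0 eps_gt0.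
have dle := tail_exponent_le eps_gt0 eps_le1.
have uE : u k `^ (2 - d) = u k ^+ 2 * u k `^ (- d).
  by rewrite powRD ?(gt_eqF u0) ?implybT// powR_mulrn ?ltW.
have -> : C * (r ^+ 2 * (18 * A0) * u k `^ (2 - d)) / y k ^+ 2 =
    C * 288 * A0 * B ^- 2 * u k `^ (- d).
  by rewrite uE /window_level; field; rewrite !gt_eqF.
have -> : u k `^ (- d) = 2 `^ d * B `^ d * x `^ (- d) * (2 `^ (- d)) ^+ k.
  have b2 : 0 <= 2 * B by rewrite mulr_ge0 ?ltW.
  rewrite /window_length powRM ?exprn_ge0 ?divr_ge0 ?(ltW x_gt0)//.
  rewrite powRM ?invr_ge0 ?(ltW x_gt0)// -(powR_inv1 b2) -powRrM mulN1r opprK.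
  have -> : ((2 : R) ^+ k) `^ (- d) = (2 `^ (- d)) ^+ k.
    rewrite -(powR_mulrn k (ler0n R 2)) -(powR_mulrn k (powR_ge0 2 _)) -!powRrM.
    by rewrite mulrC.
  by rewrite (powRM d (ler0n R 2) (ltW B_gt0)); ring.
have BE : B ^- 2 * B `^ d = B `^ (d - 2).
  by rewrite powRD ?(gt_eqF B_gt0) ?implybT// mulrC powR_invn ?ltW.
have hB := powR_two_sided eps_gt0 eps_le1 B_gt0.
have h2 : (2 : R) `^ d <= 2.
  by rewrite -[leRHS](powRr1 (ler0n R 2)); apply: ler_powR; [rewrite ler1n|lra].
rewrite [leLHS](_ : _ = C * 288 * A0 * x `^ (- d) * (2 `^ (- d)) ^+ k * (2 `^ d * B `^ (d - 2))).
  rewrite [leRHS](_ : _ = C * 288 * A0 * x `^ (- d) * (2 `^ (- d)) ^+ k * (2 * (B^-1 + B ^- 2))).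
    apply: ler_wpM2l; last by apply: ler_pM; rewrite ?powR_ge0.
    have C3 : 0 <= C * 288 * A0 := mulr_ge0 (mulr_ge0 C0 (ler0n _ _)) A0_ge0.
    exact: mulr_ge0 (mulr_ge0 C3 (powR_ge0 _ _)) (exprn_ge0 _ (powR_ge0 _ _)).
  by ring.
by rewrite -BE; ring.
Qed.

(** By 2B < r the level term 2y is at most r^2 u / 4, so it joins the arrival term with the factor
    5/4. *)
Lemma burst_failure_le C k : 0 <= C ->
  C * (lambda * u k + 2 * y k) / y k ^+ 2 <= C * 40 * B^-1 * x^-1 * 2 ^- k.
Proof.
move=> C0; have u0 := u_gt0 k; have br := Br; have r0 := r_gt0.
have y0 : 0 < y k := divr_gt0 (mulr_gt0 (mulr_gt0 r0 B_gt0) u0) (ltr0n _ 4).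
have -> : C * 40 * B^-1 * x^-1 * 2 ^- k = C * (5 / 4 * r ^+ 2 * u k) / y k ^+ 2.
  rewrite /window_level /window_length; field.
  by rewrite !gt_eqF// ?exprn_gt0.
rewrite ler_pM2r; last by rewrite invr_gt0 exprn_gt0.
apply: ler_wpM2l => //; have h : lambda * u k <= r ^+ 2 * u k by rewrite ler_pM2r.
have : 2 * y k <= 1 / 4 * r ^+ 2 * u k.
  rewrite /window_level expr2; have : B * (r * u k) <= r / 2 * (r * u k).
    by apply: ler_wpM2r; [exact: mulr_ge0 (ltW r0) (ltW u0)|lra].
  lra.
lra.
Qed.

Lemma sum_geometric_inv_le (b : R) K : 2 <= b -> \sum_(k < K) b ^- k <= 2.
Proof.
move=> b2; have b0 : 0 < b by lra.
have hb : 0 <= b^-1 < 1 by rewrite invr_ge0 ltW// invf_lt1//; lra.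
rewrite (eq_bigr (fun k : 'I_K => b^-1 ^+ k)) => [|k _]; last by rewrite exprVn.
apply: le_trans (sum_geometric_le _ hb) _.
rewrite -[leRHS]invrK lef_pV2 ?posrE ?invr_gt0 ?subr_gt0 ?(andP hb).2//.
have : b^-1 <= 2^-1 by rewrite lef_pV2 ?posrE.
by lra.
Qed.

Variables (A1 : R) (K : nat).
Hypotheses (A1_ge1 : 1 <= A1) (A01 : A0 <= A1) (psi_le1 : psi <= 1).
Local Notation bound :=
  ((eps * psi) ^- 7 * A1 * (1 + sigma2) * (B^-1 + B ^- 2) * x `^ (- d)).

Lemma le_failure_bound (e a s b z : R) : 0 <= e -> 0 <= a -> 0 <= s -> 0 <= b -> 0 <= z ->
  e <= (eps * psi) ^- 7 -> a <= A1 -> s <= 1 + sigma2 -> b <= B^-1 + B ^- 2 ->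
  z <= x `^ (- d) -> e * a * s * b * z <= bound.
Proof.
move=> e0 a0 s0 b0 z0 he ha hs hb hz.
have ea := mulr_ge0 e0 a0; have eas := mulr_ge0 ea s0; have easb := mulr_ge0 eas b0.
by do 4!(apply: ler_pM => //).
Qed.

(** The three sums bring psi^-4, eps^-1 and 1, all at most (eps psi)^-7 because eps and psi are at
    most 1; the powers of x are compared with x^-d in the same way. *)
Lemma sum_failure_le (C C' C'' : R) : 0 <= C -> 0 <= C' -> 0 <= C'' ->
  \sum_(k < K) (C * (2 * P * (r ^+ 2 * u k) + 5 * (r ^+ 2 * u k) ^+ 2) /
      (psi * y k) ^+ 4 +
    C' * (r ^+ 2 * (18 * A0) * u k `^ (2 - d)) / y k ^+ 2 +
    C'' * sigma2 * (lambda * u k + 2 * y k) / y k ^+ 2) <=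
  (C * 18432 + C' * 4608 + C'' * 80) * bound.
Proof.
move=> C0 C'0 C''0.
have d0 := tail_exponent_gt0 eps_gt0; have dle := tail_exponent_le eps_gt0 eps_le1.
have s0 := sigma2_ge0; have a1 := A1_ge1; have p0 := psi_gt0; have e0 := eps_gt0.
have b1 : 0 <= B^-1 by rewrite invr_ge0 ltW.
have b2 : 0 <= B ^- 2 by rewrite invr_ge0 exprn_ge0 ?ltW.
have x1 : 1 <= x by have := x_ge; lra.
have X1 : x^-1 <= x `^ (- d).
  by rewrite -(powR_inv1 (ltW x_gt0)); apply: ler_powR => //; lra.
have X2 : x ^- 2 <= x `^ (- d).
  by rewrite -(powR_invn 2 (ltW x_gt0)); apply: ler_powR => //; lra.
have xi0 : 0 <= x^-1 by rewrite invr_ge0 ltW.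
have xi2 : 0 <= x ^- 2 by rewrite invr_ge0 exprn_ge0 ?ltW.
have ep0 : 0 < eps * psi by rewrite mulr_gt0.
have epe : eps * psi <= eps by apply: ler_piMr => //; exact: ltW.
have epp : eps * psi <= psi by apply: ler_piMl => //; exact: ltW.
have ep1 : eps * psi <= 1 by rewrite (le_trans epe).
have E1 : psi ^- 4 <= (eps * psi) ^- 7.
  rewrite lef_pV2 ?posrE ?exprn_gt0//.
  apply: le_trans (_ : (eps * psi) ^+ 4 <= _).
    by apply: ler_wiXn2l => //; exact: ltW.
  by apply: lerXn2r => //; rewrite nnegrE ltW.
have E2 : eps^-1 <= (eps * psi) ^- 7.
  rewrite lef_pV2 ?posrE ?exprn_gt0//.
  apply: le_trans epe; rewrite -[leRHS]expr1.
  by apply: ler_wiXn2l => //; exact: ltW.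
have E3 : 1 <= (eps * psi) ^- 7.
  by rewrite invf_ge1 ?exprn_gt0//; apply: exprn_ile1 => //; exact: ltW.
apply: le_trans (_ : \sum_(k < K)
  (C * 9216 / psi ^+ 4 * B ^- 2 * x ^- 2 * 4 ^- k +
   C' * 576 * A0 * (B^-1 + B ^- 2) * x `^ (- d) * (2 `^ (- d)) ^+ k +
   C'' * sigma2 * 40 * B^-1 * x^-1 * 2 ^- k) <= _).
  apply: ler_sum => k _; apply: lerD; first apply: lerD.
  - exact: (fine_failure_le k C0).
  - exact: (coarse_failure_le k C'0).
  - exact: (burst_failure_le k (mulr_ge0 C''0 s0)).
rewrite !big_split /= -!mulr_sumr.
have S1 := sum_geometric_inv_le K (ler_nat R 2 4).
have S2 := sum_half_powR_le eps_gt0 eps_le1 K.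
have S3 := sum_geometric_inv_le K (lexx (2 : R)).
have L1 := le_failure_bound (e := psi ^- 4) (a := 1) (s := 1) (b := B ^- 2) (z := x ^- 2).
have L2 := le_failure_bound (e := eps^-1) (a := A0) (s := 1) (b := B^-1 + B ^- 2)
  (z := x `^ (- d)).
have L3 := le_failure_bound (e := 1) (a := 1) (s := sigma2) (b := B^-1) (z := x^-1).
have p4 : 0 <= psi ^- 4 by rewrite invr_ge0 exprn_ge0 ?ltW.
have ei : 0 <= eps^-1 by rewrite invr_ge0 ltW.
have X0 := powR_ge0 x (- d).
have s1 : (1 : R) <= 1 + sigma2 by lra.
rewrite [leRHS](_ : _ = C * 18432 * bound + C' * 4608 * bound + C'' * 80 * bound);
  last by ring.
apply: lerD; first apply: lerD.
- have h : 0 <= C * 9216 / psi ^+ 4 * B ^- 2 * x ^- 2.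
    by rewrite (mulr_ge0 (mulr_ge0 (mulr_ge0 (mulr_ge0 C0 (ler0n _ _)) p4) b2) xi2).
  apply: le_trans (ler_wpM2l h S1) _.
  rewrite [leLHS](_ : _ = C * 18432 * (psi ^- 4 * 1 * 1 * B ^- 2 * x ^- 2)); last by ring.
  apply: ler_wpM2l (mulr_ge0 C0 (ler0n _ _)) _ _ _.
  by apply: L1 => //; rewrite lerDr.
- have h : 0 <= C' * 576 * A0 * (B^-1 + B ^- 2) * x `^ (- d).
    by rewrite (mulr_ge0 (mulr_ge0 (mulr_ge0 (mulr_ge0 C'0 (ler0n _ _)) A0_ge0)
      (addr_ge0 b1 b2)) X0).
  apply: le_trans (ler_wpM2l h S2) _.
  rewrite [leLHS](_ : _ = C' * 4608 * (eps^-1 * A0 * 1 * (B^-1 + B ^- 2) * x `^ (- d)));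
    last by ring.
  apply: ler_wpM2l (mulr_ge0 C'0 (ler0n _ _)) _ _ _.
  by apply: L2 => //; exact: addr_ge0.
- have h : 0 <= C'' * sigma2 * 40 * B^-1 * x^-1.
    by rewrite (mulr_ge0 (mulr_ge0 (mulr_ge0 (mulr_ge0 C''0 s0) (ler0n _ _)) b1) xi0).
  apply: le_trans (ler_wpM2l h S3) _.
  rewrite [leLHS](_ : _ = C'' * 80 * (1 * 1 * sigma2 * B^-1 * x^-1)); last by ring.
  apply: ler_wpM2l (mulr_ge0 C''0 (ler0n _ _)) _ _ _.
  by apply: L3 => //; rewrite ?lerDr ?lerDl.
Qed.

End SumBound.

(** * Steady state *)

Section ContinuityPoint.
Context d (T : measurableType d) (R : realType) (P : probability T R).
Context (Q : {RV P >-> R}).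

(** A monotone function has countably many discontinuities, and an interval of positive length is
    not Lebesgue null. *)
Lemma exists_continuity_point (a b : R) : a < b ->
  exists2 z, a < z < b & {for z, continuous (cdf Q)}.
Proof.
move=> ab; pose F := fine \o cdf Q.
have finQ z : cdf Q z \is a fin_num by exact: fin_num_measure.
have ndF : nondecreasing F.
  by move=> z z' zz; rewrite /F /= fine_le//; exact: cdf_nondecreasing.
have cD := @discontinuity_countable R a b F (fun z z' _ _ => @ndF z z').
have [z [zab zD]] : exists z, z \in (`]a, b[) /\ ~ discontinuity F z.
  apply: contrapT => H.
  have sub : `]a, b[%classic `<=` [set z | z \in (`]a, b[) /\ discontinuity F z].
    by move=> z zab; split=> //; apply: contrapT => nz; apply: H; exists z.
  have := countable_lebesgue_measure0 (sub_countable (subset_card_le sub) cD).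
  rewrite lebesgue_measure_itv /= lte_fin ab -EFinB => -[] /eqP.
  by rewrite subr_eq0 (gt_eqF ab).
have ltz : a < z < b by rewrite in_itv/= in zab.
exists z => //; case/andP: ltz => az zb.
have cr : F x @[x --> z^'+] --> F z.
  apply: fine_cvg; rewrite /F /= fineK//; exact: cdf_right_continuous.
have cl : cvg (F x @[x --> z^'-]).
  apply: nondecreasing_at_left_is_cvgr; near=> r.
    by move=> u v _ _; exact: ndF.
  exists (F z) => _/= [u ur <-]; apply: ndF.
  by move: ur => /[!in_itv]/= /andP[_ /ltW].
have lE : lim (F x @[x --> z^'-]) = F z.
  apply: contrapT => ne; apply: zD; split => //; first by apply/cvg_ex; exists (F z).
  by rewrite (cvg_lim _ cr)//; apply/eqP.
apply/left_right_continuousP; split; last exact: cdf_right_continuous.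
have -> : cdf Q z = (F z)%:E by rewrite /F /= fineK.
have -> : cdf Q = (fun u => (F u)%:E) by apply/funext => u; rewrite /F /= fineK.
by apply: cvg_EFin; [exact: nearW|rewrite -lE].
Unshelve. all: by end_near. Qed.

End ContinuityPoint.
Section SteadyLimit.
Context d (T : measurableType d) (R : realType) (P : probability T R) (p : nat).
Local Notation n := p.+1.
Local Notation W := {paths coord -> R}.
Context (a s : nat -> {RV P >-> R}) (FA FS FE : probability R R).
Hypothesis a_law : forall k U, measurable U -> P (a k @^-1` U) = FA U.
Hypothesis s_law : forall k U, measurable U -> P (s k @^-1` U) = FS U.
Hypotheses (FA_ge0 : FA `]-oo, 0[%classic = 0%E) (FS_ge0 : FS `]-oo, 0[%classic = 0%E).
Context (mu : probability W R) (mu_law : product_law (coord_law FA FS FE n) predT mu).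
Hypothesis Ex_mu : forall g : W -> R, bounded_measurable g -> depends_on is_primitive g ->
  Ex mu g = Ex P (g \o primitive_path a s).
Context d1 (T1 : measurableType d1) (P1 : probability T1 R) (Q : {RV P1 >-> R}).
Hypothesis Q_steady : steady_state n a s Q.

Lemma ae_le_measure (A A' : set T) : measurable A -> measurable A' ->
  {ae P, forall w, A w -> A' w} -> (P A <= P A')%E.
Proof.
move=> mA mA' [N [mN N0 sN]].
rewrite -[leRHS]adde0 -N0; apply: le_trans (measureU2 _ mA' mN).
apply: le_measure; rewrite ?inE//; first exact: measurableU.
by move=> w Aw; apply: contrapT => /not_orP[nA' nN]; apply: nN; apply: sN => /(_ Aw).
Qed.

Lemma primitives_ge0 : {ae P, forall w k, 0 <= a k w /\ 0 <= s k w}.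
Proof.
apply: ae_foralln => k.
have ge0 (X : {RV P >-> R}) (F : probability R R) :
    (forall U, measurable U -> P (X @^-1` U) = F U) -> F `]-oo, 0[%classic = 0%E ->
    {ae P, forall w, 0 <= X w}.
  move=> XF F0; exists (X @^-1` `]-oo, 0[%classic); split.
  - exact: measurable_funPTI.
  - exact: etrans (XF _ (measurable_itv _)) F0.
  - by move=> w /= /negP; rewrite -ltNge in_itv.
by apply: filterS2 (ge0 _ _ (a_law k) FA_ge0) (ge0 _ _ (s_law k) FS_ge0) => w; split.
Qed.

Let raw_le (r : 'I_n -> R) t z (w : T) :=
  `[< (jobs_in_system (start_with r) (a^~ w) (s^~ w) t <= z%:E)%E >].

Lemma measurable_raw_le r t z : measurable_fun setT (raw_le r t z).
Proof.
apply: (measurable_jobs_in_system_le (r := fun i _ => r i)).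
- by move=> i; exact: measurable_cst.
- by move=> k; exact: measurable_funPT.
- by move=> k; exact: measurable_funPT.
Qed.

Local Notation mixed := (mix (predC is_primitive)).

Let bm_jobs t z : bounded_measurable (fun w : W => (jobs_le p t z w)%:R : R).
Proof. by apply: bm_indicator; exact: measurable_jobs_le. Qed.

(** Primitives are resampled while the residuals of [w] stay, so this is the probability for one
    deterministic initial condition. [jobs_le] reads positive parts, which agree almost surely with
    the given primitives. *)
Lemma Ex_jobs_given_residuals t z (w : W) :
  Ex mu (fun w' => (jobs_le p t z (mixed w w'))%:R) =
  fine (P [set om | (jobs_in_system (start p w) (a^~ om) (s^~ om) t <= z%:E)%E]).
Proof.
have bm : bounded_measurable (fun w' : W => (jobs_le p t z (mixed w w'))%:R : R).
  exact: bm_mix (bm_jobs t z).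
rewrite Ex_mu//; last first.
  move=> w1 w2 e; congr ((jobs_le p t z _)%:R); apply/funext => i.
  by rewrite /mix /predC /=; case: (boolP (is_primitive i)) => // /e.
pose r (i : 'I_n) := w (server_coord i 0).
pose pos_le om := `[< (jobs_in_system (start_with r) (fun k => Num.max (a k om) 0%R)
  (fun k => Num.max (s k om) 0%R) t <= z%:E)%E >].
have mp : measurable_fun setT pos_le.
  apply: (measurable_jobs_in_system_le (r := fun i _ => r i)
    (a := fun k om => Num.max (a k om) 0) (s := fun k om => Num.max (s k om) 0)).
  - by move=> i; exact: measurable_cst.
  - by move=> k; apply: measurable_maxr; [exact: measurable_funPT|exact: measurable_cst].
  - by move=> k; apply: measurable_maxr; [exact: measurable_funPT|exact: measurable_cst].
have mr := measurable_raw_le r t z.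
have mset (b : T -> bool) : measurable_fun setT b -> measurable [set om | b om].
  by move=> mb; have := mb measurableT [set true] I; rewrite setTI.
have same om : (forall k, 0 <= a k om /\ 0 <= s k om) -> pos_le om = raw_le r t z om.
  move=> h.
  have ea : (fun k => Num.max (a k om) 0) = a^~ om.
    by apply/funext => k; apply/max_idPl; case: (h k).
  have es : (fun k => Num.max (s k om) 0) = s^~ om.
    by apply/funext => k; apply/max_idPl; case: (h k).
  by rewrite /pos_le ea es.
have e : P [set om | pos_le om] = P [set om | raw_le r t z om].
  apply/le_anti/andP; split; apply: ae_le_measure; try exact: mset.
    by apply: filterS primitives_ge0 => om h /=; rewrite same.
  by apply: filterS primitives_ge0 => om h /=; rewrite same.
transitivity (Pr P pos_le) => //.
rewrite (_ : [set om | _] = [set om | raw_le r t z om]); last first.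
  by apply/seteqP; split=> om /= h; apply/asboolP.
by rewrite -e PrE.
Qed.

(** For each residual vector the conditional probability tends to the same limit by the steady-state
    hypothesis, and dominated convergence passes this to the average, for which [beta] is a lower
    bound. *)
Lemma steady_cdf_ge (beta z : R) (t_ : nat -> R) : {for z, continuous (cdf Q)} ->
  t_ @ \oo --> +oo -> (forall k, beta <= Pr mu (jobs_le p (t_ k) z)) ->
  beta <= fine (cdf Q z).
Proof.
move=> cz t_oo hb.
pose f k w := Ex mu (fun w' => (jobs_le p (t_ k) z (mixed w w'))%:R).
have bf k : bounded_measurable (f k) by exact: bm_Ex_mix (bm_jobs (t_ k) z).
have h : Ex mu (f k) @[k --> \oo] --> Ex mu (fun=> fine (cdf Q z)).
  apply: (cvg_Ex (C := 1)) => [k||k w|w].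
  - by case: (bf k).
  - exact: measurable_cst.
  - rewrite ger0_norm; last by apply: Ex_ge0 => w'.
    apply: Ex_le => [|w']; first exact: bm_mix (bm_jobs (t_ k) z).
    by case: (jobs_le _ _ _ _).
  - under eq_fun do rewrite /f Ex_jobs_given_residuals.
    apply: fine_cvg; rewrite fineK; last exact: fin_num_measure.
    exact: (cvg_comp _ _ t_oo (Q_steady (start p w) cz)).
rewrite Ex_cst in h.
rewrite -(cvg_lim _ h)//; apply: limr_ge; first by apply/cvg_ex; exists (fine (cdf Q z)).
apply: nearW => k; apply: le_trans (hb k) _.
by rewrite /Pr (Ex_mix mu_law (predC is_primitive) (bm_jobs (t_ k) z)).
Qed.

End SteadyLimit.

Section RandomVariableLaw.
Context d (T : measurableType d) (R : realType) (P : probability T R).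

Lemma Ex_distribution (X : {RV P >-> R}) (g : R -> R) : bounded_measurable g ->
  Ex (distribution P X) g = Ex P (g \o X).
Proof.
move=> [mg [C gC]]; rewrite /Ex /Rintegral; congr fine.
rewrite integral_distribution//; first exact/measurable_EFinP.
apply: (@bm_integrable _ _ _ _ (g \o X)); split; last by exists C => t; exact: gC.
exact: measurableT_comp mg (measurable_funPT X).
Qed.

Section Quotient.
Context (X : {RV P >-> R}) (c : R).

Definition quotient_rv (w : T) : R := X w / c.

Lemma measurable_quotient_rv : measurable_fun setT quotient_rv.
Proof. by apply: measurable_funM => //; exact: measurable_cst. Qed.

HB.instance Definition _ := isMeasurableFun.Build _ _ _ _ quotient_rv measurable_quotient_rv.

End Quotient.

Lemma distribution_ge0 (X : {RV P >-> R}) : (forall w, 0 <= X w) ->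
  distribution P X `]-oo, 0[%classic = 0%E.
Proof.
move=> X0; rewrite /distribution /pushforward (_ : _ @^-1` _ = set0) ?measure0//.
by apply/seteqP; split=> w //=; rewrite in_itv/= ltNge X0.
Qed.

End RandomVariableLaw.

Section SecondMoment.
Context d (T : measurableType d) (R : realType) (P : probability T R).
Context (X : {RV P >-> R}) (c : R).
Hypotheses (X_ge0 : forall w, 0 <= X w) (EX : ('E_P[X] = 1)%E) (c_gt0 : 0 < c).
Hypothesis X2 : ('E_P[(fun w => X w `^ (1 + 1))%R] < +oo)%E.

Lemma laplace_quotient_lt1 : Ex P (fun w => expR (- quotient_rv X c w)) < 1.
Proof.
set q := fine 'E_P[(fun w => X w `^ (1 + 1))%R].
have q0 : 0 <= q by apply: fine_ge0; apply: expectation_ge0 => w; exact: powR_ge0.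
(* At level k c = c + 2q the truncated mean of X loses at most q / (k c) <= 1/2. *)
pose k := 1 + 2 * q / c.
have k1 : 1 <= k by rewrite lerDl divr_ge0 ?mulr_ge0// ltW.
have k0 : 0 < k by apply: lt_le_trans k1.
have Y0 w : 0 <= quotient_rv X c w by rewrite divr_ge0 ?(ltW c_gt0).
suff /(laplace_bounds Y0 k1) : 0 < Ex P (fun w => Num.min (quotient_rv X c w) k).
  by case/andP; rewrite subr_gt0.
have kc : 0 < k * c by rewrite mulr_gt0.
have -> : Ex P (fun w => Num.min (quotient_rv X c w) k) =
    c^-1 * Ex P (fun w => Num.min (X w) (k * c)).
  rewrite -ExZ; last exact: bm_min_rv X_ge0 _ (ltW kc).
  apply: eq_Ex => w; rewrite /quotient_rv [RHS]mulrC minr_pMl ?invr_ge0 ?(ltW c_gt0)//.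
  by rewrite mulfK ?gt_eqF.
rewrite mulr_gt0 ?invr_gt0//.
have := truncated_mean_ge X_ge0 EX kc ltr01 X2; rewrite -/q powRN powRr1 ?(ltW kc)//.
have : (k * c)^-1 * q <= 2^-1.
  by rewrite mulrC ler_pdivrMr// /k mulrDl mulfVK ?gt_eqF//; have := c_gt0; lra.
lra.
Qed.

End SecondMoment.

Lemma cvg_window_length (R : realType) (B x : R) : 0 < B -> 0 < x ->
  window_length B x @ \oo --> +oo.
Proof.
move=> B0 x0; have c0 : 0 < x / (2 * B) by rewrite divr_gt0 ?mulr_gt0.
apply/cvgryPge => M; near=> k.
apply: le_trans (_ : x / (2 * B) * k%:R <= _); last first.
  by rewrite /window_length ler_pM2l// -natrX ler_nat ltnW//; exact: ltn_expl.
by rewrite mulrC -ler_pdivrMr//; near: k; exact: nbhs_infty_ger.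
Unshelve. all: by end_near. Qed.

Theorem theorem1 (R : realType)
    (d0 : measure_display) (T0 : measurableType d0) (P0 : probability T0 R)
    (A S : {RV P0 >-> R}) (eps : R)
    (A_ge0 : forall w, 0 <= A w) (S_ge0 : forall w, 0 <= S w)
    (EA : 'E_P0[A]%E = 1%E) (ES : 'E_P0[S]%E = 1%E)
    (EA2 : ('E_P0[(fun w => A w ^+ 2)%R] < +oo)%E)
    (eps_gt0 : 0 < eps) (eps_le1 : eps <= 1)
    (ESeps : ('E_P0[(fun w => S w `^ (1 + eps))%R] < +oo)%E)
    (B : R) (B_gt0 : 0 < B) (n : nat) (n_gt : 4 * B ^+ 2 < n%:R)
    (d : measure_display) (T : measurableType d) (P : probability T R)
    (a s : nat -> {RV P >-> R})
    (as_law : GI_GI_primitives P0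
                (fun w => A w / arrival_rate n B 2) S a s)
    (d1 : measure_display) (T1 : measurableType d1) (P1 : probability T1 R)
    (Q : {RV P1 >-> R}) (Q_steady : steady_state n a s Q)
    (x : R) (x_ge16 : 16 <= x) :
  (P1 [set w | (x <= n%:R `^ (- 2^-1) * queue_length n (Q w))%R] <=
    (10 ^+ 100
     * (eps * (1 - fine 'E_P0[(fun w => expR (- S w))%R])) ^- 7
     * (10 * fine 'E_P0[(fun w => S w `^ (1 + eps))%R]) `^ eps^-1
     * (1 + fine 'V_P0[A])
     * (B^-1 + B ^- 2)
     * x `^ (- (eps / (1 + eps))))%:E)%E.
Proof.
case: n n_gt as_law Q_steady => [|p] n_gt as_law Q_steady.
  by have := lt_le_trans n_gt (mulr_ge0 (ler0n R 4) (sqr_ge0 B)); rewrite ltxx.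
pose r : R := Num.sqrt p.+1%:R.
have r2 : r ^+ 2 = p.+1%:R by rewrite sqr_sqrtr.
have r0 : 0 < r by rewrite sqrtr_gt0.
have r1 : 1 <= r by rewrite -sqrtr1 ler_sqrt// ler1n.
(* The hypothesis n > 4 B^2 after taking square roots; it also makes the arrival rate positive. *)
have Br : 2 * B < r.
  rewrite -(@ltr_pXn2r _ 2) ?nnegrE ?mulr_ge0 ?(ltW B_gt0) ?(ltW r0)// r2 exprMn.
  by rewrite -natrX.
have lamE : arrival_rate p.+1 B 2 = p.+1%:R - B * r.
  by rewrite /arrival_rate powR12_sqrt.
set lam := arrival_rate p.+1 B 2 in as_law lamE *.
have lam_gt0 : 0 < lam by rewrite lamE -r2 expr2 -mulrBl mulr_gt0//; have := B_gt0; lra.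
have lam_le : lam <= r ^+ 2 by rewrite lamE r2 gerBl mulr_ge0 ?ltW.
have [a_law s_law as_indep] := as_law.
have X2 : ('E_P0[(fun w => A w `^ (1 + 1))%R] < +oo)%E.
  rewrite (_ : (fun w => A w `^ (1 + 1)) = (fun w => A w ^+ 2))//.
  by apply/funext => w; rewrite (powR_mulrn 2 (A_ge0 w)).
pose FA := distribution P0 (quotient_rv A lam).
pose FS := distribution P0 S.
pose FE := excess_law S_ge0 ES eps_gt0 ESeps.
have [mu [mu_law Ex_mu]] := queue_space (FA := FA) (FS := FS) FE a_law s_law as_indep p.+1.
pose m := fine 'E_P0[(fun w => S w `^ (1 + eps))%R].
have m_ge : 2^-1 <= m := moment_ge_half S_ge0 ES eps_gt0 eps_le1 ESeps.
have maxS w : Num.max (S w) 0 = S w by apply/max_idPl.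
have minS v : Ex FS (fun z => Num.min (Num.max z 0) v) = Ex P0 (fun w => Num.min (S w) v).
  by rewrite (Ex_distribution S (bm_min_pos v)); apply: eq_Ex => w /=; rewrite maxS.
have expS : Ex FS (fun z => expR (- Num.max z 0)) = fine 'E_P0[(fun w => expR (- S w))%R].
  rewrite (Ex_distribution S (bm_exp_pos R)) unlock /Ex /Rintegral.
  by congr fine; apply: eq_integral => w _ /=; rewrite maxS.
have minA c : 0 <= c ->
    Ex FA (fun z => Num.min (lam * Num.max z 0) c) = Ex P0 (fun w => Num.min (A w) c).
  move=> c0; rewrite (Ex_distribution _ (bm_min_scaled (ltW lam_gt0) c0)).
  apply: eq_Ex => w /=; rewrite (max_idPl _) ?divr_ge0 ?(ltW lam_gt0)//.
  by rewrite mulrC divfK ?gt_eqF.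
have tailS c : 0 < c ->
    1 - Ex FS (fun z => Num.min (Num.max z 0) c) <= c `^ (- eps) * m.
  by move=> c0; rewrite minS; exact: (truncated_mean_ge S_ge0 ES c0 eps_gt0 ESeps).
set phi := fine 'E_P0[(fun w => expR (- S w))%R] in expS *.
have /andP[phi_lt phi_ge] : 0 < 1 - phi <= 1.
  have cl1 := cut_level_ge1 eps_gt0 1 m_ge; rewrite -expS (Ex_distribution S (bm_exp_pos R)).
  rewrite (eq_Ex _ (g := fun w => expR (- S w))); last by move=> w /=; rewrite maxS.
  apply: (laplace_bounds S_ge0 cl1); rewrite -minS.
  apply: lt_le_trans (mean_cut_ge_half eps_gt0 m_ge (tailS _ (lt_le_trans ltr01 cl1))).
  by rewrite invr_gt0.
have phi1 : Ex FS (fun z => expR (- Num.max z 0)) < 1 by rewrite expS -subr_gt0.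
have psi1 : Ex FA (fun z => expR (- Num.max z 0)) < 1.
  rewrite (Ex_distribution _ (bm_exp_pos R)).
  rewrite (eq_Ex _ (g := fun w => expR (- quotient_rv A lam w))).
    exact: laplace_quotient_lt1 A_ge0 EA lam_gt0 X2.
  by move=> w /=; rewrite (max_idPl _) ?divr_ge0 ?(ltW lam_gt0).
have residual_law v : 0 <= v -> Ex FE (fun z => (Num.max z 0 <= v)%R%:R) =
    Ex FS (fun z => Num.min (Num.max z 0) v).
  move=> v0; rewrite minS.
  have mb : measurable_fun setT (fun z : R => Num.max z 0 <= v).
    by apply: measurable_fun_ler => //; exact: measurable_maxr.
  apply: EFin_inj; apply: etrans (esym (PrE FE mb)) _.
  rewrite (_ : [set z | _] = `]-oo, v]%classic); last first.
    by apply/seteqP; split=> z /=; rewrite in_itv/= ge_max v0 andbT.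
  by rewrite excess_lawE /excess_cdf (max_idPl v0).
have mean_le c : 1 <= c -> Ex FA (fun z => Num.min (lam * Num.max z 0) c) <= 1.
  move=> c1; have c0 : 0 <= c by apply: le_trans c1.
  by rewrite minA//; exact: truncated_mean_le.
have mean_ge c : 1 <= c -> 1 - Ex FA (fun z => Num.min (lam * Num.max z 0) c) <=
    fine 'E_P0[(fun w => A w `^ (1 + 1))%R] / c.
  move=> c1; have c0 : 0 < c by apply: lt_le_trans c1.
  rewrite (minA _ (ltW c0)); apply: le_trans (truncated_mean_ge A_ge0 EA c0 ltr01 X2) _.
  by rewrite powRN powRr1 ?(ltW c0)// mulrC.
have variance_le c : 1 <= c ->
    Ex FA (fun z => (Ex FA (fun z => Num.min (lam * Num.max z 0) c) -
      Num.min (lam * Num.max z 0) c) ^+ 2) <= fine 'V_P0[A].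
  move=> c1; have c0 : 0 <= c by apply: le_trans c1.
  have bz : bounded_measurable (fun z : R =>
      (Ex FA (fun z => Num.min (lam * Num.max z 0) c) - Num.min (lam * Num.max z 0) c) ^+ 2).
    by apply: bmX; apply: bmB; [exact: bm_cst|exact: bm_min_scaled (ltW lam_gt0) c0].
  rewrite (Ex_distribution _ bz) minA//; apply: le_trans (truncated_variance_le A_ge0 EA c1 EA2).
  rewrite le_eqVlt; apply/predU1P; left; apply: eq_Ex => w /=.
  rewrite (max_idPl _) ?divr_ge0 ?(ltW lam_gt0)//.
  by rewrite [lam * _]mulrC divfK ?gt_eqF.
have ratio_gt1 : 1 < 8 * r / B by rewrite ltr_pdivlMr//; have := B_gt0; lra.
have [N [N_ge N_le]] := dyadic_level ratio_gt1.
have rx0 : 0 < r * x by rewrite mulr_gt0// (lt_le_trans _ x_ge16).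
pose Y := Num.truncn (r * x / 4).
have /andP[Y_le Y_gt] := truncn_itv (divr_ge0 (ltW rx0) (ler0n R 4)).
rewrite -/Y -[Y.+1%:R]natr1 in Y_le Y_gt.
have gap : p.+1%:R + Y%:R < p.+1%:R + r * x.
  by rewrite ltrD2l; apply: le_lt_trans Y_le _; lra.
(* Convergence is available at continuity points only; Y <= r x / 4 < r x leaves room for one
   between n + Y and n + r x. *)
have [z /andP[Yz zx] cz] := exists_continuity_point Q gap.
set bound := (X in (_ <= X%:E)%E).
have lower K : 1 - bound <= Pr mu (jobs_le p (window_length B x K) z).
  apply: le_trans (_ : Pr mu (jobs_le p (window_length B x K) (p.+1 + Y)%:R) <= _); last first.
    apply: le_Pr; [exact: measurable_jobs_le|exact: measurable_jobs_le|move=> w].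
    by move=> /asboolP h; apply/asboolP; apply: le_trans h _; rewrite lee_fin natrD ltW.
  apply: le_trans (finite_time_bound mu_law residual_law phi1 eps_gt0 eps_le1 m_ge tailS psi1
    (ltW lam_gt0) B_gt0 r0 r2 lamE mean_le mean_ge variance_le K x_ge16 N_ge Y_gt).
  rewrite lerD2l lerN2 /window_failure expS -r2.
  have P_le : (2 ^ N)%:R <= 16 * r / B.
    by apply: le_trans N_le _; rewrite !mulrA -natrM.
  have A0_ge1 := cut_scale_ge1 eps_gt0 m_ge.
  have A01 : cut_scale eps m <= (10 * m) `^ eps^-1.
    have m0 : 0 <= m by apply: le_trans m_ge.
    apply: ge0_ler_powR; rewrite ?invr_ge0 ?nnegrE ?mulr_ge0 ?(ltW eps_gt0)//.
    by apply: ler_wpM2r => //; rewrite ler_nat.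
  have s2 : 0 <= fine 'V_P0[A] by apply: fine_ge0; exact: variance_ge0.
  have C0 : 0 <= 7000 * 20 ^+ 4 :> R := mulr_ge0 (ler0n R _) (exprn_ge0 4 (ler0n R 20)).
  have C1 : 0 <= 16000 :> R := ler0n R _.
  have h := sum_failure_le B_gt0 r1 Br x_ge16 P_le lam_le eps_gt0 eps_le1
    (le_trans ler01 A0_ge1) phi_lt s2 K.+1 (le_trans A0_ge1 A01) A01 phi_ge C0
    C1 (ler0n R 64).
  apply: le_trans h _; rewrite /bound -/m -/(tail_exponent eps).
  rewrite [leRHS](_ : _ = 10 ^+ 100 * ((eps * (1 - phi)) ^- 7 * (10 * m) `^ eps^-1 *
    (1 + fine 'V_P0[A]) * (B^-1 + B ^- 2) * x `^ (- tail_exponent eps)));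
    last by rewrite !mulrA.
  (* The constant delivered by [sum_failure_le] is about 2 * 10^13, far below 10^100. *)
  apply: ler_wpM2r; last by clear; lra.
  rewrite mulr_ge0 ?powR_ge0// mulr_ge0 ?addr_ge0 ?invr_ge0 ?exprn_ge0 ?(ltW B_gt0)//.
  rewrite mulr_ge0 ?addr_ge0// mulr_ge0 ?powR_ge0// invr_ge0 exprn_ge0//.
  exact: mulr_ge0 (ltW eps_gt0) (ltW phi_lt).
have final : fine (cdf Q z) >= 1 - bound.
  have wl_oo := cvg_window_length B_gt0 (lt_le_trans (ltr0n R 16) x_ge16).
  apply: (steady_cdf_ge (FA := FA) (FS := FS) a_law s_law _ _ mu_law Ex_mu Q_steady cz wl_oo lower).
    by apply: distribution_ge0 => w; rewrite divr_ge0 ?(ltW lam_gt0).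
  exact: distribution_ge0.
apply: le_trans (_ : ccdf Q z <= _)%E; last first.
  have fin : cdf Q z \is a fin_num by exact: fin_num_measure.
  by rewrite ccdf_1_cdf -(fineK fin) -EFinB lee_fin lerBlDr -lerBlDl.
have scaleE q : (x <= p.+1%:R `^ (- 2^-1) * queue_length p.+1 q) =
    (r * x <= Num.max (q - p.+1%:R) 0).
  by rewrite powRN powR12_sqrt// -/r mulrC ler_pdivlMr// [x * r]mulrC.
apply: le_measure; rewrite ?inE.
- rewrite (_ : [set w | _] = [set w | r * x <= Num.max (Q w - p.+1%:R) 0]); last first.
    by apply/seteqP; split=> w /=; rewrite scaleE.
  have mQ : measurable_fun setT (fun w => r * x <= Num.max (Q w - p.+1%:R) 0).
    apply: measurable_fun_ler => //; apply: measurable_maxr => //.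
    by apply: measurable_funB => //; exact: measurable_funPT.
  by have := mQ measurableT [set true] I; rewrite setTI.
- exact: measurable_funPTI.
move=> w /=; rewrite in_itv/= andbT scaleE => hx; apply: lt_le_trans zx _.
have := lt_le_trans rx0 hx; rewrite lt_max ltxx orbF => q0.
by move: hx; rewrite (max_idPl (ltW q0)) lerBrDl.
Qed.
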